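(* Let $m$ be odd and let $g\in C^1(\partial\mathbb{B})$ be $\mathbb{R}_{0,m}$-valued. Then the Dirichlet problem $$\partial_{\underline{x}} f\,\partial_{\underline{x}}=0\ \text{ in }\mathbb{B},\qquad f=g\ \text{ on }\partial\mathbb{B}$$ has a unique solution $f\in C^2(\mathbb{B})\cap C(\overline{\mathbb{B}})$, and it is given by $$f(\underline{x})=\tfrac12(1-\|\underline{x}\|^2)\,\Psi^{-1}\big(\partial_{\underline{x}}\mathcal{P}[g]\,\partial_{\underline{x}}\big)(\underline{x})+\mathcal{P}[g](\underline{x}),\qquad \underline{x}\in\mathbb{B}.$$
   Context: $\mathbb{R}_{0,m}$ is the real associative Clifford algebra generated by the orthonormal basis $e_1,\dots,e_m$ of $\mathbb{R}^m$ with $e_i^2=-1$, $e_ie_j=-e_je_i$ for $i\ne j$; elements are $a=\sum_A a_Ae_A$ with $A$ ranging over ordered subsets of $\{1,\dots,m\}$, $a_A\in\mathbb{R}$; smoothness of functions is componentwise. The $p$-vector part is $[a]_p=\sum_{|A|=p}a_Ae_A$. The Dirac operator is $\partial_{\underline{x}}=\sum_{i=1}^m e_i\partial_{x_i}$, so $\partial_{\underline{x}} f\,\partial_{\underline{x}}=\sum_{i,j} e_i(\partial_{x_i}\partial_{x_j}f)e_j$. The operator $\Psi:\mathbb{R}_{0,m}\to\mathbb{R}_{0,m}$, $\Psi(a)=\sum_{j=1}^m e_jae_j$, is bijective for $m$ odd, with inverse $\Psi^{-1}(a)=\sum_{p=0}^m\frac{(-1)^{p+1}}{m-2p}[a]_p$,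 and is applied pointwise to functions. $\mathbb{B}$ is the open unit ball of $\mathbb{R}^m$ centered at $0$, and $$\mathcal{P}[g](\underline{x})=\frac{1}{|\partial\mathbb{B}|}\int_{\partial\mathbb{B}}\frac{1-\|\underline{x}\|^2}{\|\underline{y}-\underline{x}\|^m}\,g(\underline{y})\,d\underline{y},\qquad \underline{x}\in\mathbb{B},$$ is the Poisson transform ($d\underline{y}$ surface measure, $|\partial\mathbb{B}|$ surface area). *)

(* Defs.v *)
From HB Require Import structures.
From mathcomp Require Import all_boot all_order all_algebra.

Set Implicit Arguments.
Unset Strict Implicit.
Unset Printing Implicit Defensive.

Import Order.TTheory GRing.Theory Num.Theory.

Local Open Scope ring_scope.

Section SymmetricDifference.
Context {T : finType}.
Implicit Types A B C : {set T}.

Definition symdiff A B := [set x | (x \in A) (+) (x \in B)].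

Lemma symdiffA : associative symdiff.
Proof. by move=> A B C; apply/setP => x; rewrite !inE addbA. Qed.

Lemma symdiffC : commutative symdiff.
Proof. by move=> A B; apply/setP => x; rewrite !inE addbC. Qed.

Lemma symdiff0 A : symdiff set0 A = A.
Proof. by apply/setP => x; rewrite !inE. Qed.

Lemma symdiffxx A : symdiff A A = set0.
Proof. by apply/setP => x; rewrite !inE addbb. Qed.

Lemma symdiffK A : cancel (symdiff A) (symdiff A).
Proof. by move=> B; rewrite symdiffA symdiffxx symdiff0. Qed.

Lemma odd_sum_symdiff A B (F : T -> nat) :
  odd (\sum_(i in symdiff A B) F i) =
  odd (\sum_(i in A) F i) (+) odd (\sum_(i in B) F i).
Proof.
rewrite ![(\sum_(i in _) _)%N]big_mkcond !(big_morph _ oddD (erefl : odd 0 = false)).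
rewrite -big_split; apply: eq_bigr => i _; rewrite !inE.
by case: (i \in A); case: (i \in B); rewrite //= ?addbb ?addbF.
Qed.

End SymmetricDifference.

(* e_A e_B = (-1)^inv(A,B) e_(A symdiff B): moving the e_j (j in B) leftwards to
   their place past e_A costs one sign for every i in A with j < i, and each
   square e_i^2 = -1 contributes one more for i = j. *)
Definition blade_inv m (A B : {set 'I_m}) : nat :=
  \sum_(i in A) \sum_(j in B) (j <= i)%N.

Lemma odd_blade_invl m (A B C : {set 'I_m}) :
  odd (blade_inv (symdiff A B) C) = odd (blade_inv A C) (+) odd (blade_inv B C).
Proof. exact: odd_sum_symdiff. Qed.

Lemma odd_blade_invr m (A B C : {set 'I_m}) :
  odd (blade_inv A (symdiff B C)) = odd (blade_inv A B) (+) odd (blade_inv A C).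
Proof.
have E X : blade_inv A X = (\sum_(j in X) \sum_(i in A) (j <= i))%N.
  exact: exchange_big.
by rewrite !E; exact: odd_sum_symdiff.
Qed.

(* The element a = \sum_A a_A e_A is represented by its coefficients a_A. *)
Definition clifford (R : comNzRingType) (m : nat) := {ffun {set 'I_m} -> R^o}.

HB.instance Definition _ (R : comNzRingType) m := GRing.Lmodule.on (clifford R m).

Section Clifford.
Context {R : comNzRingType} {m : nat}.
Implicit Types (a b c : clifford R m) (A B C : {set 'I_m}).

Definition blade A : clifford R m := [ffun B => (B == A)%:R].

Definition clifford_mul a b : clifford R m :=
  [ffun C => \sum_A (-1) ^+ blade_inv A (symdiff A C) * (a A * b (symdiff A C))].

Lemma cliffordE a : a = \sum_A a A *: blade A.
Proof.
apply/ffunP => C; rewrite sum_ffunE (bigD1 C) //= big1 => [|A nAC].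
  by rewrite addr0 !ffunE eqxx /GRing.scale /= mulr1.
by rewrite !ffunE eq_sym (negPf nAC) /GRing.scale /= mulr0.
Qed.

Fact clifford_mulA : associative clifford_mul.
Proof.
move=> a b c; apply/ffunP => D; rewrite !ffunE.
under eq_bigr => A _ do rewrite ffunE mulr_sumr mulr_sumr.
under [RHS]eq_bigr => A _ do rewrite ffunE mulr_suml mulr_sumr.
rewrite [RHS]exchange_big; apply: eq_bigr => A _ /=.
rewrite [RHS](reindex_inj (can_inj (symdiffK A))) /=; apply: eq_bigr => B _.
rewrite symdiffK (symdiffC A B) -symdiffA.
set C := symdiff B (symdiff A D).
have -> : symdiff A D = symdiff B C by rewrite symdiffK.
have sgn2 n1 n2 n3 n4 : odd n1 (+) odd n2 = odd n3 (+) odd n4 ->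
    (-1) ^+ n1 * (-1) ^+ n2 = (-1) ^+ n3 * (-1) ^+ n4 :> R.
  by move=> e; rewrite -!exprD -(signr_odd R (n1 + _)) -(signr_odd R (n3 + _)) !oddD e.
transitivity ((-1) ^+ blade_inv A (symdiff B C) * (-1) ^+ blade_inv B C * (a A * b B * c C)).
  by rewrite -!mulrA; congr (_ * _); rewrite mulrCA !mulrA.
rewrite (sgn2 _ _ (blade_inv (symdiff B A) C) (blade_inv A B)).
  by rewrite !mulrA.
by rewrite odd_blade_invr odd_blade_invl [LHS]addbC [LHS]addbA [LHS]addbAC.
Qed.

Fact clifford_mul1 : left_id (blade set0) clifford_mul.
Proof.
move=> a; apply/ffunP => C; rewrite ffunE (bigD1 set0) //= big1 => [|A nA0].
  by rewrite ffunE eqxx symdiff0 /blade_inv big_set0 !mul1r addr0.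
by rewrite ffunE (negPf nA0) mul0r mulr0.
Qed.

Fact clifford_mulr1 : right_id (blade set0) clifford_mul.
Proof.
move=> a; apply/ffunP => C; rewrite ffunE (bigD1 C) //= big1 => [|A nAC].
  rewrite ffunE symdiffxx eqxx /blade_inv.
  by rewrite big1 ?mul1r ?mulr1 ?addr0 // => i _; rewrite big_set0.
rewrite ffunE; case: eqP => [e|_]; last by rewrite !mulr0.
by case/eqP: nAC; rewrite -(symdiffK A C) e symdiffC symdiff0.
Qed.

Fact clifford_mulDl : left_distributive clifford_mul +%R.
Proof.
move=> a b c; apply/ffunP => C; rewrite !ffunE -big_split; apply: eq_bigr => A _.
by rewrite /= ffunE mulrDl mulrDr.
Qed.

Fact clifford_mulDr : right_distributive clifford_mul +%R.
Proof.
move=> a b c; apply/ffunP => C; rewrite !ffunE -big_split; apply: eq_bigr => A _.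
by rewrite /= ffunE !mulrDr.
Qed.

Fact clifford_1neq0 : blade set0 != 0.
Proof.
by apply/eqP => /ffunP/(_ set0)/eqP; rewrite !ffunE eqxx oner_eq0.
Qed.

HB.instance Definition _ := GRing.Zmodule_isNzRing.Build (clifford R m)
  clifford_mulA clifford_mul1 clifford_mulr1 clifford_mulDl clifford_mulDr
  clifford_1neq0.

Fact clifford_scaleAl (k : R) a b : k *: (a * b) = (k *: a) * b.
Proof.
apply/ffunP => C; rewrite !ffunE /GRing.scale /= mulr_sumr; apply: eq_bigr => A _.
by rewrite ffunE mulrCA !mulrA.
Qed.

HB.instance Definition _ :=
  GRing.Lmodule_isLalgebra.Build R (clifford R m) clifford_scaleAl.

Fact clifford_scaleAr (k : R) a b : k *: (a * b) = a * (k *: b).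
Proof.
apply/ffunP => C; rewrite !ffunE /GRing.scale /= mulr_sumr; apply: eq_bigr => A _.
by rewrite ffunE mulrCA; congr (_ * _); rewrite /GRing.scale /= mulrCA.
Qed.

HB.instance Definition _ :=
  GRing.Lalgebra_isAlgebra.Build R (clifford R m) clifford_scaleAr.

End Clifford.

Section Generators.
Context {R : comNzRingType} {m : nat}.
Implicit Types (A B : {set 'I_m}) (i j : 'I_m).

Definition gen i : clifford R m := blade [set i].

Lemma blade0 : blade set0 = 1 :> clifford R m.
Proof. by []. Qed.

Lemma bladeM A B :
  blade A * blade B = (-1) ^+ blade_inv A B *: blade (symdiff A B) :> clifford R m.
Proof.
apply/ffunP => C; rewrite ffunE (bigD1 A) //= big1 => [|A' nA].
  rewrite addr0 !ffunE eqxx mul1r /GRing.scale /=.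
  have -> : (symdiff A C == B) = (C == symdiff A B).
    by rewrite -(inj_eq (can_inj (symdiffK A))) symdiffK.
  by case: eqP => [->|_]; rewrite ?symdiffK ?mulr0.
by rewrite ffunE (negPf nA) mul0r mulr0.
Qed.

Lemma blade_inv1 i j : blade_inv [set i] [set j] = (j <= i)%N.
Proof. by rewrite /blade_inv !big_set1. Qed.

Lemma gen_sqr i : gen i * gen i = -1.
Proof. by rewrite bladeM blade_inv1 leqnn symdiffxx scaleN1r. Qed.

Lemma gen_anticomm i j : i != j -> gen i * gen j = - (gen j * gen i).
Proof.
move=> nij; rewrite !bladeM !blade_inv1 (symdiffC [set j]) -scaleNr.
move: nij; rewrite -(inj_eq val_inj) /=.
by case: ltngtP => //= _ _; rewrite ?expr1 ?expr0 ?opprK.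
Qed.

Lemma blade_prod A : blade A = \prod_(i in A) gen i.
Proof.
rewrite -big_filter; set s := [seq _ <- _ | _].
have -> : A = [set i in s].
  by apply/setP => i; rewrite inE mem_filter mem_index_enum andbT.
have : sorted (fun i j : 'I_m => i < j)%N s.
  apply: sorted_filter => [? ? ?|]; first exact: ltn_trans.
  by have := iota_ltn_sorted 0 m; rewrite -val_enum_ord sorted_map enumT.
elim: s => [_|i s IH /=]; first by rewrite big_nil; congr blade; apply/setP => i; rewrite !inE.
rewrite path_sortedE => [/andP[/allP lts /IH {}IH]|? ? ?]; last exact: ltn_trans.
rewrite big_cons -IH bladeM (_ : blade_inv _ _ = 0%N) ?scale1r.
  congr blade; apply/setP => j; rewrite !inE.
  by case: eqP => [->|//]; case: (boolP (i \in s)) => // /lts; rewrite ltnn.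
rewrite /blade_inv big_set1 big1 // => j; rewrite inE => /lts ltij.
by rewrite leqNgt ltij.
Qed.

End Generators.

Section Psi.
Context {R : numFieldType} {m : nat}.
Implicit Types (a : clifford R m) (A : {set 'I_m}).

Definition grade (p : nat) a : clifford R m :=
  \sum_(A : {set 'I_m} | #|A| == p) a A *: blade A.

Definition psi a : clifford R m := \sum_j gen j * a * gen j.

Definition psi_inv a : clifford R m :=
  \sum_(p < m.+1) ((-1) ^+ p.+1 / (m%:R - (2 * p)%:R)) *: grade p a.

Lemma gradeE p a A : grade p a A = if #|A| == p then a A else 0.
Proof.
rewrite sum_ffunE; case: eqP => [e|ne]; last first.
  rewrite big1 // => B /eqP eB; rewrite !ffunE; case: eqP => [E|_].
    by case: ne; rewrite E.
  by rewrite /GRing.scale /= mulr0.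
rewrite (bigD1 A) /= ?e // big1 => [|B /andP[_ nAB]].
  by rewrite !ffunE eqxx /GRing.scale /= mulr1 addr0.
by rewrite !ffunE eq_sym (negPf nAB) /GRing.scale /= mulr0.
Qed.

Lemma psi_invE a A :
  psi_inv a A = (-1) ^+ #|A|.+1 / (m%:R - (2 * #|A|)%:R) * a A.
Proof.
rewrite sum_ffunE.
have ltA : (#|A| < m.+1)%N by rewrite ltnS -[leqRHS]card_ord max_card.
rewrite (bigD1 (Ordinal ltA)) //= big1 => [|p np].
  by rewrite addr0 ffunE gradeE eqxx.
rewrite ffunE gradeE; case: eqP => [e|_]; last by rewrite /GRing.scale /= mulr0.
by case/eqP: np; apply: val_inj.
Qed.

Lemma gen_sandwich_blade i A :
  gen i * blade A * gen i = (-1) ^+ (#|A| + (i \in A)).+1 *: blade A :> clifford R m.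
Proof.
rewrite bladeM -scalerAl bladeM scalerA [symdiff (symdiff _ _) _]symdiffC symdiffK -exprD.
congr (_ *: _); rewrite -[LHS]signr_odd -[RHS]signr_odd; congr ((-1) ^+ nat_of_bool _).
rewrite oddD odd_blade_invl blade_inv1 leqnn /blade_inv !big_set1.
under [X in _ (+) (_ (+) odd X)]eq_bigr => j _ do rewrite big_set1.
rewrite addbCA -oddD -big_split /= (eq_bigr (fun j => 1 + (j == i))%N).
  rewrite big_split /= sum1_card; congr (~~ odd (_ + _)).
  case: (boolP (i \in A)) => iA.
    by rewrite (bigD1 i) //= eqxx big1 ?addn0 // => j /andP[_ /negPf->].
  by rewrite big1 // => j jA; case: eqP => // ji; rewrite -ji jA in iA.
by move=> j _; rewrite -(inj_eq val_inj) /=; case: ltngtP.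
Qed.

Lemma psiE a A : psi a A = (-1) ^+ #|A|.+1 * (m%:R - (2 * #|A|)%:R) * a A.
Proof.
rewrite /psi.
have -> : \sum_j gen j * a * gen j =
    \sum_B (a B * ((-1) ^+ #|B|.+1 * (m%:R - (2 * #|B|)%:R))) *: blade B.
  under eq_bigr => j _.
    rewrite [X in gen j * X](cliffordE a) mulr_sumr mulr_suml.
    under eq_bigr => B _ do
      rewrite -scalerAr -scalerAl gen_sandwich_blade scalerA.
    over.
  rewrite exchange_big; apply: eq_bigr => B _ /=.
  rewrite -scaler_suml -mulr_sumr; congr ((_ * _) *: _).
  under eq_bigr => j _ do rewrite -addSn exprD.
  rewrite -mulr_sumr; congr (_ * _).
  rewrite (eq_bigr (fun j => 1 - ((j \in B)%:R *+ 2))) => [|j _].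
    rewrite sumrB sumr_const card_ord sumrMnl; congr (_ - _).
    by rewrite -natr_sum -big_mkcond /= sum1_card natrM mulr_natl.
  by case: (j \in B); rewrite ?expr1 ?expr0 ?mul0rn ?subr0 // mulr2n opprD addNKr.
rewrite sum_ffunE (bigD1 A) //= big1 => [|B nB].
  by rewrite addr0 !ffunE eqxx /GRing.scale /= mulr1 mulrC.
by rewrite !ffunE eq_sym (negPf nB) /GRing.scale /= mulr0.
Qed.

Lemma odd_sub_double_neq0 A : odd m -> m%:R - (2 * #|A|)%:R != 0 :> R.
Proof.
move=> om; rewrite subr_eq0 eqr_nat; apply: contraTneq om => ->.
by rewrite mul2n odd_double.
Qed.

Lemma psiK : odd m -> cancel psi psi_inv.
Proof.
move=> om a; apply/ffunP => A; rewrite psi_invE psiE.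
have n0 := odd_sub_double_neq0 A om.
by rewrite -!mulrA (mulrCA _^-1) mulKf // mulrA -expr2 sqrr_sign mul1r.
Qed.

Lemma psi_invK : odd m -> cancel psi_inv psi.
Proof.
move=> om a; apply/ffunP => A; rewrite psiE psi_invE.
have n0 := odd_sub_double_neq0 A om.
by rewrite -!mulrA (mulrCA (_ - _)) mulVKf // mulrA -expr2 sqrr_sign mul1r.
Qed.

End Psi.

(* Loaded only here: above, set0 and [set x | P] denote finite sets. *)
From mathcomp Require Import all_classical all_reals all_analysis.

Import numFieldNormedType.Exports.

Local Open Scope classical_set_scope.
Local Open Scope ring_scope.

Section EuclideanSpace.
Context {R : realType} {m : nat}.
Implicit Types x y : 'rV[R]_m.

(* The library norm on 'rV[R]_m is the sup norm; only its topology is used. *)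
Definition enorm x : R := Num.sqrt (\sum_i x 0 i ^+ 2).

Definition unit_ball : set 'rV[R]_m := [set x | enorm x < 1].
Definition unit_sphere : set 'rV[R]_m := [set x | enorm x = 1].

Definition ediam (A : set 'rV[R]_m) : \bar R :=
  ereal_sup [set (enorm (p.1 - p.2))%:E | p in A `*` A].

End EuclideanSpace.

(* mu_ext takes infima over covers by measurable sets; this alias makes every set
   measurable, so that arbitrary covers are allowed. *)
Definition arbitrary_sets (T : Type) := T.

HB.instance Definition _ (T : pointedType) := Pointed.on (arbitrary_sets T).
HB.instance Definition _ (T : pointedType) :=
  @isMeasurable.Build default_measure_display (arbitrary_sets T)
    discrete_measurable discrete_measurable0 discrete_measurableC
    discrete_measurableU.

(* Volume of the unit ball of R^n, by omega_n = (2 pi / n) omega_(n-2). *)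
Fixpoint ball_volume {R : realType} (n : nat) : R :=
  match n with
  | 0 => 1
  | 1 => 2
  | k.+2 => 2 * pi / k.+2%:R * ball_volume k
  end.

Section Hausdorff.
Local Open Scope ereal_scope.
Context {R : realType} {m : nat}.
Variable s : nat.
Implicit Types (A : set 'rV[R]_m) (d : R).

(* A set of diameter at most d is charged vol(B_s) (diam/2)^s, the empty set 0,
   and a set of larger diameter +oo. The factor vol(B_s) / 2^s makes the
   s-dimensional measure agree with the Lebesgue measure on R^s and with the
   surface measure on s-dimensional surfaces. *)
Definition hausdorff_gauge d (A : set (arbitrary_sets 'rV[R]_m)) : \bar R :=
  if A == set0 then 0
  else if ediam A <= d%:E then
    (ball_volume s / 2 ^+ s * fine (ediam A) ^+ s)%:E
  else +oo.

Definition hausdorff A : \bar R :=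
  ereal_sup [set mu_ext (hausdorff_gauge d) A | d in [set d | (0 < d)%R]].

Lemma ball_volume_gt0 n : (0 < ball_volume n :> R)%R.
Proof.
suff: (0 < ball_volume n :> R)%R /\ (0 < ball_volume n.+1 :> R)%R by case.
elim: n => [|n [h0 h1]] /=; first by rewrite ltr01 ltr0n.
by split=> //; rewrite mulr_gt0 // divr_gt0 ?mulr_gt0 ?pi_gt0.
Qed.

Lemma ediam_ge0 A : A !=set0 -> 0 <= ediam A.
Proof.
move=> [x Ax]; apply: ereal_sup_ubound => /=; exists (x, x) => //=.
by rewrite subrr /enorm big1 ?sqrtr0 // => i _; rewrite mxE expr0n.
Qed.

Lemma hausdorff_gauge0 d : hausdorff_gauge d set0 = 0.
Proof. by rewrite /hausdorff_gauge eqxx. Qed.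

Lemma hausdorff_gauge_ge0 d A : 0 <= hausdorff_gauge d A.
Proof.
rewrite /hausdorff_gauge; case: eqP => // /eqP/set0P A0; case: ifP => // _.
rewrite lee_fin; apply: mulr_ge0.
  by rewrite divr_ge0 ?exprn_ge0 ?ltW ?ball_volume_gt0.
by rewrite exprn_ge0 // fine_ge0 // ediam_ge0.
Qed.

Lemma hausdorff0 : hausdorff set0 = 0.
Proof.
rewrite /hausdorff; apply/eqP; rewrite eq_le; apply/andP; split.
  apply: ge_ereal_sup => _ [d _ <-].
  by rewrite (mu_ext0 (hausdorff_gauge0 d) (hausdorff_gauge_ge0 d)).
apply: ereal_sup_ubound; exists 1%R => /=; first exact: ltr01.
exact: (mu_ext0 (hausdorff_gauge0 _) (hausdorff_gauge_ge0 _)).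
Qed.

Lemma hausdorff_ge0 A : 0 <= hausdorff A.
Proof.
apply: (@le_trans _ _ (mu_ext (hausdorff_gauge 1) A)).
  by apply: mu_ext_ge0; exact: hausdorff_gauge_ge0.
by apply: ereal_sup_ubound; exists 1%R => //=; exact: ltr01.
Qed.

Lemma le_hausdorff : {homo hausdorff : A B / A `<=` B >-> A <= B}.
Proof.
move=> A B AB; apply: ge_ereal_sup => _ [d d0 <-].
apply: (@le_trans _ _ (mu_ext (hausdorff_gauge d) B)); first exact: le_mu_ext.
by apply: ereal_sup_ubound; exists d.
Qed.

Lemma hausdorff_sigma_subadditive : sigma_subadditive hausdorff.
Proof.
move=> F; apply: ge_ereal_sup => _ [d d0 <-].
apply: (@le_trans _ _ (\sum_(i <oo) mu_ext (hausdorff_gauge d) (F i))).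
  by apply: mu_ext_sigma_subadditive; exact: hausdorff_gauge_ge0.
apply: lee_nneseries => [i _ _|i _].
  by apply: mu_ext_ge0; exact: hausdorff_gauge_ge0.
by apply: ereal_sup_ubound; exists d.
Qed.

HB.instance Definition _ := isOuterMeasure.Build R 'rV[R]_m hausdorff
  hausdorff0 hausdorff_ge0 le_hausdorff hausdorff_sigma_subadditive.

End Hausdorff.

Definition hausdorff_outer (R : realType) (m s : nat) :
  {outer_measure set 'rV[R]_m -> \bar R} := hausdorff s.

(* The (m-1)-dimensional Hausdorff measure on its Caratheodory-measurable sets,
   which include the Borel sets because the outer measure is metric. *)
Definition surface_measure (R : realType) (m : nat) :
    {measure set (caratheodory_type (hausdorff_outer R m m.-1)) -> \bar R} :=
  hausdorff_outer R m m.-1.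

Section Dirichlet.
Context {R : realType} {m : nat}.
Implicit Types (U : set 'rV[R]_m) (x y : 'rV[R]_m) (f g : 'rV[R]_m -> clifford R m).

Definition partial (i : 'I_m) (u : 'rV[R]_m -> R) x : R := 'D_(delta_mx 0 i) u x.

(* Meant for open U. *)
Fixpoint Ck (k : nat) U (u : 'rV[R]_m -> R) : Prop :=
  {in U, continuous u} /\
  match k with
  | 0 => True
  | k'.+1 => forall i, (forall x, U x -> derivable u x (delta_mx 0 i)) /\
                       Ck k' U (partial i u)
  end.

Definition clifford_Ck (k : nat) U f : Prop :=
  forall A, Ck k U (fun x => f x A).

(* A function on the sphere is C^k when it extends to a C^k function on an open
   neighbourhood of the sphere. *)
Definition sphere_Ck (k : nat) g : Prop :=
  exists U (h : 'rV[R]_m -> clifford R m),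
    [/\ open U, unit_sphere `<=` U, clifford_Ck k U h &
        forall y, unit_sphere y -> h y = g y].

Definition clifford_partial (i : 'I_m) f x : clifford R m :=
  [ffun A => partial i (fun y => f y A) x].

Definition dirac_sandwich f x : clifford R m :=
  \sum_i \sum_j gen i * clifford_partial i (clifford_partial j f) x * gen j.

Definition poisson g x : clifford R m :=
  [ffun A => (fine (surface_measure R m unit_sphere))^-1 *
     (\int[surface_measure R m]_(y in unit_sphere)
        ((1 - enorm x ^+ 2) / enorm (y - x) ^+ m * g y A))].

Definition dirichlet_solution g f : Prop :=
  [/\ clifford_Ck 2 unit_ball f,
      forall A, {within closure unit_ball, continuous (fun x => f x A)},
      forall x, unit_ball x -> dirac_sandwich f x = 0 &
      forall y, unit_sphere y -> f y = g y].

End Dirichlet.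

(* Main.v *)
(* Write D for the Dirac operator and m for the dimension. If u is two-sided
   monogenic (D u = u D = 0), then D ((1 - |x|^2) u) D = - 2 Psi u. If P is
   harmonic, then w = D P D is two-sided monogenic, because D w = - (Delta P) D, and
   for m odd so is Psi^-1 w. Hence 1/2 (1 - |x|^2) Psi^-1 w + P solves the equation.
   It has the boundary values of P = P[g], since (1 - |x|^2) times a second
   derivative of the Poisson integral of C^1 data vanishes at the sphere.

   Conversely, let f be a solution that is smooth across the sphere. Then
   q = Delta f is two-sided monogenic, so is h(x) = -1/2 int_0^1 t^(m-1) q(t^2 x) dt,
   and Delta ((1 - |x|^2) h) = q. So f - (1 - |x|^2) h is harmonic with the boundary
   values of f: it is P[f], and applying D . D to it gives 2 Psi h = D P[f] D. This
   expresses f by its boundary values, and bounds it at a given point by their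
   maximum. A solution that is only continuous up to the boundary is approximated
   by dilations of its averages over small segments; these operations commute with
   D . D up to constant factors. So vanishing boundary values force f = 0. *)
Require Import Defs.
From HB Require Import structures.
From mathcomp Require Import all_boot all_order all_algebra.
From mathcomp Require Import all_classical all_reals all_analysis.
From mathcomp Require Import measurable_realfun zify ring lra.
Set Implicit Arguments.
Unset Strict Implicit.
Unset Printing Implicit Defensive.
Import Order.TTheory GRing.Theory Num.Theory numFieldNormedType.Exports.
Local Open Scope classical_set_scope.
Local Open Scope ring_scope.

(** * The Euclidean norm *)

Section EuclideanNorm.
Context {R : realType} {m : nat}.
Implicit Types (x y z : 'rV[R]_m) (a b r t : R).

(** The equation couples the components of f and no maximum principle for it is at hand, so
    uniqueness rests on the representation formula alone, read as a bound of f(x) by the boundary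
    values. The formula needs h of class C^2, hence Delta f of class C^2 and f of class C^4, whereas
    a solution is only C^2. A round of segment averages in all coordinate directions gains one
    order, so two rounds are made before the dilation.

    Segment averages, dilations and the potential h all have the form int_0^1 w(t) f(s(t) x + v(t))
    dt, so regularity and commutation with derivatives are settled once, for [affine_avg].

    The surface measure is a Hausdorff measure, and no integral over the sphere is ever computed.
    Four facts suffice: the sphere has finite measure, it has positive measure, continuous functions
    on it are measurable, and averages are invariant under reflections. The last one also gives the
    normalisation of the Poisson kernel.

    Oddness of m enters through the eigenvalues of Psi twice: they are nonzero, and they differ from
    2 and -2. *)

Definition dot x y : R := \sum_i x 0 i * y 0 i.

Lemma dotC x y : dot x y = dot y x.
Proof. by apply: eq_bigr => i _; rewrite mulrC. Qed.

Lemma dotDl x y z : dot (x + y) z = dot x z + dot y z.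
Proof. by rewrite /dot -big_split; apply: eq_bigr => i _; rewrite /= mxE mulrDl. Qed.

Lemma dotZl a x y : dot (a *: x) y = a * dot x y.
Proof. by rewrite /dot mulr_sumr; apply: eq_bigr => i _; rewrite mxE mulrA. Qed.

Lemma dotNl x y : dot (- x) y = - dot x y.
Proof. by rewrite -scaleN1r dotZl mulN1r. Qed.

Lemma dotDr x y z : dot x (y + z) = dot x y + dot x z.
Proof. by rewrite dotC dotDl !(dotC x). Qed.

Lemma dotNr x y : dot x (- y) = - dot x y.
Proof. by rewrite dotC dotNl dotC. Qed.

Lemma dotZr a x y : dot x (a *: y) = a * dot x y.
Proof. by rewrite dotC dotZl dotC. Qed.

Lemma dot_ge0 x : 0 <= dot x x.
Proof. by apply: sumr_ge0 => i _; rewrite -expr2 sqr_ge0. Qed.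

Lemma enormE x : enorm x = Num.sqrt (dot x x).
Proof. by congr Num.sqrt; apply: eq_bigr => i _; rewrite expr2. Qed.

Lemma sqr_enorm x : enorm x ^+ 2 = dot x x.
Proof. by rewrite enormE sqr_sqrtr ?dot_ge0. Qed.

Lemma enorm_ge0 x : 0 <= enorm x.
Proof. exact: sqrtr_ge0. Qed.
#[local] Hint Resolve enorm_ge0 : core.

Lemma le_coord_enorm x i : `|x 0 i| <= enorm x.
Proof.
rewrite -(ler_pXn2r (n := 2)) ?nnegrE//= sqr_enorm real_normK ?num_real//.
rewrite /dot (bigD1 i)//= -expr2 lerDl.
by apply: sumr_ge0 => j _; rewrite -expr2 sqr_ge0.
Qed.

Lemma enorm0_eq0 x : enorm x = 0 -> x = 0.
Proof.
move=> x0; apply/rowP => i; rewrite mxE; apply/eqP.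
by rewrite -normr_le0 -x0 le_coord_enorm.
Qed.

Lemma enorm0 : enorm (0 : 'rV[R]_m) = 0.
Proof. by rewrite enormE /dot big1 ?sqrtr0// => i _; rewrite mxE mulr0. Qed.

Lemma enormZ a x : enorm (a *: x) = `|a| * enorm x.
Proof.
by rewrite !enormE dotZl dotZr mulrA -expr2 sqrtrM ?sqr_ge0// sqrtr_sqr.
Qed.

Lemma enormN x : enorm (- x) = enorm x.
Proof. by rewrite -scaleN1r enormZ normrN1 mul1r. Qed.

Lemma enorm_distC x y : enorm (x - y) = enorm (y - x).
Proof. by rewrite -enormN opprB. Qed.

Lemma dot_le_enorm x y : dot x y <= enorm x * enorm y.
Proof.
have [x0|x0] := eqVneq (enorm x) 0.
  by rewrite (enorm0_eq0 x0) enorm0 mul0r /dot big1// => i _; rewrite mxE mul0r.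
(* The vector (x.y) x - |x|^2 y has squared norm |x|^2 (|x|^2 |y|^2 - (x.y)^2). *)
have := dot_ge0 (dot x y *: x - (enorm x ^+ 2) *: y).
rewrite !(dotDl, dotDr, dotNl, dotNr, dotZl, dotZr) -!sqr_enorm (dotC y x) => h.
have x2 : 0 < enorm x ^+ 2 by rewrite exprn_gt0// lt_def x0 enorm_ge0.
have : 0 <= enorm x ^+ 2 * (enorm x ^+ 2 * enorm y ^+ 2 - dot x y ^+ 2) by lra.
rewrite pmulr_rge0// => h2.
apply: le_trans (ler_norm _) _.
by rewrite -(ler_pXn2r (n := 2)) ?nnegrE ?mulr_ge0//= real_normK ?num_real// exprMn -subr_ge0.
Qed.

Lemma enormD x y : enorm (x + y) <= enorm x + enorm y.
Proof.
rewrite -(ler_pXn2r (n := 2)) ?nnegrE ?addr_ge0//= sqr_enorm.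
rewrite dotDl !dotDr sqrrD -!sqr_enorm (dotC y x).
by have := dot_le_enorm x y; lra.
Qed.

Lemma enormB x y : enorm (x - y) <= enorm x + enorm y.
Proof. by rewrite -(enormN y) enormD. Qed.

Lemma enorm_triangle y x z : enorm (x - z) <= enorm (x - y) + enorm (y - z).
Proof. by rewrite (le_trans _ (enormD _ _))// addrA subrK. Qed.

Lemma enorm_dist x y : `|enorm x - enorm y| <= enorm (x - y).
Proof.
rewrite ler_norml; have := enormD (x - y) y; have := enormD (y - x) x.
by rewrite !subrK (enorm_distC y x); lra.
Qed.

Lemma norm_le_enorm x : `|x| <= enorm x.
Proof.
rewrite [leLHS]/Num.norm /= mx_normrE; apply/bigmax_leP; split => // -[i j] _ /=.
by rewrite ord1 le_coord_enorm.
Qed.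

Lemma coord_le_norm x i : `|x 0 i| <= `|x|.
Proof.
rewrite [leRHS]/Num.norm /= mx_normrE; apply/bigmax_geP; right.
by exists (0, i).
Qed.

Lemma enorm_le_sum x : enorm x <= \sum_i `|x 0 i|.
Proof.
rewrite -(ler_pXn2r (n := 2)) ?nnegrE ?sumr_ge0//= sqr_enorm.
rewrite expr2 mulr_suml ler_sum// => i _.
rewrite -expr2 -real_normK ?num_real// expr2 ler_wpM2l//.
by rewrite (bigD1 i)//= lerDl sumr_ge0.
Qed.

Lemma enorm_le_norm x : enorm x <= m%:R * `|x|.
Proof.
rewrite (le_trans (enorm_le_sum x))// mulr_natl.
rewrite -[X in _ *+ X]card_ord -sumr_const ler_sum// => i _.
exact: coord_le_norm.
Qed.

(** The sup norm and the Euclidean norm bound each other up to a factor m, so neighbourhoods may be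
    tested on Euclidean balls. All later epsilon-delta arguments use [enorm] through this
    equivalence. *)
Lemma nbhs_enormP x (P : set 'rV[R]_m) :
  nbhs x P <-> exists2 e, 0 < e & forall y, enorm (y - x) < e -> P y.
Proof.
split=> [/nbhs_ballP[e /= e0 xP]|[e e0 xP]].
  exists e => // y yx; apply: xP; rewrite -ball_normE /ball_/=.
  by rewrite distrC (le_lt_trans _ yx)// norm_le_enorm.
apply/nbhs_ballP; exists (e / m.+1%:R) => /=; first by rewrite divr_gt0.
move=> y; rewrite -ball_normE /ball_/= distrC ltr_pdivlMr// => yx.
apply: xP; rewrite (le_lt_trans (enorm_le_norm _))// (le_lt_trans _ yx)//.
by rewrite mulrC ler_wpM2l// ler_nat.
Qed.

Lemma continuous_enormP (f : 'rV[R]_m -> R) x :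
  {for x, continuous f} <-> forall e, 0 < e -> exists2 d, 0 < d &
    forall y, enorm (y - x) < d -> `|f y - f x| < e.
Proof.
split=> [/cvgrPdist_lt cf e e0|cf].
  have /nbhs_enormP[d d0 dP] := cf e e0.
  by exists d => // y /dP; rewrite distrC.
apply: (@cvgrPdist_lt _ _ _ (nbhs x) _ f (f x)).2 => e /cf [d d0 dP].
by apply/nbhs_enormP; exists d => // y /dP; rewrite distrC.
Qed.

Lemma continuous_within_enormP (K : set 'rV[R]_m) (f : 'rV[R]_m -> R) :
  {within K, continuous f} <-> forall x e, K x -> 0 < e -> exists2 d, 0 < d &
    forall y, K y -> enorm (y - x) < d -> `|f y - f x| < e.
Proof.
rewrite subspace_continuousP; split=> [cf x e Kx e0|cf x Kx].
  have /cvgrPdist_lt/(_ e e0) := cf x Kx.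
  rewrite near_withinE => /nbhs_enormP[d d0 dP].
  by exists d => // y Ky /dP; rewrite distrC => /(_ Ky).
apply/cvgrPdist_lt => e e0; have [d d0 dP] := cf x e Kx e0.
rewrite near_withinE; apply/nbhs_enormP; exists d => // y /[swap] Ky /(dP y Ky).
by rewrite distrC.
Qed.

Lemma continuous_enorm : continuous (@enorm R m).
Proof.
move=> x; apply/continuous_enormP => e e0; exists e => // y.
exact/le_lt_trans/enorm_dist.
Qed.

Definition eball r : set 'rV[R]_m := [set x | enorm x < r].

Lemma open_eball r : open (eball r).
Proof.
rewrite [eball r](_ : _ = enorm @^-1` [set t | t < r])//.
by apply: open_comp => [x _|]; [exact: continuous_enorm|exact: open_lt].
Qed.

Lemma eball_nbhs r x : eball r x -> nbhs x (eball r).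
Proof. by move=> xr; apply: open_nbhs_nbhs; split=> //; exact: open_eball. Qed.

Lemma closed_enorm_le r : closed [set x : 'rV[R]_m | enorm x <= r].
Proof.
rewrite [X in closed X](_ : _ = enorm @^-1` [set t | t <= r])//.
by apply: preimage_closed; [move=> x _; exact: continuous_enorm|exact: closed_le].
Qed.

Lemma compact_enorm_le r : compact [set x : 'rV[R]_m | enorm x <= r].
Proof.
apply: bounded_closed_compact; last exact: closed_enorm_le.
exists r; split; first exact: num_real.
move=> t rt x /= xr; rewrite (le_trans (norm_le_enorm x))//.
by rewrite (le_trans xr)// ltW.
Qed.

Lemma closure_unit_ball :
  closure (unit_ball : set 'rV[R]_m) = [set x | enorm x <= 1].
Proof.
apply/seteqP; split.
  have /closure_id -> := @closed_enorm_le 1.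
  by apply: closure_subset => x /ltW.
move=> x /= x1 B /nbhs_enormP[e e0 xB].
pose t : R := Num.min (e / 2) 1.
have t0 : 0 < t by rewrite lt_min divr_gt0//=.
have t1 : t <= 1 by rewrite ge_min lexx orbT.
have te : t < e by rewrite /t gt_min ltr_pdivrMr// ltr_pMr// ltr1n.
exists ((1 - t) *: x); split.
  rewrite /unit_ball /= enormZ ger0_norm ?subr_ge0//.
  apply: (@le_lt_trans _ _ (1 - t)); last by rewrite ltrBlDr ltrDl.
  by rewrite ler_piMr// subr_ge0.
apply: xB; rewrite scalerBl scale1r addrAC subrr sub0r enormN enormZ gtr0_norm//.
by rewrite (le_lt_trans _ te)// ler_piMr// ltW.
Qed.

End EuclideanNorm.
#[global] Hint Extern 0 (is_true (0 <= enorm _)) => solve [apply: enorm_ge0] : core.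

(** * Hausdorff measure of the sphere *)

Section HausdorffMeasure.
Local Open Scope ereal_scope.
Context {R : realType} {m : nat}.
Variable s : nat.
Implicit Types (A B : set 'rV[R]_m) (d : R).

Lemma ediam_le_image {p : nat} (B : set 'rV[R]_p) (A : set 'rV[R]_m)
    (T : 'rV[R]_m -> 'rV[R]_p) :
  (forall x y, A x -> A y -> (enorm (T x - T y) <= enorm (x - y))%R) ->
  B `<=` T @` A -> ediam B <= ediam A.
Proof.
move=> lipT BA; apply: ge_ereal_sup => _ [[x y] [/= /BA[x' Ax' <-] /BA[y' Ay' <-]] <-].
apply: (@le_trans _ _ (enorm (x' - y'))%:E); first by rewrite lee_fin lipT.
by apply: ereal_sup_ubound; exists (x', y').
Qed.

Lemma le_ediam A B : A `<=` B -> ediam A <= ediam B.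
Proof. by move=> AB; apply: (ediam_le_image (T := id)) => //; rewrite image_id. Qed.

Lemma enorm_le_ediam A x y : A x -> A y -> (enorm (x - y))%:E <= ediam A.
Proof. by move=> Ax Ay; apply: ereal_sup_ubound; exists (x, y). Qed.

Lemma ediam_le A d :
  (forall x y, A x -> A y -> (enorm (x - y) <= d)%R) -> ediam A <= d%:E.
Proof. by move=> Ad; apply: ge_ereal_sup => _ [[x y] [/= Ax Ay] <-]; rewrite lee_fin Ad. Qed.

Lemma le_hausdorff_gauge {p : nat} d (A : set 'rV[R]_p) B :
  (B = set0 -> A = set0) -> ediam A <= ediam B ->
  hausdorff_gauge s d A <= hausdorff_gauge s d B.
Proof.
move=> B0 AB; rewrite {1}/hausdorff_gauge; case: eqP => [_|A0].
  exact: hausdorff_gauge_ge0.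
have nB0 : (B == set0) = false by apply/eqP => /B0.
rewrite /hausdorff_gauge nB0.
have dA := ediam_ge0 (iffLR (@set0P _ A) (introN eqP A0)).
have [Bd|] := leP (ediam B) d%:E; last by rewrite leey.
rewrite (le_trans AB Bd) lee_fin ler_wpM2l//.
  by rewrite divr_ge0// ?exprn_ge0// ltW// ball_volume_gt0.
have finB : ediam B \is a fin_num.
  by rewrite ge0_fin_numE ?(le_trans dA)// (le_lt_trans Bd)// ltry.
have finA : ediam A \is a fin_num.
  by rewrite ge0_fin_numE// (le_lt_trans AB)// -ge0_fin_numE// (le_trans dA).
by rewrite lerXn2r// ?nnegrE ?fine_ge0// ?(le_trans dA)// fine_le.
Qed.

Lemma le_hausdorff_gauge_scale d d' A : (d <= d')%R ->
  hausdorff_gauge s d' A <= hausdorff_gauge s d A.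
Proof.
move=> dd'; rewrite /hausdorff_gauge; case: ifP => // _.
have [Ad|_] := leP (ediam A) d%:E; last by rewrite leey.
by rewrite (le_trans Ad)// lee_fin.
Qed.

Lemma mu_ext_cover (G : set (arbitrary_sets 'rV[R]_m) -> \bar R) A
    (F : (set 'rV[R]_m)^nat) : A `<=` \bigcup_k F k ->
  @mu_ext _ (arbitrary_sets 'rV[R]_m) R G A <= \sum_(k <oo) G (F k).
Proof. by move=> AF; apply: ereal_inf_lbound; exists F. Qed.

Lemma le_mu_ext_hausdorff_scale d d' A : (d <= d')%R ->
  mu_ext (hausdorff_gauge s d') A <= mu_ext (hausdorff_gauge s d) A.
Proof.
move=> dd'; apply: le_ereal_inf_tmp => _ [F [_ AF] <-].
apply: (le_trans (mu_ext_cover _ AF)).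
apply: lee_nneseries => [k _ _|k _]; first exact: hausdorff_gauge_ge0.
exact: le_hausdorff_gauge_scale.
Qed.

Lemma mu_ext_le_hausdorff d A : (0 < d)%R ->
  mu_ext (hausdorff_gauge s d) A <= hausdorff s A.
Proof. by move=> d0; apply: ereal_sup_ubound; exists d. Qed.

(** The images of the sets of a cover form a cover with no larger diameters. Applied to an isometry
    and its inverse, this is the invariance of the surface measure. *)
Lemma hausdorff_image {p : nat} (T : 'rV[R]_m -> 'rV[R]_p) A :
  (forall x y, (enorm (T x - T y) <= enorm (x - y))%R) ->
  hausdorff s (T @` A) <= hausdorff s A.
Proof.
move=> lipT; apply: ge_ereal_sup => _ [d /= d0 <-].
apply: le_trans (mu_ext_le_hausdorff A d0).
apply: le_ereal_inf_tmp => _ [F [_ AF] <-].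
apply: (@le_trans _ _ (\sum_(k <oo) hausdorff_gauge s d (T @` F k))).
  apply: ereal_inf_lbound; exists (fun k => T @` F k) => //.
  by split=> // _ [x /AF[k _ Fx] <-]; exists k => //; exists x.
apply: lee_nneseries => [k _ _|k _]; first exact: hausdorff_gauge_ge0.
apply: le_hausdorff_gauge => [->|]; first by rewrite image_set0.
exact: (ediam_le_image (T := T)).
Qed.

(** At a scale below d no set of finite gauge meets both A and B, so a cover of the union splits
    into a cover of A and a cover of B at no extra cost. *)
Lemma hausdorff_metric A B d : (0 < d)%R ->
    (forall x y, A x -> B y -> (d <= enorm (x - y))%R) ->
  hausdorff s A + hausdorff s B <= hausdorff s (A `|` B).
Proof.
move=> d0 dAB.
have split e : (0 < e)%R -> (e < d)%R ->
    mu_ext (hausdorff_gauge s e) A + mu_ext (hausdorff_gauge s e) B <=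
    mu_ext (hausdorff_gauge s e) (A `|` B).
  move=> e0 ed; apply: le_ereal_inf_tmp => _ [F [_ ABF] <-].
  have cA : A `<=` \bigcup_k (F k `&` A).
    by move=> x Ax; have [k _ Fx] := ABF x (or_introl Ax); exists k.
  have cB : B `<=` \bigcup_k (F k `&` B).
    by move=> x Bx; have [k _ Fx] := ABF x (or_intror Bx); exists k.
  apply: (le_trans (leeD (mu_ext_cover _ cA) (mu_ext_cover _ cB))).
  rewrite -nneseriesD => [|k _ _|k _ _]; try exact: hausdorff_gauge_ge0.
  apply: lee_nneseries => [k _ _|k _].
    by apply: adde_ge0; exact: hausdorff_gauge_ge0.
  have [A0|A0] := eqVneq (F k `&` A) set0.
    rewrite A0 hausdorff_gauge0 add0e; apply: le_hausdorff_gauge.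
      by move=> ->; rewrite set0I.
    by apply: le_ediam; exact: subIsetl.
  have [B0|B0] := eqVneq (F k `&` B) set0.
    rewrite B0 hausdorff_gauge0 adde0; apply: le_hausdorff_gauge.
      by move=> ->; rewrite set0I.
    by apply: le_ediam; exact: subIsetl.
  (* [F k] meets both sets, so its diameter is at least d > e and its gauge is +oo. *)
  move: A0 B0 => /set0P[x [Fx Ax]] /set0P[y [Fy By]].
  rewrite [leRHS]/hausdorff_gauge ifF; last by apply/eqP => Fk0; rewrite Fk0 in Fx.
  rewrite ifF ?leey//; apply/negbTE; rewrite -ltNge.
  apply: lt_le_trans (enorm_le_ediam Fx Fy).
  by rewrite lte_fin (lt_le_trans ed)// dAB.
(* The suprema for A and B run over independent scales; both outer measures only grow on passing to
   a common smaller scale, taken below d. *)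
have {}split e e' : (0 < e)%R -> (0 < e')%R ->
    mu_ext (hausdorff_gauge s e) A + mu_ext (hausdorff_gauge s e') B <=
    hausdorff s (A `|` B).
  move=> e0 e'0; pose t := Num.min (Num.min e e') (d / 2)%R.
  have t0 : (0 < t)%R by rewrite !lt_min e0 e'0 divr_gt0.
  apply: le_trans (mu_ext_le_hausdorff _ t0).
  apply: le_trans (split t t0 _); last first.
    by rewrite /t !gt_min (_ : d / 2 < d)%R ?orbT//; lra.
  by apply: leeD; apply: le_mu_ext_hausdorff_scale; rewrite !ge_min lexx ?orbT.
have [->|fAB] := eqVneq (hausdorff s (A `|` B)) +oo; first by rewrite leey.
have finAB : hausdorff s (A `|` B) \is a fin_num.
  by rewrite ge0_fin_numE ?ltey ?hausdorff_ge0.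
have finB : hausdorff s B \is a fin_num.
  rewrite ge0_fin_numE ?hausdorff_ge0//.
  apply: (@le_lt_trans _ _ (hausdorff s (A `|` B))); last by rewrite ltey.
  by apply: le_hausdorff; exact: subsetUr.
rewrite -leeBrDr//; apply: ge_ereal_sup => _ [e /= e0 <-].
rewrite leeBrDr// addeC.
have finA : mu_ext (hausdorff_gauge s e) A \is a fin_num.
  rewrite ge0_fin_numE ?mu_ext_ge0//; last exact: hausdorff_gauge_ge0.
  apply: le_lt_trans (_ : hausdorff s (A `|` B) < +oo); last by rewrite ltey.
  apply: le_trans (mu_ext_le_hausdorff _ e0) _.
  by apply: le_hausdorff; exact: subsetUl.
rewrite -leeBrDr//; apply: ge_ereal_sup => _ [e' /= e'0 <-].
by rewrite leeBrDr// addeC split.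
Qed.

Definition eunif_continuous_on (D : set 'rV[R]_m) (f : 'rV[R]_m -> R) :=
  forall e, (0 < e)%R -> exists2 d, (0 < d)%R & forall x y, D x -> D y ->
    (enorm (x - y) < d -> `|f x - f y| < e)%R.

Section Sublevel.
Variables (D A : set 'rV[R]_m) (f : 'rV[R]_m -> R) (c : R).
Hypothesis f_unif : eunif_continuous_on D f.
Hypothesis AD : A `<=` D.

(** By uniform continuity a gap between the values of f forces a gap between the sets. *)
Lemma hausdorff_separated B B' e : (0 < e)%R -> B `<=` D -> B' `<=` D ->
    (forall x y, B x -> B' y -> (f x + e <= f y)%R) ->
  hausdorff s B + hausdorff s B' <= hausdorff s (B `|` B').
Proof.
move=> e0 BD B'D ef; have [d d0 dP] := f_unif e0.
apply: (hausdorff_metric d0) => x y Bx By; rewrite leNgt; apply/negP.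
move=> /(dP _ _ (BD _ Bx) (B'D _ By)); have := ef x y Bx By.
by rewrite ltr_norml; lra.
Qed.

Let Ak (k : nat) := [set x | A x /\ (c + k.+1%:R^-1 <= f x)%R].
Let Rk (k : nat) :=
  [set x | A x /\ (c + k.+2%:R^-1 <= f x /\ f x < c + k.+1%:R^-1)%R].

Let inv_lt (k l : nat) : (k < l)%N -> (l.+1%:R^-1 < k.+1%:R^-1 :> R)%R.
Proof. by move=> kl; rewrite ltf_pV2 ?posrE// ltr_nat ltnS. Qed.

(* Layers whose indices differ by two are separated, so the measures of the layers
   of each parity add up. *)
Let sum_even_layers (p : bool) (K : nat) :
  \sum_(0 <= j < K) hausdorff s (Rk (p + j.*2)%N) <= hausdorff s A.
Proof.
suff : \sum_(0 <= j < K) hausdorff s (Rk (p + j.*2)%N) <=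
    hausdorff s [set x | A x /\ exists2 j, (j < K)%N & Rk (p + j.*2)%N x].
  by move/le_trans; apply; apply: le_hausdorff => x [].
elim: K => [|K IH]; first by rewrite big_geq// hausdorff_ge0.
rewrite big_nat_recr//= addeC.
case: K IH => [|K] IH.
  rewrite big_geq// adde0; apply: le_hausdorff => x Rx.
  by split; [case: Rx|exists 0%N].
have e0 : (0 < (p + K.*2).+2%:R^-1 - (p + K.*2).+3%:R^-1 :> R)%R.
  by rewrite subr_gt0 inv_lt.
rewrite (le_trans (leeD (lexx _) IH))//.
apply: le_trans (hausdorff_separated e0 _ _ _) _.
- by move=> x [/AD].
- by move=> x [/AD].
- move=> x y [_ [_ fx]] [_ [j jK [_ [fy _]]]].
  have : ((p + K.*2).+2%:R^-1 <= (p + j.*2).+2%:R^-1 :> R)%R.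
    by rewrite lef_pV2 ?posrE// ler_nat !ltnS leq_add2l leq_double.
  move: fx fy; rewrite doubleS !addnS.
  set u := _^-1%R; set v := _^-1%R; set w := _^-1%R => fx fy uw.
  by clearbody u v w; lra.
- apply: (@le_hausdorff R m s _ _ _) => x [Rx|[Ax [j jK Rx]]].
    by split; [case: Rx|exists K.+1].
  by split=> //; exists j => //; rewrite ltnS ltnW.
Qed.

Let sum_layers : hausdorff s A < +oo -> \sum_(j <oo) hausdorff s (Rk j) < +oo.
Proof.
move=> finA; apply: (@le_lt_trans _ _ (hausdorff s A + hausdorff s A)).
  apply: lime_le; first by apply: is_cvg_nneseries => *; exact: hausdorff_ge0.
  apply: nearW => K /=.
  apply: (@le_trans _ _ (\sum_(0 <= j < K.*2) hausdorff s (Rk j))).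
    apply: lee_sum_nneg_natr => [j _ _|]; first exact: hausdorff_ge0.
    by rewrite -addnn leq_addr.
  have -> : \sum_(0 <= j < K.*2) hausdorff s (Rk j) =
    \sum_(0 <= j < K) hausdorff s (Rk (false + j.*2)%N) +
    \sum_(0 <= j < K) hausdorff s (Rk (true + j.*2)%N).
    elim: K => [|K IH]; first by rewrite !big_geq// adde0.
    by rewrite doubleS !big_nat_recr//= IH addeACA addeA.
  by apply: leeD; exact: sum_even_layers.
by rewrite lte_add_pinfty.
Qed.

(** The part of A where f > c lies in [Ak N], which is separated from the part where f <= c,
    together with the layers [Rk k] for k >= N, whose measures are the tail of a convergent
    series. *)
Lemma hausdorff_sublevel : hausdorff s A < +oo ->
  hausdorff s (A `&` [set x | (f x <= c)%R]) +
  hausdorff s (A `&` ~` [set x | (f x <= c)%R]) <= hausdorff s A.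
Proof.
move=> finA; apply/lee_addgt0Pr => e e0.
have tail := nneseries_tail_cvg (sum_layers finA)
  (fun k _ => hausdorff_ge0 s (Rk k)).
have : \forall N \near \oo, \sum_(N <= k <oo) hausdorff s (Rk k) < e%:E.
  by apply: (tail [set y | y < e%:E]); apply: open_nbhs_nbhs; split;
    [exact: open_ereal_lt_ereal|rewrite /= lte_fin].
case=> N _ /(_ N (leqnn N)) tailN.
have cover : A `&` ~` [set x | (f x <= c)%R] `<=`
    Ak N `|` \bigcup_(k in ~` `I_N) Rk k.
  move=> x [Ax /= /negP]; rewrite -ltNge => fx.
  have [fN|fN] := leP (c + N.+1%:R^-1)%R (f x); first by left.
  right.
  (* The least such index is positive because f x < c + 1 / (N + 1), and its predecessor is the
     index of the layer containing x. *)
  have ex : exists k, (c + k.+1%:R^-1 <= f x)%R.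
    exists (Num.truncn (f x - c)^-1); rewrite -lerBrDl -[leRHS]invrK.
    by rewrite lef_pV2 ?posrE ?invr_gt0 ?subr_gt0// ltW// truncnS_gt.
  have k0 := ex_minnP ex; case: k0 => [[|k] ck kmin].
    have : (N.+1%:R^-1 <= 1 :> R)%R by rewrite invf_le1// ler1n.
    move: fN ck; rewrite (_ : 1%:R^-1 = 1 :> R)%R ?invr1//.
    by set u := _^-1%R; clearbody u; lra.
  exists k => /=.
    move=> kN.
    have : (N.+1%:R^-1 <= k.+2%:R^-1 :> R)%R.
      by rewrite lef_pV2 ?posrE// ler_nat ltnS.
    move: fN ck; set u := _^-1%R; set v := _^-1%R; clearbody u v; lra.
  split=> //; split=> //; rewrite ltNge; apply/negP => /kmin.
  by rewrite ltnn.
have AN : hausdorff s (A `&` [set x | (f x <= c)%R]) + hausdorff s (Ak N) <= hausdorff s A.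
  have N0 : (0 < N.+1%:R^-1 :> R)%R by rewrite invr_gt0.
  apply: le_trans (hausdorff_separated N0 _ _ _) _.
  - by move=> x [/AD].
  - by move=> x [/AD].
  - by move=> x y [_ /= fx] [_]; apply: le_trans; rewrite lerD2r.
  - by apply: le_hausdorff => x [[]|[]].
apply: le_trans (leeD AN (ltW tailN)).
rewrite -addeA leeD//.
apply: le_trans (le_hausdorff s cover) _.
apply: le_trans (outer_measureU2 (hausdorff_outer R m s) _ _) _.
apply: leeD => //.
by have := outer_measure_sigma_subadditive_tail (hausdorff_outer R m s) N Rk.
Qed.

End Sublevel.

(** The test set is first cut by D, where f is controlled; what lies outside D belongs to the
    complement of the sublevel set. *)
Lemma caratheodory_sublevel (D : set 'rV[R]_m) f c :
    (hausdorff_outer R m s).-caratheodory D -> eunif_continuous_on D f ->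
  (hausdorff_outer R m s).-caratheodory (D `&` [set x | (f x <= c)%R]).
Proof.
move=> mD f_unif; apply: le_caratheodory_measurable => X.
have [->|] := eqVneq (hausdorff_outer R m s X) +oo; first by rewrite leey.
rewrite -ltey => finX; rewrite [leRHS](mD X).
have finXD : hausdorff s (X `&` D) < +oo.
  by apply: le_lt_trans finX; apply: le_hausdorff; exact: subIsetl.
have XD : X `&` D `<=` D by exact: subIsetr.
apply: le_trans (leeD (hausdorff_sublevel c f_unif XD finXD) (lexx _)).
rewrite -addeA setIA leeD//.
apply: le_trans (outer_measureU2 _ _ _); apply: le_hausdorff => x [Xx nx].
have [Dx|Dx] := pselect (D x); last by right.
by left; split=> // fx; apply: nx.
Qed.

(** Compactness is used as the near-covering property, with the modulus d running through the filter
    of small positive reals. It then suffices to find, around each x, a neighbourhood on which one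
    small d works. *)
Lemma heine_cantor (K : set 'rV[R]_m) (f : 'rV[R]_m -> R) : compact K ->
  {within K, continuous f} -> eunif_continuous_on K f.
Proof.
move=> cK cf e e0.
pose P (d : R) x := forall y, K x -> K y ->
  (enorm (x - y) < d -> `|f x - f y| < e)%R.
have : near_covering K by exact/compact_near_coveringP.
move=> /(_ R (0^'+)%R P _) [].
  move=> x Kx; have e2 : (0 < e / 2)%R by rewrite divr_gt0.
  have [d d0 dP] := iffLR (continuous_within_enormP K f) cf x _ Kx e2.
  exists ([set x' | enorm (x' - x) < d / 2]%R, [set t | t < d / 2]%R) => /=.
    split; last by apply: nbhs_right_lt; rewrite divr_gt0.
    by apply/nbhs_enormP; exists (d / 2)%R; rewrite ?divr_gt0.
  move=> [x' t] [/= xx' td] y Kx' Ky xy.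
  have h1 : (enorm (x' - x) < d)%R by lra.
  have h2 : (enorm (y - x) < d)%R.
    rewrite (le_lt_trans (enorm_triangle x' _ _))// (enorm_distC y); lra.
  have := dP _ Kx' h1; have := dP _ Ky h2.
  by rewrite !ltr_norml; lra.
move=> t /= t0 h; exists (t / 2)%R; first by rewrite divr_gt0.
by move=> x y Kx Ky; apply: (h (t / 2)%R) => //=;
  rewrite ?divr_gt0// sub0r normrN ger0_norm; lra.
Qed.

Lemma caratheodory_unit_sphere :
  (hausdorff_outer R m s).-caratheodory (@unit_sphere R m).
Proof.
have mT := @measurableT _ (caratheodory_type (hausdorff_outer R m s)).
have unif : eunif_continuous_on setT (@enorm R m).
  by move=> e e0; exists e => // x y _ _; exact/le_lt_trans/enorm_dist.
have unifN : eunif_continuous_on setT (fun x : 'rV[R]_m => - enorm x)%R.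
  move=> e e0; have [d d0 dP] := unif e e0; exists d => // x y Dx Dy /dP.
  by rewrite -opprD normrN; exact.
rewrite [unit_sphere](_ : _ = (setT `&` [set x | enorm x <= 1]%R) `&`
   (setT `&` [set x | - enorm x <= - 1]%R)).
  by apply: caratheodory_measurable_setI; exact: caratheodory_sublevel.
apply/seteqP; split=> [x /= ->|x [[_ /= h1] [_ /= h2]]]; first by rewrite !lexx.
by apply/eqP; rewrite eq_le h1/=; move: h2; rewrite lerN2.
Qed.

Lemma measurable_fun_within_continuous (K : set 'rV[R]_m) (f : 'rV[R]_m -> R) :
    compact K -> (hausdorff_outer R m s).-caratheodory K ->
    {within K, continuous f} ->
  measurable_fun (K : set (caratheodory_type (hausdorff_outer R m s))) f.
Proof.
move=> cK mK cf; have unif := heine_cantor cK cf.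
move=> mD; apply: (measurability _ (RGenOInfty.measurableE R)) => //.
move=> _ [_ [x ->] <-].
rewrite [X in measurable X](_ : _ = K `\` (K `&` [set t | f t <= x]%R)).
  by apply: measurableD => //; exact: caratheodory_sublevel.
apply/seteqP; split=> [t [Kt /=]|t [Kt /= nKt]].
  by rewrite in_itv/= andbT ltNge => /negP ft; split=> // -[].
by split=> //=; rewrite in_itv/= andbT ltNge; apply/negP => ft; apply: nKt.
Qed.

End HausdorffMeasure.

(** * Finiteness of the surface area *)

Section SphereFinite.
Local Open Scope ereal_scope.
Context {R : realType} {n : nat}.

Lemma mu_ext_finite_cover {m s : nat} d (I : finType) (cell : I -> set 'rV[R]_m)
    (A : set 'rV[R]_m) (c : R) :
    A `<=` [set x | exists i, cell i x] ->
    (forall i, hausdorff_gauge s d (cell i) <= c%:E) ->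
  mu_ext (hausdorff_gauge s d) A <= (#|I|%:R * c)%:E.
Proof.
move=> Acell gc; pose F k := nth set0 [seq cell i | i <- enum I] k.
have szF : size [seq cell i | i <- enum I] = #|I| by rewrite size_map cardE.
have AF : A `<=` \bigcup_k F k.
  move=> x /Acell[i ix]; exists (index i (enum I)) => //.
  by rewrite /F (nth_map i) ?index_mem ?mem_enum// nth_index ?mem_enum.
apply: (le_trans (mu_ext_cover _ AF)).
rewrite (nneseries_split 0%N #|I|) => [|k _]; last exact: hausdorff_gauge_ge0.
rewrite add0n eseries0 ?adde0; last first.
  by move=> k Ik _; rewrite /F nth_default ?szF// hausdorff_gauge0.
rewrite mulr_natl; apply: (@le_trans _ _ (\sum_(0 <= k < #|I|) c%:E)).
  rewrite [leLHS]big_nat_cond [leRHS]big_nat_cond; apply: lee_sum => k.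
  rewrite andbT => /andP[_ kI].
  have [i0 _] : exists i : I, true by case: (pickP I) kI => [i|/eq_card0->//]; exists i.
  by rewrite /F (nth_map i0) -?cardE.
by rewrite sumEFin sumr_const_nat subn0.
Qed.

(** A cell fixes a coordinate of modulus at least 1 / (n + 1), its sign, and a grid interval of
    length 1/k for each other coordinate. On such a piece the sphere is a Lipschitz graph over the
    other coordinates, so the diameter is O(1/k), while there are O(k^n) cells. The values (y_j + 1)
    k range over [0, 2k], hence 2k + 1 possible integer parts. *)
Let cell (k : nat) (c : 'I_n.+1 * bool * {ffun 'I_n -> 'I_(k.*2.+1)}) :=
  [set y : 'rV[R]_n.+1 | unit_sphere y /\
     ((n.+1%:R^-1 <= (-1) ^+ c.1.2 * y 0 c.1.1)%R /\
      forall j, Num.truncn ((y 0 (lift c.1.1 j) + 1) * k%:R)%R = c.2 j)].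

Let cell_cover k : unit_sphere `<=` [set x | exists c, @cell k c x].
Proof.
move=> y /= y1.
(* Otherwise the sum of the moduli of the coordinates, which dominates |y|, would be below 1. *)
have [i yi] : exists i, (n.+1%:R^-1 <= `|y 0 i|)%R.
  apply: contrapT => /forallNP h.
  have : (enorm y < 1)%R.
    apply: le_lt_trans (enorm_le_sum y) _.
    apply: (@lt_le_trans _ _ (\sum_(i < n.+1) n.+1%:R^-1)%R).
      apply: ltr_sum => [|i _]; last by rewrite ltNge; apply/negP/h.
      by apply/hasP; exists ord0; rewrite ?mem_index_enum.
    by rewrite sumr_const card_ord -[leLHS]mulr_natl divff.
  by rewrite y1 ltxx.
have tr j : (Num.truncn ((y 0%R (lift i j) + 1) * k%:R)%R < k.*2.+1)%N.
  rewrite ltnS truncn_le_nat; apply: (@le_lt_trans _ _ (k.*2)%:R); last by rewrite ltr_nat.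
  rewrite -mul2n natrM ler_wpM2r//.
  by have := le_coord_enorm y (lift i j); rewrite y1 ler_norml; lra.
exists (i, (y 0 i < 0)%R, [ffun j => Ordinal (tr j)]); split=> //=; split.
  by rewrite -normrEsign.
by move=> j; rewrite ffunE.
Qed.

Let ediam_cell k c : (0 < k)%N -> ediam (@cell k c) <= ((n * n.+2)%:R / k%:R)%:E.
Proof.
move=> k0; case: c => -[i b] q; apply: ediam_le => y z [/= y1 [yi yq]] [z1 [zi zq]].
have kR : (0 < k%:R :> R)%R by rewrite ltr0n.
have near j : (`|y 0 (lift i j) - z 0 (lift i j)| <= k%:R^-1)%R.
  have tb (w : 'rV[R]_n.+1) : enorm w = 1%R -> (0 <= (w 0 (lift i j) + 1) * k%:R)%R.
    move=> w1; rewrite mulr_ge0//.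
    by have := le_coord_enorm w (lift i j); rewrite w1 ler_norml; lra.
  have := truncn_itv (tb _ y1); have := truncn_itv (tb _ z1).
  rewrite yq zq -natr1 => /andP[z2 z3] /andP[y2 y3].
  rewrite -(ler_pM2r kR) mulVf ?gt_eqF// -{1}(gtr0_norm kR) -normrM ler_norml.
  by rewrite mulrBl; lra.
have le1 (w : 'rV[R]_n.+1) j : enorm w = 1%R -> (`|w 0 j| <= 1)%R.
  by move=> <-; exact: le_coord_enorm.
(* As |y| = |z|, the difference y_i^2 - z_i^2 is the sum of z_j^2 - y_j^2 over the n other
   coordinates, at most 2n / k in modulus. Since y_i and z_i have the same sign, |y_i + z_i| >= 2 /
   (n + 1), and one divides by it. *)
have neari : (`|y 0 i - z 0 i| <= (n * n.+1)%:R / k%:R)%R.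
  have sq (w : 'rV[R]_n.+1) : enorm w = 1%R ->
      (w 0 i ^+ 2 = 1 - \sum_j w 0 (lift i j) ^+ 2)%R.
    move=> w1; have := sqr_enorm w; rewrite w1 expr1n /dot (bigD1_ord i)//= => ->.
    by rewrite -expr2; under [X in (_ - X)%R]eq_bigr => j _ do rewrite expr2; rewrite addrK.
  have e : ((y 0 i - z 0 i) * (y 0 i + z 0 i) =
      \sum_j (z 0 (lift i j) - y 0 (lift i j)) * (z 0 (lift i j) + y 0 (lift i j)))%R.
    rewrite -subr_sqr (sq _ y1) (sq _ z1).
    under [RHS]eq_bigr => j _ do rewrite -subr_sqr.
    by rewrite sumrB; lra.
  have l2 : (2 / n.+1%:R <= `|y 0 i + z 0 i|)%R.
    rewrite -[leRHS](normrMsign b).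
    apply: le_trans (ler_norm _); rewrite mulrDr.
    by rewrite (_ : 2 = 1 + 1)%R// mulrDl !mul1r lerD.
  have u : (`|(y 0 i - z 0 i) * (y 0 i + z 0 i)| <= n%:R * (2 / k%:R))%R.
    rewrite e (le_trans (ler_norm_sum _ _ _))//.
    rewrite mulr_natl -[X in (_ *+ X)%R]card_ord -sumr_const ler_sum// => j _.
    rewrite normrM distrC mulrC ler_pM//.
    by rewrite (le_trans (ler_normD _ _))// (_ : 2 = 1 + 1)%R// lerD// le1.
  rewrite normrM in u.
  have n1 : (0 < n.+1%:R :> R)%R by [].
  have n2 : (0 < 2 / n.+1%:R :> R)%R by rewrite divr_gt0.
  rewrite -(ler_pM2r n2) [leRHS](_ : _ = n%:R * (2 / k%:R))%R.
    by apply: le_trans u; rewrite ler_wpM2l.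
  by rewrite natrM; field; rewrite !gt_eqF.
rewrite (le_trans (enorm_le_sum _))// (bigD1_ord i)//= !mxE.
have -> : ((n * n.+2)%:R / k%:R = (n * n.+1)%:R / k%:R + n%:R / k%:R :> R)%R.
  by rewrite -mulrDl -natrD; congr (_%:R / _)%R; rewrite mulnS addnC.
rewrite lerD// mulr_natl -[X in (_ *+ X)%R]card_ord -sumr_const ler_sum// => j _.
by rewrite !mxE.
Qed.

Lemma hausdorff_unit_sphere_lty : hausdorff n (unit_sphere : set 'rV[R]_n.+1) < +oo.
Proof.
pose v : R := (ball_volume n / 2 ^+ n)%R.
have v0 : (0 <= v)%R by rewrite divr_ge0// ?exprn_ge0// ltW// ball_volume_gt0.
(* c / k bounds the diameter of a cell. There are 2 (n + 1) (2k + 1)^n cells, and 2k + 1 <= 3k makes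
   their total gauge bounded independently of k, hence of the scale d. *)
pose c : R := (n * n.+2)%:R.
apply: (@le_lt_trans _ _ ((n.+1 * 2)%:R * 3 ^+ n * (v * c ^+ n))%:E); last by rewrite ltry.
apply: ge_ereal_sup => _ [d /= d0 <-].
pose k := (Num.truncn (c / d)).+1.
have kd : (c / k%:R <= d)%R.
  by rewrite ler_pdivrMr// mulrC -ler_pdivrMr// ltW// truncnS_gt.
have gc i : hausdorff_gauge n d (@cell k i) <= (v * (c / k%:R) ^+ n)%:E.
  have [E|/set0P ne] := eqVneq (@cell k i) set0.
    by rewrite E hausdorff_gauge0 lee_fin mulr_ge0// exprn_ge0// divr_ge0.
  have dc : ediam (@cell k i) <= (c / k%:R)%:E by exact: ediam_cell.
  rewrite /hausdorff_gauge ifF; last by apply/negbTE/set0P.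
  rewrite (le_trans dc) ?lee_fin// ler_wpM2l// lerXn2r// ?nnegrE.
  - by rewrite fine_ge0// ediam_ge0.
  - by rewrite divr_ge0.
  - by rewrite -lee_fin fineK// ge0_fin_numE ?ediam_ge0// (le_lt_trans dc)// ltry.
apply: le_trans (mu_ext_finite_cover (@cell_cover k) gc) _.
rewrite !card_prod card_bool card_ord card_ffun !card_ord lee_fin natrM natrX.
rewrite [leLHS](_ : _ =
  (n.+1 * 2)%:R * (v * ((k.*2.+1)%:R * (c / k%:R)) ^+ n))%R; last first.
  by rewrite [in RHS]exprMn -mulrA; congr (_ * _)%R; rewrite mulrCA.
rewrite [leRHS](_ : _ = (n.+1 * 2)%:R * (v * (3 * c) ^+ n))%R; last first.
  by rewrite [in RHS]exprMn -mulrA; congr (_ * _)%R; rewrite mulrCA.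
rewrite ler_wpM2l// ler_wpM2l// lerXn2r ?nnegrE ?mulr_ge0 ?divr_ge0//.
rewrite mulrCA mulrC ler_wpM2r// ler_pdivrMr ?ltr0n//.
by rewrite -natrM ler_nat -muln2; lia.
Qed.

End SphereFinite.

(** * Positivity of the surface area *)

Section SpherePositive.
Context {R : realType} {n : nat}.

Lemma card_ord_near (N : nat) (h p t : R) : 0 < h ->
  (#|[pred i : 'I_N | (`|i%:R * h - p| < t)%R]| <= (Num.truncn (2 * t / h)).+1)%N.
Proof.
move=> h0; set A := [pred i : 'I_N | _]; set K := Num.truncn _.
have [i0 Ai0|A0] := pickP A; last by rewrite eq_card0.
pose a0 := [arg min_(i < i0 | A i) (i : nat)]%N.
have [Aa0 amin] : A a0 /\ forall i, A i -> (a0 <= i)%N.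
  by rewrite /a0; case: arg_minnP.
rewrite cardE -(size_map val) -(size_iota a0 K.+1); apply: uniq_leq_size.
  by rewrite map_inj_uniq ?enum_uniq//; exact: val_inj.
move=> _ /mapP[i + ->]; rewrite mem_enum mem_iota => Ai; rewrite amin//=.
rewrite addnS ltnS -leq_subLR truncn_ge_nat//.
  by rewrite ler_pdivlMr// natrB ?amin//; move: Ai Aa0; rewrite !inE !ltr_norml; lra.
have t0 : 0 <= t by move: Ai; rewrite inE => /(le_lt_trans (normr_ge0 _))/ltW.
by rewrite divr_ge0// ?mulr_ge0// ltW.
Qed.

Lemma card_ffun_near (N : nat) (h t : R) (p : 'I_n -> R) : 0 < h ->
  (#|[pred q : {ffun 'I_n -> 'I_N} | [forall j, (`|(q j)%:R * h - p j| < t)%R]]|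
   <= (Num.truncn (2 * t / h)).+1 ^ n)%N.
Proof.
move=> h0; set K := (_.+1)%N.
rewrite (eq_card (B := family (fun j => [pred i : 'I_N | (`|i%:R * h - p j| < t)%R]))).
  rewrite card_family -[X in (_ <= K ^ X)%N]card_ord -[X in (_ <= K ^ X)%N](size_image id) /image_mem.
  rewrite size_map -(size_map (fun j => #|[pred i : 'I_N | (`|i%:R * h - p j| < t)%R]|)).
  set s := map _ _.
  have : all (fun k => (k <= K)%N) s.
    by apply/allP => _ /mapP[j _ ->]; exact: card_ord_near.
  elim: s => [//|k s IH /= /andP[kK /IH sK]].
  by rewrite expnS leq_mul.
by move=> q; rewrite !inE; apply: eq_forallb => j.
Qed.

(** Serves to replace a covering set of diameter d by an open ball of slightly larger radius t, at
    an arbitrarily small cost. *)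
Lemma exists_gt_exprn (d e : R) : 0 <= d -> 0 < e ->
  exists2 t, d < t & t ^+ n <= d ^+ n + e.
Proof.
move=> d0 e0; have cX : {for d, continuous (fun t : R => t ^+ n)}.
  exact: exprn_continuous.
have /cvgrPdist_lt/(_ e e0)/nbhs_ballP[r /= r0 rP] := cX.
exists (d + r / 2); first by rewrite ltrDl divr_gt0.
have : ball d r (d + r / 2).
  by rewrite -ball_normE /ball_/= opprD addNKr normrN gtr0_norm; lra.
by move=> /rP/=; rewrite ltr_norml; lra.
Qed.

(** With grid step h = 1 / (N (n + 1)), a ball of radius t sees at most (2 t / h + 1)^n grid points;
    when N t >= 1 this is at most C N^n t^n. *)
Let C : R := (4 * n.+1%:R) ^+ n.

Let C_gt0 : 0 < C.
Proof. by rewrite exprn_gt0// mulr_gt0. Qed.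

Let grid_point (c : 'I_n -> R) : 'rV[R]_n.+1 :=
  \row_i if unlift ord0 i is Some j then c j else Num.sqrt (1 - \sum_j c j ^+ 2).

(* Volume comparison: the points of S above a fine grid of the cube are counted
   by the balls covering them, a ball of radius t seeing O((t N)^n) of the N^n points. *)
Let sphere_count (M : nat) (t : 'I_M -> R) (p : 'I_M -> 'rV[R]_n.+1) (P : pred 'I_M) :
  (forall k, P k -> 0 < t k) ->
  unit_sphere `<=` [set x | exists2 k, P k & enorm (x - p k) < t k] ->
  1 <= C * \sum_(k | P k) t k ^+ n.
Proof.
move=> t0 cov.
(* N is so large that N t_k >= 1 for every radius, which absorbs the additive 1 of the count. *)
pose N := (Num.truncn (\sum_(k | P k) (t k)^-1)).+1.
have tN k : P k -> (t k)^-1 <= N%:R.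
  move=> Pk; rewrite ltW// (le_lt_trans _ (truncnS_gt _))//.
  by rewrite (bigD1 k)//= lerDl sumr_ge0// => j /andP[/t0 ? _]; rewrite invr_ge0 ltW.
have N0 : 0 < N%:R :> R by [].
(* All grid coordinates stay below 1 / (n + 1), so their squares sum to at most 1 and the height of
   [grid_point] is the root of a nonnegative number. *)
pose h : R := (N%:R * n.+1%:R)^-1.
have h0 : 0 < h by rewrite invr_gt0 mulr_gt0.
pose x (q : {ffun 'I_n -> 'I_N}) := grid_point (fun j => (q j)%:R * h).
have xS q : unit_sphere (x q).
  rewrite /unit_sphere /= enormE /dot big_ord_recl/= mxE unlift_none -!expr2.
  under eq_bigr => j _ do rewrite mxE liftK -expr2.
  rewrite sqr_sqrtr ?subrK ?sqrtr1// subr_ge0.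
  apply: (@le_trans _ _ (\sum_(j < n) n.+1%:R^-1)); last first.
    by rewrite sumr_const card_ord -[leLHS]mulr_natl ler_pdivrMr// mul1r ler_nat.
  apply: ler_sum => j _.
  have qh : (q j)%:R * h <= n.+1%:R^-1.
    by rewrite /h invfM mulrA ler_piMl// ler_pdivrMr// mul1r ler_nat ltnW.
  have qh0 : 0 <= (q j)%:R * h by rewrite mulr_ge0// ltW.
  rewrite expr2 (le_trans (ler_pM qh0 qh0 qh qh))// ler_piMl//.
  by rewrite invf_le1// ler1n.
have count : ((N ^ n)%:R <= \sum_(k | P k) (2 * t k / h + 1) ^+ n :> R)%R.
  have -> : (N ^ n)%N = (\sum_(q : {ffun 'I_n -> 'I_N}) 1)%N.
    by rewrite sum1_card card_ffun !card_ord.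
  apply: (@le_trans _ _ (\sum_(q : {ffun 'I_n -> 'I_N})
      \sum_(k | P k) (enorm (x q - p k) < t k)%R)%N%:R).
    rewrite ler_nat; apply: leq_sum => q _.
    have [k Pk kq] := cov _ (xS q).
    by rewrite (bigD1 k)//= kq.
  rewrite exchange_big/= natr_sum; apply: ler_sum => k Pk.
  apply: (@le_trans _ _ ((Num.truncn (2 * t k / h)).+1 ^ n)%:R).
    rewrite ler_nat; apply: leq_trans (card_ffun_near N (t k) (fun j => p k 0 (lift ord0 j)) h0).
    rewrite -sum1_card [leqRHS]big_mkcond/=; apply: leq_sum => q _.
    case: ifP => [_|/negP nq]; first by case: (_ < _).
    case: (boolP (enorm (x q - p k) < t k)) => // qk; case: nq.
    rewrite inE; apply/forallP => j; apply: le_lt_trans qk.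
    by have := le_coord_enorm (x q - p k) (lift ord0 j); rewrite !mxE liftK.
  rewrite natrX lerXn2r ?nnegrE ?addr_ge0 ?divr_ge0 ?mulr_ge0// ?(ltW (t0 _ _)) ?(ltW h0)//.
  by rewrite -natr1 lerD2r truncn_le// divr_ge0 ?mulr_ge0// ltW// t0.
rewrite -(ler_pM2l (x := N%:R ^+ n)) ?exprn_gt0// mulr1 -natrX (le_trans count)//.
rewrite natrX mulrA !mulr_sumr; apply: ler_sum => k Pk.
have tk := t0 k Pk.
rewrite -!exprMn lerXn2r ?nnegrE ?addr_ge0 ?divr_ge0 ?mulr_ge0// ?(ltW tk) ?(ltW h0)//.
have : 1 <= N%:R * t k by rewrite -ler_pdivrMr// mul1r tN.
have n1 : 1 <= n.+1%:R :> R by rewrite ler1n.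
rewrite /h invrK; move: n.+1%:R N%:R (t k) n1 => a b c a1 bc.
nra.
Qed.

Let pow2_sum (M : nat) : \sum_(k < M) (2^-1 ^+ k.+1 : R) <= 1.
Proof.
suff -> : \sum_(k < M) (2^-1 ^+ k.+1 : R) = 1 - 2^-1 ^+ M by rewrite gerBl exprn_ge0.
elim: M => [|M IH]; first by rewrite big_ord0 expr0 subrr.
by rewrite big_ord_recr/= IH exprS; lra.
Qed.

(** If the measure vanished, some cover would have total gauge below v e. Its sets are enlarged to
    open balls, the k-th at the extra cost e / 2^(k+1), and compactness leaves finitely many, with
    the sum of the t_k^n below 2 e. For e = 1 / (2 C) this contradicts the volume comparison. *)
Lemma hausdorff_unit_sphere_gt0 : (0 < hausdorff n (unit_sphere : set 'rV[R]_n.+1))%E.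
Proof.
rewrite ltNge; apply/negP => H0.
pose v : R := ball_volume n / 2 ^+ n.
have v0 : 0 < v by rewrite divr_gt0 ?exprn_gt0// ball_volume_gt0.
pose e := (2 * C)^-1.
have e0 : 0 < e by rewrite invr_gt0 mulr_gt0.
have : (mu_ext (hausdorff_gauge n 1) (unit_sphere : set 'rV[R]_n.+1) < (v * e)%:E)%E.
  apply: le_lt_trans (mu_ext_le_hausdorff n _ ltr01) _.
  by rewrite (le_lt_trans H0)// lte_fin mulr_gt0.
move=> /ereal_inf_lt[_ [F [_ SF] <-]] Flt.
have gge0 k := hausdorff_gauge_ge0 n 1 (F k).
have part M : (\sum_(0 <= k < M) hausdorff_gauge n 1 (F k) < (v * e)%:E)%E.
  by apply: le_lt_trans Flt; apply: nneseries_lim_ge.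
have gfin k : F k !=set0 -> hausdorff_gauge n 1 (F k) = (v * fine (ediam (F k)) ^+ n)%:E.
  move=> /set0P F0; rewrite /hausdorff_gauge (negbTE F0); case: ifP => // /negbT ediam1.
  have := part k.+1; rewrite big_nat_recr//= ltNge => /negP; case.
  rewrite (@le_trans _ _ (hausdorff_gauge n 1 (F k)))//.
    by rewrite /hausdorff_gauge (negbTE F0) (negbTE ediam1) leey.
  by rewrite leeDr// sume_ge0.
have dfin k : F k !=set0 -> ediam (F k) \is a fin_num.
  move=> F0; rewrite ge0_fin_numE ?ediam_ge0//.
  have /set0P nF0 := F0.
  have := gfin k F0; rewrite /hausdorff_gauge (negbTE nF0).
  by case: ifP => // /le_lt_trans -> //; rewrite ltry.
have choice k : exists pt : 'rV[R]_n.+1 * R, F k !=set0 ->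
    [/\ F k `<=` [set x | enorm (x - pt.1) < pt.2], 0 < pt.2 &
        pt.2 ^+ n <= fine (ediam (F k)) ^+ n + e * 2^-1 ^+ k.+1].
  have [F0|] := pselect (F k !=set0); last by exists (0, 0).
  have [p Fp] := F0.
  have d0 : 0 <= fine (ediam (F k)) by rewrite fine_ge0 ?ediam_ge0.
  have ek : 0 < e * 2^-1 ^+ k.+1 by rewrite mulr_gt0 ?exprn_gt0.
  have [t td tn] := exists_gt_exprn d0 ek.
  exists (p, t) => _; split=> //=; last by rewrite (le_lt_trans d0).
  move=> x Fx /=; rewrite (le_lt_trans _ td)// -lee_fin fineK ?dfin//.
  exact: enorm_le_ediam.
have [pt ptP] : {pt & forall k, F k !=set0 ->
    [/\ F k `<=` [set x | enorm (x - (pt k).1) < (pt k).2], 0 < (pt k).2 &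
        (pt k).2 ^+ n <= fine (ediam (F k)) ^+ n + e * 2^-1 ^+ k.+1]}.
  exact: (@boolp.choice _ _ _ choice).
pose O k := [set x : 'rV[R]_n.+1 | F k !=set0 /\ enorm (x - (pt k).1) < (pt k).2].
have oO k : open (O k).
  rewrite openE => x [F0 xk]; apply/nbhs_enormP.
  exists ((pt k).2 - enorm (x - (pt k).1)); first by rewrite subr_gt0.
  move=> y yx; split=> //=; rewrite (le_lt_trans (enorm_triangle x _ _))//.
  by move: yx; rewrite ltrBrDr.
have : cover_compact (unit_sphere : set 'rV[R]_n.+1).
  rewrite -compact_cover.
  apply: (subclosed_compact _ (@compact_enorm_le R n.+1 1)); last by move=> x /= ->.
  rewrite [X in closed X](_ : _ = enorm @^-1` [set 1]).
    by apply: preimage_closed; [move=> x _; exact: continuous_enorm|exact: closed_eq].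
  by apply/seteqP; split.
move=> /(_ nat setT O (fun k _ => oO k)) [].
  move=> x /SF[k _ Fx]; exists k => //; split; first by exists x.
  by have [+ _ _] := ptP k (ex_intro _ x Fx); apply.
move=> D _ cov.
pose M := (\max_(k <- finmap.enum_fset D) k).+1.
have covM : unit_sphere `<=` [set x | exists2 k : 'I_M,
    (F k != set0) & enorm (x - (pt k).1) < (pt k).2].
  move=> x /cov[k /= kD [F0 xk]].
  have kM : (k < M)%N by rewrite ltnS (leq_bigmax_seq (F := id))//.
  by exists (Ordinal kM) => //; apply/set0P.
have tpos (k : 'I_M) : F k != set0 -> 0 < (pt k).2 by move=> /set0P/ptP[].
have := sphere_count (P := fun k : 'I_M => F k != set0) tpos covM.
rewrite leNgt => /negP; apply.
have sum_lt : \sum_(k < M | F k != set0) v * fine (ediam (F k)) ^+ n < v * e.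
  rewrite -lte_fin; apply: le_lt_trans (part M).
  rewrite big_mkord -sumEFin [leLHS]big_mkcond; apply: lee_sum => k _.
  by case: ifP => [/set0P/gfin -> //|_]; exact: gge0.
rewrite -mulr_sumr ltr_pM2l// in sum_lt.
have : \sum_(k < M | F k != set0) (pt k).2 ^+ n < e + e.
  apply: (@le_lt_trans _ _ (\sum_(k < M | F k != set0)
     (fine (ediam (F k)) ^+ n + e * 2^-1 ^+ k.+1))).
    by apply: ler_sum => k /set0P F0; have [] := ptP k F0.
  rewrite big_split/= ltr_leD// -mulr_sumr ler_piMr ?(ltW e0)//.
  rewrite (le_trans _ (pow2_sum M))// [leLHS]big_mkcond; apply: ler_sum => k _.
  by case: ifP => // _; rewrite exprn_ge0.
rewrite -(ltr_pM2l C_gt0) => /lt_le_trans; apply.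
by rewrite /e invfM; have := mulfV (lt0r_neq0 C_gt0); nra.
Qed.

End SpherePositive.

(** * Functions of class C^k *)

Section PartialDerivatives.
Context {R : realType} {m : nat}.
Implicit Types (U V : set 'rV[R]_m) (x y z v : 'rV[R]_m) (f g : 'rV[R]_m -> R).

Lemma within_continuousD (K : set 'rV[R]_m) f g : {within K, continuous f} ->
  {within K, continuous g} -> {within K, continuous (fun x => f x + g x)}.
Proof.
rewrite !subspace_continuousP => cf cg x Kx; exact: cvgD (cf x Kx) (cg x Kx).
Qed.

Lemma within_continuousM (K : set 'rV[R]_m) f g : {within K, continuous f} ->
  {within K, continuous g} -> {within K, continuous (fun x => f x * g x)}.
Proof.
rewrite !subspace_continuousP => cf cg x Kx; exact: cvgM (cf x Kx) (cg x Kx).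
Qed.

Lemma within_continuous_cst (K : set 'rV[R]_m) (c : R) :
  {within K, continuous (fun=> c)}.
Proof. by apply: continuous_subspaceT; exact: cst_continuous. Qed.

Lemma within_continuousZ (K : set 'rV[R]_m) f (c : R) : {within K, continuous f} ->
  {within K, continuous (fun x => c * f x)}.
Proof. by move=> cf; apply: within_continuousM => //; exact: within_continuous_cst. Qed.

Lemma within_continuousB (K : set 'rV[R]_m) f g : {within K, continuous f} ->
  {within K, continuous g} -> {within K, continuous (fun x => f x - g x)}.
Proof.
rewrite !subspace_continuousP => cf cg x Kx; exact: cvgB (cf x Kx) (cg x Kx).
Qed.

Lemma within_continuous_sqr_enorm (K : set 'rV[R]_m) :
  {within K, continuous (fun x => enorm x ^+ 2)}.
Proof.
by apply: within_continuousM; apply: continuous_subspaceT; exact: continuous_enorm.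
Qed.

Definition unit_vec (i : 'I_m) : 'rV[R]_m := delta_mx 0 i.

Lemma derive_cvgP {V : normedModType R} (f : V -> R) (x v : V) d :
  is_derive x v f d <-> h^-1 *: (f (h *: v + x) - f x) @[h --> 0^'] --> d.
Proof.
split=> [[df <-]|cvf]; first exact: df.
by split; [apply/cvg_ex; exists d|apply/cvg_lim].
Qed.

(** The bridge to one real variable, where the chain rule, the mean value theorem and the
    fundamental theorem of calculus are available. *)
Lemma is_derive_line f x v (t d : R) :
  is_derive (t *: v + x) v f d <-> is_derive t 1 (fun s => f (s *: v + x)) d.
Proof.
rewrite derive_cvgP; split=> [cvf|[df <-]].
  split; first (apply/cvg_ex; exists d); last apply/cvg_lim => //;
    by under eq_fun do rewrite /= [_%:A]mulr1 scalerDl -addrA.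
move: df; rewrite /derivable /derive.
by under eq_fun do rewrite /= [_%:A]mulr1 scalerDl -addrA.
Qed.

Lemma is_derive_mull (s t : R) : is_derive t 1 (fun r => s * r) s.
Proof.
have := @is_deriveZ R R R id s t 1 1 (is_derive_id t 1).
by rewrite [_%:A]mulr1.
Qed.

Lemma is_derive_affine f x v w (s d : R) :
  is_derive (s *: x + w) v f d -> is_derive x v (fun z => f (s *: z + w)) (s * d).
Proof.
move=> df; have := @is_derive_line (fun z => f (s *: z + w)) x v 0 (s * d).
rewrite scale0r add0r => h; apply/h.
have -> : (fun t : R => f (s *: (t *: v + x) + w)) =
    (fun t => f (t *: v + (s *: x + w))) \o (fun t => s * t).
  by apply/funext => t /=; rewrite scalerDr scalerA addrA.
rewrite mulrC; apply: is_derive1_comp.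
  by apply/is_derive_line; rewrite mulr0 scale0r add0r.
exact: is_derive_mull.
Qed.

Lemma is_derive_scale_vec f x v (c d : R) :
  is_derive x v f d -> is_derive x (c *: v) f (c * d).
Proof.
move=> df; have := @is_derive_line f x (c *: v) 0 (c * d).
rewrite scale0r add0r => h; apply/h.
have -> : (fun t : R => f (t *: (c *: v) + x)) =
    (fun t => f (t *: v + x)) \o (fun t => c * t).
  by apply/funext => t /=; rewrite scalerA mulrC.
rewrite mulrC; apply: is_derive1_comp.
  by apply/is_derive_line; rewrite mulr0 scale0r add0r.
exact: is_derive_mull.
Qed.

Lemma partialE i f x d : is_derive x (unit_vec i) f d -> partial i f x = d.
Proof. by case. Qed.

Lemma open_eq_near U f g x : open U -> U x -> {in U, f =1 g} -> \near x, f x = g x.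
Proof.
move=> oU Ux fg; near=> y; apply: fg; rewrite inE; near: y.
by apply: open_nbhs_nbhs.
Unshelve. all: by end_near. Qed.

Lemma partial_ext U i f g x : open U -> U x -> {in U, f =1 g} ->
  partial i f x = partial i g x.
Proof. by move=> oU Ux fg; apply: near_eq_derive; apply: (open_eq_near oU). Qed.

Lemma continuous_near_eq f g x : (\near x, f x = g x) ->
  {for x, continuous f} -> {for x, continuous g}.
Proof.
move=> fg cf; rewrite /prop_for /continuous_at -(nbhs_singleton fg).
exact: cvg_trans (near_eq_cvg fg) cf.
Qed.

Lemma Ck_continuous k U f x : Ck k U f -> U x -> {for x, continuous f}.
Proof. by case: k => [|k] [cf _] Ux; apply: cf; rewrite inE. Qed.

Lemma Ck_is_derive k U f i x : Ck k.+1 U f -> U x ->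
  is_derive x (unit_vec i) f (partial i f x).
Proof. by move=> [_ /(_ i)[df _]] Ux; apply: DeriveDef => //; exact: df. Qed.

Lemma Ck_partial k U f i : Ck k.+1 U f -> Ck k U (partial i f).
Proof. by move=> [_ /(_ i)[_]]. Qed.

Lemma CkW k U f : Ck k.+1 U f -> Ck k U f.
Proof.
elim: k f => [|k IH] f [cf df]; split=> // i.
by have [d1 d2] := df i; split=> //; apply: IH.
Qed.

Lemma Ck_sub k U V f : V `<=` U -> Ck k U f -> Ck k V f.
Proof.
move=> VU; elim: k f => [|k IH] f [cf df]; split=> //; try by
  move=> x; rewrite inE => /VU Ux; apply: cf; rewrite inE.
by move=> i; have [d1 d2] := df i; split=> [x /VU/d1//|]; apply: IH.
Qed.

Lemma Ck_ext k U f g : open U -> {in U, f =1 g} -> Ck k U f -> Ck k U g.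
Proof.
move=> oU; have cg f' g' : {in U, f' =1 g'} -> {in U, continuous f'} -> {in U, continuous g'}.
  move=> fg cf x xU; apply: continuous_near_eq (cf x xU).
  by apply: open_eq_near fg => //; rewrite inE in xU.
elim: k f g => [|k IH] f g fg [cf df]; split=> //; try exact: cg cf.
move=> i; have [d1 d2] := df i; split=> [x Ux|].
  have : derivable f x (delta_mx 0 i) by exact: d1.
  by apply: near_eq_derivable; apply: open_eq_near fg.
apply: IH d2 => x; rewrite inE => Ux; exact: partial_ext fg.
Qed.

(** [Ck] speaks of the global function [partial i f], which is known only on U; here any G that
    gives the derivatives on U may take its place. *)
Lemma Ck_intro k U f (G : 'I_m -> 'rV[R]_m -> R) : open U ->
  (forall x, U x -> {for x, continuous f}) ->
  (forall i x, U x -> is_derive x (unit_vec i) f (G i x)) ->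
  (forall i, Ck k U (G i)) -> Ck k.+1 U f.
Proof.
move=> oU cf df CG; split=> [x|i]; first by rewrite inE => /cf.
split=> [x Ux|]; first by have [] := df i x Ux.
apply: Ck_ext (CG i) => // x; rewrite inE => Ux.
by rewrite (partialE (df i x Ux)).
Qed.

(** Every clause of [Ck] is a condition at single points, with limits taken in the whole space. This
    lets regularity on the open unit ball be checked on smaller balls, where uniform bounds hold. *)
Lemma Ck_local k U f : (forall x, U x -> exists V, V x /\ Ck k V f) -> Ck k U f.
Proof.
elim: k f => [|k IH] f loc; split=> //.
- by move=> x; rewrite inE => /loc[V [Vx /Ck_continuous]]; apply.
- by move=> x; rewrite inE => /loc[V [Vx /Ck_continuous]]; apply.
move=> i; split=> [x /loc[V [Vx [_ /(_ i)[d1 _]]]]|]; first exact: d1.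
by apply: IH => x /loc[V [Vx /Ck_partial CV]]; exists V.
Qed.

Lemma Ck_cst k U (c : R) : open U -> Ck k U (fun=> c).
Proof.
move=> oU; elim: k c => [|k IH] c.
  by split=> // x _; exact: cst_continuous.
apply: (@Ck_intro _ _ _ (fun _ _ => 0)) => //.
by move=> x _; exact: cst_continuous.
Qed.

Lemma CkD k U f g : open U -> Ck k U f -> Ck k U g -> Ck k U (fun x => f x + g x).
Proof.
move=> oU; elim: k f g => [|k IH] f g Cf Cg.
  split=> // x; rewrite inE => Ux.
  by apply: (@continuousD _ _ _ f g); [exact: Ck_continuous Cf Ux|exact: Ck_continuous Cg Ux].
apply: (@Ck_intro _ _ _ (fun i x => partial i f x + partial i g x)) => //.
- move=> x Ux.
  by apply: (@continuousD _ _ _ f g); [exact: Ck_continuous Cf Ux|exact: Ck_continuous Cg Ux].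
- by move=> i x Ux; apply: (is_deriveD (Ck_is_derive i Cf Ux) (Ck_is_derive i Cg Ux)).
- by move=> i; apply: IH; exact: Ck_partial.
Qed.

Lemma is_derive_prod f g x v (df dg : R) : is_derive x v f df -> is_derive x v g dg ->
  is_derive x v (fun z => f z * g z) (df * g x + f x * dg).
Proof.
move=> hf hg; apply: (is_derive_eq (is_deriveM hf hg)).
by rewrite addrC; congr (_ + _); rewrite -[LHS]/(_ * _) mulrC.
Qed.

Lemma is_deriveMl f x v (c d : R) : is_derive x v f d ->
  is_derive x v (fun z => c * f z) (c * d).
Proof.
move=> df; apply: (is_derive_eq (is_derive_prod (is_derive_cst c x v) df)).
by rewrite mul0r add0r.
Qed.

Lemma is_derive_sub f g x v (df dg : R) : is_derive x v f df -> is_derive x v g dg ->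
  is_derive x v (fun z => f z - g z) (df - dg).
Proof. by move=> hf hg; exact: is_deriveB. Qed.

Lemma is_derive_add f g x v (df dg : R) : is_derive x v f df -> is_derive x v g dg ->
  is_derive x v (fun z => f z + g z) (df + dg).
Proof. by move=> hf hg; exact: is_deriveD. Qed.

Lemma CkM k U f g : open U -> Ck k U f -> Ck k U g -> Ck k U (fun x => f x * g x).
Proof.
move=> oU; elim: k f g => [|k IH] f g Cf Cg.
  split=> // x; rewrite inE => Ux.
  by apply: (@continuousM _ _ f g); [exact: Ck_continuous Cf Ux|exact: Ck_continuous Cg Ux].
apply: (@Ck_intro _ _ _ (fun i x => partial i f x * g x + f x * partial i g x)) => //.
- move=> x Ux.
  by apply: (@continuousM _ _ f g); [exact: Ck_continuous Cf Ux|exact: Ck_continuous Cg Ux].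
- by move=> i x Ux; exact: (is_derive_prod (Ck_is_derive i Cf Ux) (Ck_is_derive i Cg Ux)).
- move=> i; apply: CkD => //; apply: IH;
    by [exact: Ck_partial|exact: CkW].
Qed.

Lemma CkZ k U (c : R) f : open U -> Ck k U f -> Ck k U (fun x => c * f x).
Proof. by move=> oU Cf; apply: CkM => //; exact: Ck_cst. Qed.

Lemma Ck_sum k U (I : Type) (r : seq I) (P : pred I) (F : I -> 'rV[R]_m -> R) :
  open U -> (forall i, P i -> Ck k U (F i)) -> Ck k U (fun x => \sum_(i <- r | P i) F i x).
Proof.
move=> oU CF; elim: r => [|i r IH].
  by under eq_fun do rewrite big_nil; exact: Ck_cst.
have [Pi|/negbTE nPi] := boolP (P i); last by under eq_fun do rewrite big_cons nPi.
by under eq_fun do rewrite big_cons Pi; apply: CkD => //; exact: CF.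
Qed.

Lemma is_derive_coord i j x : is_derive x (unit_vec i) (fun z => z 0 j) (i == j)%:R.
Proof.
apply/derive_cvgP; apply: cvg_near_cst; rewrite near_withinE; near=> h => h0.
by rewrite !mxE eqxx/= addrK -[LHS]/(_ * _) mulrA mulVf// mul1r eq_sym.
Unshelve. all: by end_near. Qed.

Lemma continuous_coord j x : {for x, continuous (fun z : 'rV[R]_m => z 0 j)}.
Proof.
apply/continuous_enormP => e e0; exists e => // y; apply: le_lt_trans.
by have := le_coord_enorm (y - x) j; rewrite !mxE.
Qed.

Lemma Ck_coord k U j : open U -> Ck k U (fun x => x 0 j).
Proof.
move=> oU; case: k => [|k].
  by split=> // x _; exact: continuous_coord.
apply: (@Ck_intro _ _ _ (fun i _ => (i == j)%:R)) => //.
- by move=> x _; exact: continuous_coord.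
- by move=> i x _; exact: is_derive_coord.
- by move=> i; exact: Ck_cst.
Qed.

Lemma Ck_sqr_enorm k U : open U -> Ck k U (fun x => enorm x ^+ 2).
Proof.
move=> oU; under eq_fun do rewrite sqr_enorm /dot.
by apply: Ck_sum => // i _; apply: CkM => //; exact: Ck_coord.
Qed.

Lemma is_derive_sqr_enorm i x :
  is_derive x (unit_vec i) (fun z => enorm z ^+ 2) (2 * x 0 i).
Proof.
under eq_fun do rewrite sqr_enorm /dot.
pose F j (z : 'rV[R]_m) := z 0 j * z 0 j.
have dF j : is_derive x (unit_vec i) (F j) ((i == j)%:R * x 0 j + x 0 j * (i == j)%:R).
  exact: is_derive_prod (is_derive_coord i j x) (is_derive_coord i j x).
have := is_derive_sum dF; rewrite (_ : \sum_j F j = (fun z => \sum_j F j z)).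
  move=> d; apply: is_derive_eq d _; rewrite (bigD1 i)//= big1 => [|j ji].
    by rewrite eqxx mul1r mulr1 addr0 mulr2n mulrDl mul1r.
  by rewrite eq_sym (negbTE ji) mul0r mulr0 addr0.
by apply/funext => z; rewrite fct_sumE.
Qed.

End PartialDerivatives.

(** * Harmonic functions *)

#[local] Opaque Ck partial.

Section DifferentialCalculus.
Context {R : realType} {m : nat}.
Implicit Types (U V : set 'rV[R]_m) (x y z v : 'rV[R]_m) (f g : 'rV[R]_m -> R).
Local Notation e_ := (@unit_vec R m).

Lemma mvt_coord f i z (c : R) (d : 'rV[R]_m -> R) :
    (forall t : R, 0 <= t <= 1 -> is_derive (t *: (c *: e_ i) + z) (e_ i) f
       (d (t *: (c *: e_ i) + z))) ->
  exists2 t, 0 <= t <= 1 &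
    f (z + c *: e_ i) - f z = c * d (t *: (c *: e_ i) + z).
Proof.
move=> df; pose g t := f (t *: (c *: e_ i) + z).
have dg (t : R) : 0 <= t <= 1 -> is_derive t 1 g (c * d (t *: (c *: e_ i) + z)).
  by move=> t01; apply/is_derive_line; exact/is_derive_scale_vec/df.
have [||t t01 eqg] := @MVT_segment R g (fun t => c * d (t *: (c *: e_ i) + z)) 0 1 ler01.
- move=> t; rewrite in_itv/= => /andP[t0 t1]; apply: dg.
  by rewrite !ltW.
- apply: derivable_within_continuous => t; by rewrite in_itv/= => /dg[].
exists t; first by rewrite in_itv/= in t01.
by move: eqg; rewrite /g scale1r scale0r add0r subr0 mulr1 => <-; rewrite (addrC z).
Qed.

(* Moving from x to y one coordinate at a time stays in a sup-norm ball around p,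
   where the partial derivatives are close to their values at p. *)
Lemma strict_differentiability U f p (h : R) : open U -> Ck 1 U f -> U p -> 0 < h ->
  exists2 d, 0 < d & forall x y, enorm (x - p) < d -> enorm (y - p) < d ->
    `|f y - f x - \sum_i partial i f p * (y - x) 0 i| <= h * enorm (y - x).
Proof.
move=> oU Cf Up h0.
have m1 : 0 < m.+1%:R^-1 :> R by rewrite invr_gt0.
have near i : \forall z \near p, U z /\ `|partial i f z - partial i f p| < h * m.+1%:R^-1.
  apply: filterI; first by apply: open_nbhs_nbhs.
  have := Ck_continuous (Ck_partial i Cf) Up => /cvgrPdist_lt/(_ (h * m.+1%:R^-1)).
  by rewrite mulr_gt0// => /(_ erefl); apply: filterS => z; rewrite distrC.
have := filter_forall (nbhs_filter p) near.
move=> /nbhs_ballP[r /= r0 rP].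
exists r => // x y xp yp.
pose w (k : nat) : 'rV[R]_m := \row_i if (i < k)%N then y 0 i else x 0 i.
have w0 : w 0%N = x by apply/rowP => i; rewrite mxE.
have wm : w m = y by apply/rowP => i; rewrite mxE ltn_ord.
have wS (k : 'I_m) : w k.+1 = w k + (y 0 k - x 0 k) *: e_ k.
  apply/rowP => i; rewrite !mxE eqxx/= ltnS leq_eqVlt -(inj_eq val_inj)/=.
  case: (ltngtP i k) => [ik|ik|/val_inj ->]; rewrite ?mulr0 ?addr0// mulr1.
  by rewrite addrC subrK.
have ball_itv (z : 'rV[R]_m) : (forall i, `|z 0 i - p 0 i| < r) -> ball p r z.
  move=> zr; rewrite -ball_normE /ball_/= distrC.
  rewrite [`|_|]/Num.norm/= mx_normrE; apply/bigmax_ltP; split=> // -[i j] _ /=.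
  by rewrite ord1 !mxE.
have xr i : `|x 0 i - p 0 i| < r.
  by have := le_coord_enorm (x - p) i; rewrite !mxE => /le_lt_trans; exact.
have yr i : `|y 0 i - p 0 i| < r.
  by have := le_coord_enorm (y - p) i; rewrite !mxE => /le_lt_trans; exact.
have seg (k : 'I_m) (t : R) : 0 <= t <= 1 -> ball p r (t *: ((y 0 k - x 0 k) *: e_ k) + w k).
  move=> /andP[t0 t1]; apply: ball_itv => i; rewrite !mxE eqxx/=.
  have [->|ik] := eqVneq i k.
    rewrite ltnn mulr1.
    have -> : t * (y 0 k - x 0 k) + x 0 k - p 0 k =
      t * (y 0 k - p 0 k) + (1 - t) * (x 0 k - p 0 k) by ring.
    have mr : Num.max `|y 0 k - p 0 k| `|x 0 k - p 0 k| < r by rewrite gt_max yr xr.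
    apply: le_lt_trans mr; rewrite (le_trans (ler_normD _ _))// !normrM.
    rewrite (ger0_norm t0) (@ger0_norm _ (1 - t)) ?subr_ge0//.
    set M := Num.max _ _.
    have yM : `|y 0 k - p 0 k| <= M by rewrite le_max lexx.
    have xM : `|x 0 k - p 0 k| <= M by rewrite le_max lexx orbT.
    rewrite [leRHS](_ : M = t * M + (1 - t) * M); last by ring.
    by rewrite lerD// ler_wpM2l// subr_ge0.
  by rewrite !mulr0 add0r; case: ifP.
have step (k : 'I_m) : `|f (w k.+1) - f (w k) - partial k f p * (y - x) 0 k| <=
    h * m.+1%:R^-1 * enorm (y - x).
  have [t t01 eqt] := @mvt_coord f k (w k) (y 0 k - x 0 k) (partial k f)
    (fun t t01 => Ck_is_derive k Cf (rP _ (seg k t t01) k).1).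
  rewrite wS eqt !mxE [_ * (_ - _)]mulrC -mulrBr normrM mulrC.
  have [_ /ltW pk] := rP _ (seg k t t01) k.
  rewrite ler_pM//; have := le_coord_enorm (y - x) k.
  by rewrite !mxE.
have -> : f y - f x - \sum_i partial i f p * (y - x) 0 i =
    \sum_(i < m) (f (w i.+1) - f (w i) - partial i f p * (y - x) 0 i).
  rewrite sumrB; congr (_ - _); rewrite -w0 -wm -(big_mkord xpredT (fun i => f (w i.+1) - f (w i))).
  by rewrite telescope_sumr.
apply: le_trans (ler_norm_sum _ _ _) _.
apply: (@le_trans _ _ (\sum_(i < m) h * m.+1%:R^-1 * enorm (y - x))).
  exact: ler_sum.
rewrite sumr_const card_ord -[leLHS]mulr_natl.
rewrite [leLHS](_ : _ = (m%:R / m.+1%:R) * (h * enorm (y - x))); last by ring.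
rewrite ler_piMl ?mulr_ge0 ?(ltW h0) ?enorm_ge0//.
by rewrite ler_pdivrMr// mul1r ler_nat.
Qed.

(** Strict differentiability along the line through p. The radial potential needs it for the
    direction x, which is not a coordinate direction. *)
Lemma is_derive_direction U f p v : open U -> Ck 1 U f -> U p ->
  is_derive p v f (\sum_i v 0 i * partial i f p).
Proof.
move=> oU Cf Up; apply/derive_cvgP/cvgrPdist_le => e e0.
have ev : 0 < e / (enorm v + 1) by rewrite divr_gt0// ltr_wpDl.
have [d d0 dP] := strict_differentiability oU Cf Up ev.
have ed : 0 < d / (enorm v + 1) by rewrite divr_gt0// ltr_wpDl.
near=> t.
have t0 : t != 0 by near: t; exact: nbhs_dnbhs_neq.
have tv : enorm (t *: v + p - p) < d.
  rewrite addrK enormZ; apply: (@le_lt_trans _ _ (`|t| * (enorm v + 1))).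
    by rewrite ler_wpM2l// lerDl.
  rewrite -ltr_pdivlMr ?ltr_wpDl//; near: t; exact: dnbhs0_lt.
have := dP p _ _ tv; rewrite subrr enorm0 addrK => /(_ d0).
rewrite enormZ => h.
have -> : \sum_i v 0 i * partial i f p - t^-1 *: (f (t *: v + p) - f p) =
  - (t^-1 * (f (t *: v + p) - f p - \sum_i partial i f p * (t *: v) 0 i)).
  rewrite mulrBr opprB; congr (_ - _); rewrite mulr_sumr; apply: eq_bigr => i _.
  by rewrite mxE mulrCA (mulrCA t^-1) mulVKf// mulrC.
rewrite normrN normrM normfV ler_pdivrMl ?normr_gt0// (le_trans h)//.
rewrite mulrCA ler_wpM2l// -mulrA ler_piMr ?(ltW e0)//.
by rewrite ler_pdivrMl ?ltr_wpDl ?enorm_ge0// mulr1 lerDl.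
Unshelve. all: by end_near. Qed.

(** The mean value theorem in direction i, then in direction j. Exchanging i and j merely rearranges
    the second difference, whence the equality of mixed derivatives. *)
Let second_difference U f p (i j : 'I_m) (e : R) : open U -> Ck 2 U f -> U p -> 0 < e ->
  exists2 d, 0 < d & forall h, 0 < h -> h < d ->
    `|(f (p + h *: e_ i + h *: e_ j) - f (p + h *: e_ i) - (f (p + h *: e_ j) - f p))
      - h ^+ 2 * partial j (partial i f) p| <= h ^+ 2 * e.
Proof.
move=> oU Cf Up e0.
have Cj : Ck 0 U (partial j (partial i f)) by do 2 apply: Ck_partial.
have [d1 d10 d1P] := iffLR (continuous_enormP _ _) (Ck_continuous Cj Up) e e0.
have /nbhs_enormP[d2 d20 d2P] : nbhs p U by apply: open_nbhs_nbhs.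
pose d := Num.min d1 d2; have d0 : 0 < d by rewrite lt_min d10.
have dP z : enorm (z - p) < d ->
    U z /\ `|partial j (partial i f) z - partial j (partial i f) p| <= e.
  by rewrite lt_min => /andP[/d1P/ltW zp /d2P].
exists (d / 2); first by rewrite divr_gt0.
move=> h h0 hd.
have ev k : enorm (e_ k) = 1.
  rewrite enormE /dot (bigD1 k)//= big1 => [|l lk]; rewrite !mxE ?eqxx/=.
    by rewrite mulr1 addr0 sqrtr1.
  by rewrite (negbTE lk) mulr0.
have close (s t : R) : 0 <= s <= h -> 0 <= t <= h -> enorm (s *: e_ i + t *: e_ j) < d.
  move=> /andP[s0 s1] /andP[t0 t1]; rewrite (le_lt_trans (enormD _ _))//.
  by rewrite !enormZ !ev !mulr1 !ger0_norm//; lra.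
pose g z := f (z + h *: e_ j) - f z.
have dg (t : R) : 0 <= t <= 1 -> is_derive (t *: (h *: e_ i) + p) (e_ i) g
    (partial i f (t *: (h *: e_ i) + p + h *: e_ j) - partial i f (t *: (h *: e_ i) + p)).
  move=> /andP[t0 t1].
  have th : 0 <= t * h <= h by rewrite mulr_ge0 ?(ltW h0)//= ler_piMl// ltW.
  apply: is_derive_sub; last first.
    apply: (Ck_is_derive i Cf); apply: (dP _ _).1; rewrite addrK scalerA.
    have := close (t * h) 0 th; rewrite scale0r addr0; apply.
    by rewrite lexx ltW.
  have := @is_derive_affine _ _ f (t *: (h *: e_ i) + p) (e_ i) (h *: e_ j) 1.
  rewrite scale1r => /(_ (partial i f (t *: (h *: e_ i) + p + h *: e_ j))).
  rewrite mul1r; under eq_fun do rewrite scale1r; apply.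
  apply: (Ck_is_derive i Cf); apply: (dP _ _).1.
  rewrite addrAC addrK scalerA; apply: close => //; rewrite lexx ltW//.
have [t t01 ->] : exists2 t, 0 <= t <= 1 &
   g (p + h *: e_ i) - g p = h * (partial i f (t *: (h *: e_ i) + p + h *: e_ j) -
     partial i f (t *: (h *: e_ i) + p)).
  exact: (mvt_coord (d := fun z => partial i f (z + h *: e_ j) - partial i f z)).
move: (t01) => /andP[t0 t1].
have th : 0 <= t * h <= h by rewrite mulr_ge0 ?(ltW h0)//= ler_piMl// ltW.
have cl (s : R) : 0 <= s <= 1 -> enorm (s *: (h *: e_ j) + (t *: (h *: e_ i) + p) - p) < d.
  move=> /andP[s0 s1]; rewrite addrA addrK addrC !scalerA; apply: close => //.
  by rewrite mulr_ge0 ?(ltW h0)//= ler_piMl// ltW.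
have [s s01 ->] := @mvt_coord (partial i f) j (t *: (h *: e_ i) + p) h
  (partial j (partial i f)) (fun s s01 => Ck_is_derive j (Ck_partial i Cf) (dP _ (cl s s01)).1).
rewrite mulrA -expr2 -mulrBr normrM ger0_norm ?exprn_ge0 ?(ltW h0)//.
rewrite ler_wpM2l ?exprn_ge0 ?(ltW h0)//; exact: (dP _ (cl s s01)).2.
Qed.

Lemma partial_comm U f p (i j : 'I_m) : open U -> Ck 2 U f -> U p ->
  partial j (partial i f) p = partial i (partial j f) p.
Proof.
move=> oU Cf Up; apply/eqP; rewrite -subr_eq0 -normr_le0; apply/ler_addgt0Pr => e e0.
rewrite add0r; have e2 : 0 < e / 2 by rewrite divr_gt0.
have [d d0 dP] := second_difference i j oU Cf Up e2.
have [d' d'0 d'P] := second_difference j i oU Cf Up e2.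
pose h := Num.min d d' / 2.
have mind : 0 < Num.min d d' by rewrite lt_min d0.
have h0 : 0 < h by rewrite divr_gt0.
have hm : h < Num.min d d' by rewrite /h; lra.
have hd : h < d by rewrite (lt_le_trans hm)// ge_min lexx.
have hd' : h < d' by rewrite (lt_le_trans hm)// ge_min lexx orbT.
have h2 : 0 < h ^+ 2 by rewrite exprn_gt0.
rewrite -(ler_pM2l h2) -[h ^+ 2 in leLHS](gtr0_norm h2) -normrM mulrBr.
have aux (a b c q X Y r : R) : `|a - b - (c - q) - X| <= r ->
    `|a - c - (b - q) - Y| <= r -> `|X - Y| <= r + r.
  move=> A B; have -> : X - Y = (a - c - (b - q) - Y) - (a - b - (c - q) - X) by ring.
  by rewrite (le_trans (ler_normB _ _))// lerD.
have := d'P h h0 hd'; rewrite (addrAC p (h *: e_ j)) => B.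
by have := aux _ _ _ _ _ _ _ (dP h h0 hd) B; rewrite -mulrDr -splitr.
Qed.

(** At the maximum [dphi] vanishes; were s > 0, it would be positive just to the right and phi would
    increase there. *)
Lemma second_derivative_test (phi dphi : R -> R) (s d : R) : 0 < d ->
  (forall t : R, `|t| < d -> is_derive t 1 phi (dphi t)) -> is_derive (0 : R) 1 dphi s ->
  (forall t : R, `|t| < d -> phi t <= phi 0) -> s <= 0.
Proof.
move=> d0 dp ds pmax; rewrite leNgt; apply/negP => s0.
have nd : - d <= d by lra.
have itv t : t \in `]- d, d[ -> `|t| < d by rewrite in_itv/= ltr_norml.
have i0 : 0 \in `]- d, d[ by rewrite in_itv/= oppr_lt0 d0.
have dp0 : dphi 0 = 0.
  have dv t : t \in `]- d, d[ -> derivable phi t 1 by move=> /itv/dp[].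
  have [_ e1] := derive1_at_max nd dv i0 (fun t td => pmax t (itv t td)).
  by have [_ <-] := dp 0 (itv 0 i0).
have /derive_cvgP/cvgr_gt/(_ 0 s0) := ds; rewrite near_withinE => /nbhs_ballP[r /= r0 rP].
pose t := Num.min r d / 2.
have m0 : 0 < Num.min r d by rewrite lt_min r0.
have t0 : 0 < t by rewrite divr_gt0.
have tm : t < Num.min r d by rewrite /t; lra.
have tr : t < r by rewrite (lt_le_trans tm)// ge_min lexx.
have td : t < d by rewrite (lt_le_trans tm)// ge_min lexx orbT.
have abs u : 0 <= u -> u <= t -> `|u| < d.
  by move=> u0 ut; rewrite ger0_norm// (le_lt_trans ut).
have [||u] := @MVT R phi dphi 0 t t0.
- by move=> u; rewrite in_itv/= => /andP[u0 ut]; apply/dp/abs; rewrite ltW.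
- apply: derivable_within_continuous => u; rewrite in_itv/= => /andP[u0 ut].
  by have [] := dp u (abs u u0 ut).
rewrite in_itv/= subr0 => /andP[u0 ut] eqphi.
have : 0 < dphi u.
  have /rP/(_ (lt0r_neq0 u0)) : ball 0 r u.
    by rewrite -ball_normE /ball_/= sub0r normrN gtr0_norm// (lt_trans ut).
  by rewrite dp0 subr0 addr0 [_%:A]mulr1 -[X in _ < X]/(_ * _) pmulr_rgt0 ?invr_gt0.
rewrite -(pmulr_lgt0 _ t0) -eqphi subr_gt0 ltNge => /negP; apply.
by apply/pmax/abs => //; exact: ltW.
Qed.

Definition laplacian f x : R := \sum_i partial i (partial i f) x.

Lemma local_max_partial2 U f p i (d : R) : Ck 2 U f -> 0 < d ->
  (forall y, enorm (y - p) < d -> U y /\ f y <= f p) -> partial i (partial i f) p <= 0.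
Proof.
move=> Cf d0 dP.
have line (t : R) : `|t| < d -> U (t *: e_ i + p) /\ f (t *: e_ i + p) <= f p.
  move=> td; apply: dP; rewrite addrK enormZ.
  rewrite (_ : enorm (e_ i) = 1) ?mulr1//.
  rewrite enormE /dot (bigD1 i)//= big1 => [|l li]; rewrite !mxE ?eqxx/=.
    by rewrite mulr1 addr0 sqrtr1.
  by rewrite (negbTE li) mulr0.
have l0 : `|0 : R| < d by rewrite normr0.
pose phi t := f (t *: e_ i + p); pose dphi t := partial i f (t *: e_ i + p).
have dp (t : R) : `|t| < d -> is_derive t 1 phi (dphi t).
  by move=> /line[Ut _]; apply/is_derive_line; exact: (Ck_is_derive i Cf).
have ds : is_derive (0 : R) 1 dphi (partial i (partial i f) p).
  apply/is_derive_line; rewrite scale0r add0r; apply: (Ck_is_derive i (Ck_partial i Cf)).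
  by have [+ _] := line 0 l0; rewrite scale0r add0r.
have pmax (t : R) : `|t| < d -> phi t <= phi 0.
  by move=> /line[_]; rewrite /phi scale0r add0r.
exact: second_derivative_test d0 dp ds pmax.
Qed.

Lemma laplacianD U f g x : open U -> Ck 2 U f -> Ck 2 U g -> U x ->
  laplacian (fun z => f z + g z) x = laplacian f x + laplacian g x.
Proof.
move=> oU Cf Cg Ux; rewrite /laplacian -big_split/=; apply: eq_bigr => i _.
have E : {in U, partial i (fun z => f z + g z) =1 (fun z => partial i f z + partial i g z)}.
  move=> z; rewrite inE => Uz; apply: partialE.
  exact: is_derive_add (Ck_is_derive i Cf Uz) (Ck_is_derive i Cg Uz).
rewrite (partial_ext i oU Ux E); apply: partialE.
exact: is_derive_add (Ck_is_derive i (Ck_partial i Cf) Ux) (Ck_is_derive i (Ck_partial i Cg) Ux).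
Qed.

Lemma laplacianZ U f (c : R) x : open U -> Ck 2 U f -> U x ->
  laplacian (fun z => c * f z) x = c * laplacian f x.
Proof.
move=> oU Cf Ux; rewrite /laplacian mulr_sumr; apply: eq_bigr => i _.
have E : {in U, partial i (fun z => c * f z) =1 (fun z => c * partial i f z)}.
  move=> z; rewrite inE => Uz; apply: partialE.
  exact: is_deriveMl (Ck_is_derive i Cf Uz).
rewrite (partial_ext i oU Ux E); apply: partialE.
exact: is_deriveMl (Ck_is_derive i (Ck_partial i Cf) Ux).
Qed.

Lemma laplacian_sqr_enorm x : laplacian (fun z => enorm z ^+ 2) x = (2 * m)%:R.
Proof.
rewrite /laplacian (eq_bigr (fun=> 2)) => [|i _].
  by rewrite sumr_const card_ord -[LHS]mulr_natr natrM.
have -> : partial i (fun z => enorm z ^+ 2) = fun z => 2 * z 0 i.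
  by apply/funext => z; apply: partialE; exact: is_derive_sqr_enorm.
by apply: partialE; have := is_deriveMl 2 (is_derive_coord i i x); rewrite eqxx mulr1.
Qed.

Lemma maximum_principle f (r : R) : (0 < m)%N -> 0 < r -> Ck 2 (eball r) f ->
    {within [set x | enorm x <= r], continuous f} ->
    (forall x, enorm x < r -> laplacian f x = 0) ->
    (forall x, enorm x = r -> f x <= 0) ->
  forall x, enorm x <= r -> f x <= 0.
Proof.
move=> m0 r0 Cf cf lapf fr x xr; apply/ler_addgt0Pr => e e0; rewrite add0r.
have oB := @open_eball R m r.
(* The added b |z|^2 has Laplacian 2 m b > 0, which excludes an interior maximum of g, and it is at
   most e on the ball. *)
pose b := e / r ^+ 2.
have b0 : 0 < b by rewrite divr_gt0 ?exprn_gt0.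
pose g z := f z + b * enorm z ^+ 2.
have Cs : Ck 2 (eball r) (fun z : 'rV[R]_m => b * enorm z ^+ 2).
  exact: (CkZ b oB (Ck_sqr_enorm 2 oB)).
have Cg : Ck 2 (eball r) g by exact: (CkD oB Cf Cs).
have [c /[!inE]/= cr cmax] : exists2 c, c \in [set x : 'rV[R]_m | enorm x <= r] &
    forall t, t \in [set x : 'rV[R]_m | enorm x <= r] -> g t <= g c.
  apply: EVT_max_rV; [by exists x|exact: compact_enorm_le|].
  apply: within_continuousD => //; apply: within_continuousZ.
  exact: within_continuous_sqr_enorm.
have gx : g x <= g c by apply: cmax; rewrite inE.
have br : b * r ^+ 2 = e by rewrite /b divfK// gt_eqF// exprn_gt0.
have fg : f x <= g x by rewrite lerDl mulr_ge0 ?(ltW b0)// exprn_ge0.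
move: cr; rewrite le_eqVlt => /orP[/eqP cr|cr].
  rewrite (le_trans fg)// (le_trans gx)// /g cr br.
  by rewrite -[leRHS]add0r lerD2r fr.
have [d d0 dP] : exists2 d, 0 < d & forall y, enorm (y - c) < d -> eball r y /\ g y <= g c.
  have /nbhs_enormP[d d0 dP] := eball_nbhs cr.
  exists d => // y /dP yr; split=> //; apply: cmax; rewrite inE/=; exact: ltW.
have : laplacian g c <= 0.
  by apply: sumr_le0 => i _; exact: local_max_partial2 Cg d0 dP.
rewrite (laplacianD oB Cf Cs cr) lapf// add0r (laplacianZ b oB (Ck_sqr_enorm 2 oB) cr).
by rewrite laplacian_sqr_enorm pmulr_rle0// lern0 muln_eq0/= (gtn_eqF m0).
Qed.

Lemma harmonic_unique f g (r : R) : (0 < m)%N -> 0 < r ->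
    Ck 2 (eball r) f -> Ck 2 (eball r) g ->
    {within [set x | enorm x <= r], continuous f} ->
    {within [set x | enorm x <= r], continuous g} ->
    (forall x, enorm x < r -> laplacian f x = 0) ->
    (forall x, enorm x < r -> laplacian g x = 0) ->
    (forall x, enorm x = r -> f x = g x) ->
  forall x, enorm x <= r -> f x = g x.
Proof.
move=> m0 r0.
suff le f' g' : Ck 2 (eball r) f' -> Ck 2 (eball r) g' ->
    {within [set x | enorm x <= r], continuous f'} ->
    {within [set x | enorm x <= r], continuous g'} ->
    (forall x, enorm x < r -> laplacian f' x = 0) ->
    (forall x, enorm x < r -> laplacian g' x = 0) ->
    (forall x, enorm x = r -> f' x = g' x) ->
    forall x, enorm x <= r -> f' x <= g' x.
  move=> Cf Cg cf cg lf lg fg x xr; have gf y : enorm y = r -> g y = f y by move/fg.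
  apply/eqP; rewrite eq_le (le _ _ Cf Cg cf cg lf lg fg _ xr).
  by rewrite (le _ _ Cg Cf cg cf lg lf gf _ xr).
move: f' g' => {}f {}g Cf Cg cf cg lf lg fg x xr.
have oB := @open_eball R m r.
have Ng : Ck 2 (eball r) (fun z => -1 * g z) by exact: (CkZ _ oB Cg).
pose F z := f z + -1 * g z.
have cF : {within [set x | enorm x <= r], continuous F}.
  by apply: within_continuousD cf _; exact: within_continuousZ cg.
have lF z : enorm z < r -> laplacian F z = 0.
  move=> zr; rewrite (laplacianD oB Cf Ng zr) (laplacianZ _ oB Cg zr).
  by rewrite (lf _ zr) (lg _ zr) mulr0 addr0.
have bF z : enorm z = r -> F z <= 0 by move=> /fg; rewrite /F => ->; rewrite mulN1r subrr.
have := maximum_principle m0 r0 (CkD oB Cf Ng) cF lF bF xr.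
by rewrite mulN1r subr_le0.
Qed.

End DifferentialCalculus.

(** * Averages over the sphere *)

Section ParametricIntegrals.
Context {R : realType} {m : nat} {d : measure_display} {T : measurableType d}.
Context (mu : {measure set T -> \bar R}) (D : set T).
Hypothesis mD : measurable D.
Hypothesis muD : (mu D < +oo)%E.
Implicit Types (U : set 'rV[R]_m) (x : 'rV[R]_m) (F : 'rV[R]_m -> T -> R) (h : T -> R).
Local Notation e_ := (@unit_vec R m).

Lemma integrable_bounded h (C : R) : measurable_fun D h ->
  (forall y, D y -> `|h y| <= C) -> mu.-integrable D (EFin \o h).
Proof.
move=> mh hC; apply: measurable_bounded_integrable => //.
exists C; split; first exact: num_real.
by move=> M CM y Dy /=; rewrite (le_trans (hC y Dy))// ltW.
Qed.

Lemma norm_Rintegral_le h (C : R) : measurable_fun D h ->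
  (forall y, D y -> `|h y| <= C) -> `|\int[mu]_(y in D) h y| <= C * fine (mu D).
Proof.
move=> mh hC; apply: le_trans (le_normr_Rintegral mD (integrable_bounded mh hC)) _.
rewrite -Rintegral_cst//; apply: le_Rintegral => //.
- have := integrable_bounded (h := fun y => `|h y|) (C := C).
  apply; first exact: measurableT_comp.
  by move=> y Dy; rewrite normr_id hC.
- by apply: (integrable_bounded (C := `|C|)) => //; exact: measurable_cst.
Qed.

(* Bounds and moduli of continuity are uniform in the parameter y, so that
   integration in y preserves the class. *)
Fixpoint Ckfam (k : nat) U F : Prop :=
  [/\ forall x, U x -> measurable_fun D (F x),
      exists C, forall x y, U x -> D y -> `|F x y| <= C &
      forall x e, U x -> 0 < e -> exists2 r, 0 < r & forall x', U x' ->
        enorm (x' - x) < r -> forall y, D y -> `|F x' y - F x y| <= e] /\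
  match k with
  | 0 => True
  | k'.+1 => exists G : 'I_m -> 'rV[R]_m -> T -> R,
      (forall i x y, U x -> D y -> is_derive x (e_ i) (F ^~ y) (G i x y)) /\
      (forall i, Ckfam k' U (G i))
  end.

Lemma Ckfam0 k U F : Ckfam k U F -> Ckfam 0 U F.
Proof. by case: k => [//|k] []. Qed.

Lemma Ckfam_integrable U F x : Ckfam 0 U F -> U x -> mu.-integrable D (EFin \o F x).
Proof.
by move=> [[mF [C FC] _] _] Ux; apply: (integrable_bounded (mF x Ux) (FC x ^~ Ux)).
Qed.

Lemma continuous_Rintegral U F x : open U -> Ckfam 0 U F -> U x ->
  {for x, continuous (fun x => \int[mu]_(y in D) F x y)}.
Proof.
move=> oU CF Ux; have [[mF _ eF] _] := CF; apply/continuous_enormP => e e0.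
have M0 : 0 < fine (mu D) + 1 by rewrite ltr_wpDl// fine_ge0.
have e1 : 0 < e / (fine (mu D) + 1) by rewrite divr_gt0.
have [r r0 rP] := eF x _ Ux e1.
have /nbhs_enormP[r' r'0 r'P] : nbhs x U by exact: open_nbhs_nbhs.
exists (Num.min r r'); first by rewrite lt_min r0.
move=> y; rewrite lt_min => /andP[yr yr']; have Uy := r'P _ yr'.
rewrite -(RintegralB mD (Ckfam_integrable CF Uy) (Ckfam_integrable CF Ux)).
apply: le_lt_trans (norm_Rintegral_le (C := e / (fine (mu D) + 1)) _ _) _.
- by apply: measurable_funB; exact: mF.
- by move=> z Dz; exact: rP.
- by rewrite -mulrAC ltr_pdivrMr// ltr_pM2l// ltrDl.
Qed.

Lemma is_derive_Rintegral U F (G : 'I_m -> 'rV[R]_m -> T -> R) i x : open U ->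
  Ckfam 0 U F -> Ckfam 0 U (G i) ->
  (forall x y, U x -> D y -> is_derive x (e_ i) (F ^~ y) (G i x y)) -> U x ->
  is_derive x (e_ i) (fun x => \int[mu]_(y in D) F x y) (\int[mu]_(y in D) G i x y).
Proof.
move=> oU CF CG dF Ux.
have /nbhs_enormP[r r0 rP] : nbhs x U by exact: open_nbhs_nbhs.
have line t : t \in `]- r, r[ -> U (t *: e_ i + x).
  rewrite in_itv/= -ltr_norml => tr; apply: rP; rewrite addrK enormZ.
  rewrite (_ : enorm (e_ i) = 1) ?mulr1//.
  rewrite enormE /dot (bigD1 i)//= big1 => [|l li]; rewrite !mxE ?eqxx/=.
    by rewrite mulr1 addr0 sqrtr1.
  by rewrite (negbTE li) mulr0.
have [[_ [C GC] _] _] := CG.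
pose f t y := F (t *: e_ i + x) y.
have df t y : t \in `]- r, r[ -> D y -> is_derive t 1 (f ^~ y) (G i (t *: e_ i + x) y).
  by move=> tr Dy; apply/(is_derive_line (F ^~ y)); apply: dF => //; exact: line.
have i0 : (0 : R) \in `]- r, r[ by rewrite in_itv/= oppr_lt0 r0.
have d1 t y : t \in `]- r, r[ -> D y -> partial1of2 f t y = G i (t *: e_ i + x) y.
  by move=> tr Dy; rewrite partial1of2E; have [_ ->] := df t y tr Dy.
have := @cvg_differentiation_under_integral R d T mu f D mD 0 (- r) r i0 _ _
  (fun=> `|C|) _ _ _.
have -> : \int[mu]_(y in D) partial1of2 f 0 y = \int[mu]_(y in D) G i x y.
  by apply: eq_Rintegral => y; rewrite inE => Dy; rewrite d1// scale0r add0r.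
move=> cvgf; apply/derive_cvgP.
have : (fun h : R => h^-1 *: (\int[mu]_(y in D) f (h + 0) y - \int[mu]_(y in D) f 0 y)) =
    (fun h : R => h^-1 *: (\int[mu]_(y in D) F (h *: e_ i + x) y - \int[mu]_(y in D) F x y)).
  by apply/funext => h; rewrite addr0 /f scale0r add0r.
move=> <-; apply: cvgf => //.
- by move=> t tr; apply: Ckfam_integrable CF (line t tr).
- by move=> t y tr Dy; have [] := df t y tr Dy.
- have mc : measurable_fun D (fun=> `|C|) by exact: measurable_cst.
  by apply: (integrable_bounded (C := `|C|) mc) => y _; rewrite normr_id.
- move=> t y tr Dy; rewrite d1//; apply: le_trans (GC _ _ (line t tr) Dy) _.
  exact: ler_norm.
Qed.

Lemma Ck_Rintegral k U F : open U -> Ckfam k U F ->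
  Ck k U (fun x => \int[mu]_(y in D) F x y).
Proof.
move=> oU; elim: k F => [|k IH] F CF.
  by split=> // x; rewrite inE; exact: continuous_Rintegral.
have [_ [G [dF CG]]] := CF.
apply: (@Ck_intro _ _ k U _ (fun i x => \int[mu]_(y in D) G i x y)) => //.
- by move=> x Ux; apply: continuous_Rintegral Ux => //; exact: Ckfam0 CF.
- move=> i x Ux.
  exact: (is_derive_Rintegral oU (Ckfam0 CF) (Ckfam0 (CG i)) (fun z y => dF i z y) Ux).
- by move=> i; exact: IH (CG i).
Qed.

End ParametricIntegrals.

Section SphereAverage.
Context {R : realType} {n : nat}.
Local Notation S := (@unit_sphere R n.+1).
Local Notation mu := (surface_measure R n.+1).
Implicit Types (h k : 'rV[R]_n.+1 -> R).

Lemma compact_unit_sphere : compact S.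
Proof.
apply: (subclosed_compact _ (@compact_enorm_le R n.+1 1)); last by move=> x /= ->.
rewrite [X in closed X](_ : _ = enorm @^-1` [set 1]).
  by apply: preimage_closed; [move=> x _; exact: continuous_enorm|exact: closed_eq].
by apply/seteqP; split.
Qed.

Lemma within_continuous_bounded {m} (K : set 'rV[R]_m) (f : 'rV[R]_m -> R) : compact K ->
  {within K, continuous f} -> exists2 C, 0 <= C & forall x, K x -> `|f x| <= C.
Proof.
move=> cK cf; have [[x0 Kx0]|K0] := pselect (K !=set0); last first.
  by exists 0 => // x Kx; case: K0; exists x.
have [c _ cmax] : exists2 c, c \in K & forall t, t \in K -> `|f t| <= `|f c|.
  apply: (EVT_max_rV (f := fun x => `|f x|)) => //; first by exists x0.
  rewrite subspace_continuousP => x Kx; apply: cvg_norm.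
  by move: cf; rewrite subspace_continuousP; exact.
by exists `|f c| => // x Kx; apply: cmax; rewrite inE.
Qed.

Lemma measurable_unit_sphere : measurable (S : set (caratheodory_type (hausdorff_outer R n.+1 n.+1.-1))).
Proof. exact: caratheodory_unit_sphere. Qed.
Let mS := measurable_unit_sphere.

Lemma surface_unit_sphere_lty : (mu S < +oo)%E.
Proof. exact: hausdorff_unit_sphere_lty. Qed.
Let muS := surface_unit_sphere_lty.

Lemma fine_surface_unit_sphere_gt0 : 0 < fine (mu S).
Proof.
by rewrite fine_gt0// surface_unit_sphere_lty andbT; exact: hausdorff_unit_sphere_gt0.
Qed.
Let muS0 := fine_surface_unit_sphere_gt0.

Lemma measurable_fun_sphere h : {within S, continuous h} ->
  measurable_fun (S : set (caratheodory_type (hausdorff_outer R n.+1 n.+1.-1))) h.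
Proof.
move=> ch; apply: measurable_fun_within_continuous ch; first exact: compact_unit_sphere.
exact: caratheodory_unit_sphere.
Qed.

Lemma integrable_sphere h : {within S, continuous h} -> mu.-integrable S (EFin \o h).
Proof.
move=> ch; have [C _ hC] := within_continuous_bounded compact_unit_sphere ch.
exact: (integrable_bounded mS muS (measurable_fun_sphere ch) hC).
Qed.

Definition savg h : R := (fine (mu S))^-1 * \int[mu]_(y in S) h y.

Lemma eq_savg h k : (forall y, S y -> h y = k y) -> savg h = savg k.
Proof. by move=> hk; congr (_ * _); apply: eq_Rintegral => y; rewrite inE => /hk. Qed.

Lemma savg_cst c : savg (fun=> c) = c.
Proof. by rewrite /savg Rintegral_cst// mulrCA mulVf ?mulr1// gt_eqF. Qed.

Lemma savgD h k : {within S, continuous h} -> {within S, continuous k} ->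
  savg (fun y => h y + k y) = savg h + savg k.
Proof.
by move=> ch ck; rewrite /savg (RintegralD mS (integrable_sphere ch) (integrable_sphere ck)) mulrDr.
Qed.

Lemma savgB h k : {within S, continuous h} -> {within S, continuous k} ->
  savg (fun y => h y - k y) = savg h - savg k.
Proof.
by move=> ch ck; rewrite /savg (RintegralB mS (integrable_sphere ch) (integrable_sphere ck)) mulrBr.
Qed.

Lemma savgZ h c : {within S, continuous h} -> savg (fun y => c * h y) = c * savg h.
Proof.
by move=> ch; rewrite /savg (RintegralZl c mS (integrable_sphere ch)) mulrCA.
Qed.

Lemma savg_le h k : {within S, continuous h} -> {within S, continuous k} ->
  (forall y, S y -> h y <= k y) -> savg h <= savg k.
Proof.
move=> ch ck hk; rewrite ler_wpM2l ?invr_ge0 ?(ltW muS0)//.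
exact: (le_Rintegral mS (integrable_sphere ch) (integrable_sphere ck)).
Qed.

Lemma norm_savg_le h k : {within S, continuous h} -> {within S, continuous k} ->
  (forall y, S y -> `|h y| <= k y) -> `|savg h| <= savg k.
Proof.
move=> ch ck hk; rewrite ler_norml -mulN1r -savgZ//.
apply/andP; split; apply: savg_le => //; try exact: within_continuousZ.
  by move=> y /hk; rewrite ler_norml mulN1r => /andP[].
by move=> y /hk; rewrite ler_norml => /andP[].
Qed.

(** T is its own inverse, so images are preimages, T preserves the Hausdorff outer measure and hence
    Caratheodory sets. The claim is then a change of variables for the pushforward measure. *)
Lemma savg_isometry (T : 'rV[R]_n.+1 -> 'rV[R]_n.+1) h :
    (forall x, T (T x) = x) -> (forall x y, enorm (T x - T y) = enorm (x - y)) ->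
    (forall x, S x -> S (T x)) -> {within S, continuous h} ->
  savg (h \o T) = savg h.
Proof.
move=> TK isoT TS ch; congr (_ * _).
have imT A : T @` A = T @^-1` A.
  apply/seteqP; split=> [_ [x Ax <-]|x Tx]; first by rewrite /= TK.
  by exists (T x).
have HT A : hausdorff n (T @^-1` A) = hausdorff n A.
  apply/eqP; rewrite eq_le -imT hausdorff_image/=; last by move=> x y; rewrite isoT.
  have {1}-> : A = T @` (T @` A).
    by rewrite imT imT; apply/seteqP; split=> x /=; rewrite TK.
  by rewrite hausdorff_image// => x y; rewrite isoT.
have mT : measurable_fun setT
    (T : caratheodory_type (hausdorff_outer R n.+1 n.+1.-1) ->
         caratheodory_type (hausdorff_outer R n.+1 n.+1.-1)).
  move=> _ A mA; rewrite setTI.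
  suff : (hausdorff_outer R n.+1 n.+1.-1).-caratheodory (T @^-1` A) by [].
  move=> X.
  have TX : X = T @^-1` (T @^-1` X) by apply/seteqP; split=> x /=; rewrite TK.
  have := mA (T @^-1` X); rewrite /= -!(HT (T @^-1` _ `&` _)) -(HT (T @^-1` X)) -TX => ->.
  by rewrite !preimage_setI -TX.
have ST : T @^-1` S = S.
  by apply/seteqP; split=> x Sx; [rewrite -(TK x); exact: TS|exact: TS].
pose C := `|0 : R|.
have push (f : 'rV[R]_n.+1 -> R) : {within S, continuous f} -> (forall y, S y -> 0 <= f y) ->
   \int[mu]_(y in S) f (T y) = \int[mu]_(y in S) f y.
  move=> cf f0; rewrite /Rintegral; congr fine.
  have := @ge0_integral_pushforward _ _ _ _ R _ mT mu S (EFin \o f) mS.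
  rewrite ST => <- //.
  - by apply: (eq_measure_integral mu) => A mA AS; rewrite /pushforward; exact: HT.
  - by apply/measurable_EFinP; exact: measurable_fun_sphere.
  - by move=> y; rewrite inE => /f0; rewrite lee_fin.
(* The change of variables holds for nonnegative functions; adding a bound M of |h| reduces to
   them. *)
have [M M0 hM] := within_continuous_bounded compact_unit_sphere ch.
have cM : {within S, continuous (fun=> M)} by exact: within_continuous_cst.
have cT (f : 'rV[R]_n.+1 -> R) : {within S, continuous f} -> {within S, continuous (f \o T)}.
  move=> /continuous_within_enormP cf; apply/continuous_within_enormP => x e Sx e0.
  have [d d0 dP] := cf _ _ (TS _ Sx) e0; exists d => // y Sy yx.
  by apply: dP; [exact: TS|rewrite isoT].
have shift (f : 'rV[R]_n.+1 -> R) : {within S, continuous f} ->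
    \int[mu]_(y in S) f y = \int[mu]_(y in S) (f y + M) - \int[mu]_(y in S) M.
  by move=> cf; rewrite (RintegralD mS (integrable_sphere cf) (integrable_sphere cM)) addrK.
rewrite (shift (h \o T)); last exact: cT.
rewrite (shift h ch); congr (_ - _).
apply: (push (fun y => h y + M)); first exact: within_continuousD.
by move=> y /hM; rewrite ler_norml -subr_ge0 opprK addrC => /andP[].
Qed.

End SphereAverage.

(** * The Poisson integral *)

Section KernelAlgebra.
Context {R : realType} {n : nat}.
Local Notation S := (@unit_sphere R n.+1).
Local Notation V := 'rV[R]_n.+1.
Local Notation CT := (caratheodory_type (hausdorff_outer R n.+1 n.+1.-1)).
Local Notation e_ := (@unit_vec R n.+1).
Implicit Types (x y : V) (F G : V -> V -> R).

Definition inv_dist x y : R := (enorm (y - x))^-1.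

(** A syntactic class of integrands that is closed under differentiation in x and whose members are,
    on each ball of radius r < 1, bounded and Lipschitz in x uniformly in y. Their averages over y
    are therefore of class C^k for every k, without estimating higher derivatives. *)
Inductive sphere_kernel : (V -> V -> R) -> Prop :=
| kernel_cst c : sphere_kernel (fun _ _ => c)
| kernel_fst i : sphere_kernel (fun x _ => x 0 i)
| kernel_snd u : {within S, continuous u} -> sphere_kernel (fun _ y => u y)
| kernel_inv_dist : sphere_kernel inv_dist
| kernel_add F G : sphere_kernel F -> sphere_kernel G ->
    sphere_kernel (fun x y => F x y + G x y)
| kernel_mul F G : sphere_kernel F -> sphere_kernel G ->
    sphere_kernel (fun x y => F x y * G x y).

Lemma dist_sphere_gt0 x y : enorm x < 1 -> S y -> 0 < enorm (y - x).
Proof.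
rewrite /unit_sphere/= => x1 y1; have := enorm_triangle x y 0.
by rewrite !subr0 y1; lra.
Qed.

Lemma dist_sphere_ge r x y : enorm x < r -> S y -> 1 - r <= enorm (y - x).
Proof.
rewrite /unit_sphere/= => xr y1; have := enorm_triangle x y 0.
by rewrite !subr0 y1; lra.
Qed.

Lemma within_continuous_coord (K : set V) i : {within K, continuous (fun y => y 0 i)}.
Proof. by apply: continuous_subspaceT => x; exact: continuous_coord. Qed.

Lemma kernel_continuous F x : sphere_kernel F -> enorm x < 1 ->
  {within S, continuous (F x)}.
Proof.
move=> kF x1; elim: kF => [c|i|u //||{}F G _ IF _ IG|{}F G _ IF _ IG].
- exact: within_continuous_cst.
- exact: within_continuous_cst.
- apply/subspace_continuousP => y Sy; apply: cvgV.
    by rewrite gt_eqF// dist_sphere_gt0.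
  have : {within S, continuous (fun y => enorm (y - x))}.
    apply/continuous_within_enormP => z e Sz e0; exists e => // z' Sz'.
    apply: le_lt_trans; apply: le_trans (enorm_dist _ _) _.
    by rewrite opprB addrA subrK.
  by move/subspace_continuousP; apply.
- exact: within_continuousD.
- exact: within_continuousM.
Qed.

Lemma kernel_bounded F r : sphere_kernel F -> r < 1 ->
  exists2 C, 0 <= C & forall x y, enorm x < r -> S y -> `|F x y| <= C.
Proof.
move=> kF r1; elim: kF => [c|i|u cu||{}F G _ [C C0 FC] _ [C' C'0 GC]|{}F G _ [C C0 FC] _ [C' C'0 GC]].
- by exists `|c|.
- exists 1 => // x y xr _; rewrite (le_trans (le_coord_enorm x i))//.
  by rewrite ltW// (lt_trans xr).
- have [C C0 uC] := within_continuous_bounded (@compact_unit_sphere R n) cu.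
  by exists C => // x y _; exact: uC.
- have r0 : 0 < 1 - r by rewrite subr_gt0.
  exists (1 - r)^-1; first by rewrite invr_ge0 ltW.
  move=> x y xr Sy; have xy := dist_sphere_ge xr Sy.
  have xy0 : 0 < enorm (y - x) by exact: lt_le_trans xy.
  by rewrite ger0_norm ?invr_ge0// lef_pV2 ?posrE.
- exists (C + C'); first exact: addr_ge0.
  by move=> x y xr Sy; rewrite (le_trans (ler_normD _ _))// lerD ?FC ?GC.
- exists (C * C'); first exact: mulr_ge0.
  by move=> x y xr Sy; rewrite normrM ler_pM ?FC ?GC.
Qed.

Lemma kernel_equicontinuous F r : sphere_kernel F -> r < 1 ->
  exists2 L, 0 <= L & forall x x' y, enorm x < r -> enorm x' < r -> S y ->
    `|F x' y - F x y| <= L * enorm (x' - x).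
Proof.
move=> kF r1; elim: kF => [c|i|u cu||{}F G kF [C C0 FC] kG [C' C'0 GC]|{}F G kF [C C0 FC] kG [C' C'0 GC]].
- by exists 0 => // *; rewrite subrr normr0 mul0r.
- exists 1 => // x x' y _ _ _; rewrite mul1r.
  by have := le_coord_enorm (x' - x) i; rewrite !mxE.
- by exists 0 => // *; rewrite subrr normr0 mul0r.
- have r0 : 0 < 1 - r by rewrite subr_gt0.
  exists ((1 - r)^-1 ^+ 2); first by rewrite exprn_ge0// invr_ge0 ltW.
  move=> x x' y xr x'r Sy.
  have xy := dist_sphere_ge xr Sy; have x'y := dist_sphere_ge x'r Sy.
  have xy0 : 0 < enorm (y - x) by exact: lt_le_trans xy.
  have x'y0 : 0 < enorm (y - x') by exact: lt_le_trans x'y.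
  have -> : inv_dist x' y - inv_dist x y =
      (inv_dist x y * inv_dist x' y) * (enorm (y - x) - enorm (y - x')).
    by rewrite /inv_dist; field; rewrite !gt_eqF.
  rewrite normrM ler_pM//.
    rewrite ger0_norm ?mulr_ge0 ?invr_ge0// expr2.
    by rewrite ler_pM ?invr_ge0// lef_pV2 ?posrE.
  by rewrite (le_trans (enorm_dist _ _))// opprB addrC addrA subrK.
- exists (C + C'); first exact: addr_ge0.
  move=> x x' y xr x'r Sy; rewrite opprD addrACA (le_trans (ler_normD _ _))// mulrDl.
  by rewrite lerD ?FC ?GC.
- have [B B0 FB] := kernel_bounded kF r1; have [B' B'0 GB] := kernel_bounded kG r1.
  exists (C * B' + B * C'); first by rewrite addr_ge0// mulr_ge0.
  move=> x x' y xr x'r Sy.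
  have -> : F x' y * G x' y - F x y * G x y =
    (F x' y - F x y) * G x' y + F x y * (G x' y - G x y) by ring.
  rewrite (le_trans (ler_normD _ _))// !normrM mulrDl lerD//.
    by rewrite mulrAC ler_pM ?FC ?GB.
  by rewrite -mulrA ler_pM ?FB ?GC.
Qed.

Lemma kernel_Ckfam0 F r : sphere_kernel F -> r < 1 ->
  Ckfam (S : set CT) 0 (eball r) (F : V -> CT -> R).
Proof.
move=> kF r1; split=> //; split.
- move=> x xr; apply: measurable_fun_sphere; apply: kernel_continuous => //.
  exact: lt_trans r1.
- by have [C _ FC] := kernel_bounded kF r1; exists C.
- move=> x e xr e0; have [L L0 FL] := kernel_equicontinuous kF r1.
  exists (e / (L + 1)); first by rewrite divr_gt0// ltr_wpDl.
  move=> x' x'r xx' y Sy; rewrite (le_trans (FL _ _ _ xr x'r Sy))//.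
  rewrite ltr_pdivlMr ?ltr_wpDl// in xx'.
  by rewrite (le_trans _ (ltW xx'))// mulrC ler_wpM2l// lerDl.
Qed.

Lemma is_derive_inv_dist i x y : 0 < enorm (y - x) ->
  is_derive x (e_ i) (inv_dist ^~ y) ((y 0 i - x 0 i) * inv_dist x y ^+ 3).
Proof.
move=> xy; pose q t := enorm (t *: e_ i + (x - y)) ^+ 2.
have dq : is_derive (0 : R) 1 q (2 * (x - y) 0 i).
  apply/(is_derive_line (fun z => enorm z ^+ 2)).
  by rewrite scale0r add0r; exact: is_derive_sqr_enorm.
have q0 : q 0 = enorm (y - x) ^+ 2 by rewrite /q scale0r add0r enorm_distC.
have ds : is_derive (0 : R) 1 (Num.sqrt \o q) ((2 * Num.sqrt (q 0))^-1 * (2 * (x - y) 0 i)).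
  by apply: is_derive1_comp => //; apply: is_derive1_sqrt; rewrite q0 exprn_gt0.
have s0 : (Num.sqrt \o q) 0 = enorm (y - x) by rewrite /= q0 sqrtr_sqr ger0_norm.
have ne0 : (Num.sqrt \o q) 0 != 0 by rewrite s0 gt_eqF.
have [ds1 ds2] := ds.
have dV : is_derive (0 : R) 1 (fun t => ((Num.sqrt \o q) t)^-1)
    (- (enorm (y - x)) ^- 2 * ((2 * enorm (y - x))^-1 * (2 * (x - y) 0 i))).
  split; first exact: derivableV.
  by rewrite deriveV// ds2 s0 -[Num.sqrt (q 0)]/((Num.sqrt \o q) 0) s0.
have := @is_derive_line R n.+1 (inv_dist ^~ y) x (e_ i) 0
  ((y 0 i - x 0 i) * inv_dist x y ^+ 3).
rewrite scale0r add0r => h; apply/h.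
have -> : (fun s : R => inv_dist (s *: e_ i + x) y) = (fun t => ((Num.sqrt \o q) t)^-1).
  apply/funext => t; rewrite /= /q sqrtr_sqr ger0_norm// /inv_dist enorm_distC.
  by rewrite -addrA.
apply: is_derive_eq dV _.
rewrite /inv_dist !mxE; field.
by rewrite gt_eqF.
Qed.

Lemma kernel_is_derive F : sphere_kernel F -> exists G : 'I_n.+1 -> V -> V -> R,
  (forall i x y, enorm x < 1 -> S y -> is_derive x (e_ i) (F ^~ y) (G i x y)) /\
  (forall i, sphere_kernel (G i)).
Proof.
elim=> [c|j|u cu||{}F G kF [F' [dF kF']] kG [G' [dG kG']]|{}F G kF [F' [dF kF']] kG [G' [dG kG']]].
- exists (fun _ _ _ => 0); split=> [i x y _ _|i]; last exact: kernel_cst.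
  exact: is_derive_cst.
- exists (fun i _ _ => (i == j)%:R); split=> [i x y _ _|i]; last exact: kernel_cst.
  exact: is_derive_coord.
- exists (fun _ _ _ => 0); split=> [i x y _ _|i]; last exact: kernel_cst.
  exact: is_derive_cst.
- exists (fun i x y => (y 0 i + -1 * x 0 i) * (inv_dist x y * (inv_dist x y * inv_dist x y))).
  split=> [i x y x1 Sy|i].
    apply: is_derive_eq (is_derive_inv_dist i (dist_sphere_gt0 x1 Sy)) _.
    by rewrite mulN1r !exprS expr0 mulr1.
  have kN := kernel_inv_dist.
  apply: kernel_mul (kernel_mul kN (kernel_mul kN kN)).
  apply: kernel_add; first by apply: kernel_snd; exact: within_continuous_coord.
  exact: kernel_mul (kernel_cst _) (kernel_fst _).
- exists (fun i x y => F' i x y + G' i x y); split=> [i x y x1 Sy|i].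
    by apply: is_derive_add; [exact: dF|exact: dG].
  exact: kernel_add.
- exists (fun i x y => F' i x y * G x y + F x y * G' i x y); split=> [i x y x1 Sy|i].
    by apply: is_derive_prod; [exact: dF|exact: dG].
  by apply: kernel_add; exact: kernel_mul.
Qed.

Lemma kernel_Ckfam F k r : sphere_kernel F -> r < 1 ->
  Ckfam (S : set CT) k (eball r) (F : V -> CT -> R).
Proof.
move=> + r1; elim: k F => [|k IH] F kF; first exact: kernel_Ckfam0.
split; first by have [] := kernel_Ckfam0 kF r1.
have [G [dG kG]] := kernel_is_derive kF; exists G; split=> [i x y xr Sy|i].
  by apply: dG => //; exact: lt_trans r1.
exact: IH.
Qed.

Let ball_r (x : V) : unit_ball x -> exists2 r, r < 1 & eball r x.
Proof.
rewrite /unit_ball/= => x1; exists ((1 + enorm x) / 2); first by lra.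
by rewrite /eball/=; lra.
Qed.

Lemma Ck_savg k F : sphere_kernel F -> Ck k unit_ball (fun x => savg (F x)).
Proof.
move=> kF; apply: Ck_local => x /ball_r[r r1 xr]; exists (eball r); split=> //.
apply: CkZ; first exact: open_eball.
apply: (Ck_Rintegral (@measurable_unit_sphere R n) (@surface_unit_sphere_lty R n)).
  exact: open_eball.
exact: kernel_Ckfam.
Qed.

Lemma is_derive_savg F (G : 'I_n.+1 -> V -> V -> R) i x :
  sphere_kernel F -> sphere_kernel (G i) ->
  (forall x y, enorm x < 1 -> S y -> is_derive x (e_ i) (F ^~ y) (G i x y)) ->
  unit_ball x -> is_derive x (e_ i) (fun x => savg (F x)) (savg (G i x)).
Proof.
move=> kF kG dF /ball_r[r r1 xr].
have dF' z y : eball r z -> S y -> is_derive z (e_ i) (F ^~ y) (G i z y).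
  by move=> zr Sy; apply: dF => //; exact: lt_trans r1.
have := (@is_derive_Rintegral R n.+1 _ CT (surface_measure R n.+1) S
  (@measurable_unit_sphere R n) (@surface_unit_sphere_lty R n) (eball r) F G i x
  (@open_eball R n.+1 r) (kernel_Ckfam0 kF r1) (kernel_Ckfam0 kG r1) dF' xr).
exact: is_deriveMl.
Qed.

End KernelAlgebra.

(** * Reflections in hyperplanes *)

Section Reflection.
Context {R : realType} {m : nat}.
Implicit Types (w x y z : 'rV[R]_m).

Definition reflection w z := z - (2 * dot z w / dot w w) *: w.

Lemma reflectionB w x y : reflection w (x - y) = reflection w x - reflection w y.
Proof. by apply/rowP => i; rewrite /reflection dotDl dotNl !mxE; ring. Qed.

Lemma enorm_reflection w z : 0 < dot w w -> enorm (reflection w z) = enorm z.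
Proof.
move=> w0; rewrite !enormE; congr Num.sqrt; rewrite /reflection.
rewrite !(dotDl, dotDr, dotNl, dotNr, dotZl, dotZr) (dotC w z).
by field; rewrite gt_eqF.
Qed.

Lemma reflectionK w z : 0 < dot w w -> reflection w (reflection w z) = z.
Proof.
move=> w0; apply/rowP => i; rewrite /reflection dotDl dotNl dotZl !mxE.
by field; rewrite gt_eqF.
Qed.

(** For w = x - y and |x| = |y| one has 2 x.w = w.w, so the reflection subtracts exactly w from
    x. *)
Lemma reflection_swap x y : enorm x = enorm y -> 0 < dot (x - y) (x - y) ->
  reflection (x - y) x = y.
Proof.
move=> xy w0; rewrite /reflection (_ : 2 * _ / _ = 1); last first.
  apply: (canLR (mulfK _)); rewrite ?gt_eqF// mul1r.
  rewrite !(dotDl, dotDr, dotNl, dotNr) (dotC y x) -(sqr_enorm y) -xy sqr_enorm.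
  by ring.
by rewrite scale1r opprB addrC subrK.
Qed.

End Reflection.

Section PoissonKernel.
Context {R : realType} {n : nat}.
Local Notation S := (@unit_sphere R n.+1).
Local Notation V := 'rV[R]_n.+1.
Local Notation e_ := (@unit_vec R n.+1).
Local Notation m := (n.+1).
Implicit Types (x y : V) (u h : V -> R).

Definition poisson_kernel x y : R := (1 - enorm x ^+ 2) / enorm (y - x) ^+ m.

(** The first and second x-derivatives of (1 - |x|^2) N^m with N = 1 / |y - x|, expanded by the rule
    d_i N^k = k (y_i - x_i) N^(k+2). *)
Definition poisson_kernel1 (i : 'I_m) x y : R :=
  - (2 * x 0 i) * inv_dist x y ^+ m
  + (1 - enorm x ^+ 2) * (m%:R * (y 0 i - x 0 i) * inv_dist x y ^+ m.+2).

Definition poisson_kernel2 (i j : 'I_m) x y : R :=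
  - (2 * (i == j)%:R) * inv_dist x y ^+ m
  - 2 * x 0 i * (m%:R * (y 0 j - x 0 j) * inv_dist x y ^+ m.+2)
  - 2 * x 0 j * (m%:R * (y 0 i - x 0 i) * inv_dist x y ^+ m.+2)
  + (1 - enorm x ^+ 2) * m%:R *
    (- (i == j)%:R * inv_dist x y ^+ m.+2 +
     (y 0 i - x 0 i) * (m.+2%:R * (y 0 j - x 0 j) * inv_dist x y ^+ m.+4)).

Definition poisson_int u x : R := savg (fun y => poisson_kernel x y * u y).

Lemma poisson_kernelE x y : poisson_kernel x y = (1 - enorm x ^+ 2) * inv_dist x y ^+ m.
Proof. by rewrite /poisson_kernel /inv_dist exprVn. Qed.

Lemma kernel_exp (F : V -> V -> R) k : sphere_kernel F ->
  sphere_kernel (fun x y => F x y ^+ k).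
Proof.
move=> kF; elim: k => [|k IH]; first exact: kernel_cst.
rewrite [X in sphere_kernel X](_ : _ = fun x y => F x y * F x y ^+ k).
  exact: kernel_mul.
by apply/funext => x; apply/funext => y; rewrite exprS.
Qed.

Lemma kernel_opp (F : V -> V -> R) : sphere_kernel F ->
  sphere_kernel (fun x y => - F x y).
Proof.
move=> kF; rewrite [X in sphere_kernel X](_ : _ = fun x y => -1 * F x y).
  exact: kernel_mul (kernel_cst _) kF.
by apply/funext => x; apply/funext => y; rewrite mulN1r.
Qed.

Lemma kernel_sub (F G : V -> V -> R) : sphere_kernel F -> sphere_kernel G ->
  sphere_kernel (fun x y => F x y - G x y).
Proof. by move=> kF kG; apply: kernel_add kF (kernel_opp kG). Qed.

Lemma kernel_sum (I : Type) (r : seq I) (F : I -> V -> V -> R) :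
  (forall i, sphere_kernel (F i)) -> sphere_kernel (fun x y => \sum_(i <- r) F i x y).
Proof.
move=> kF; elim: r => [|i r IH].
  rewrite [X in sphere_kernel X](_ : _ = fun x y => 0); first exact: kernel_cst.
  by apply/funext => x; apply/funext => y; rewrite big_nil.
rewrite [X in sphere_kernel X](_ : _ = fun x y => F i x y + \sum_(i <- r) F i x y).
  exact: kernel_add.
by apply/funext => x; apply/funext => y; rewrite big_cons.
Qed.

Lemma kernel_one_sub_sqr : sphere_kernel (fun x _ : V => 1 - enorm x ^+ 2).
Proof.
apply: kernel_sub; first exact: kernel_cst.
rewrite [X in sphere_kernel X](_ : _ = fun x y => \sum_i x 0 i * x 0 i).
  by apply: kernel_sum => i; exact: kernel_mul (kernel_fst _) (kernel_fst _).
by apply/funext => x; apply/funext => y; rewrite sqr_enorm.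
Qed.

Lemma kernel_coord_sub i : sphere_kernel (fun x y : V => y 0 i - x 0 i).
Proof.
apply: kernel_sub (kernel_fst i); apply: kernel_snd; exact: within_continuous_coord.
Qed.

Lemma kernel_poisson : sphere_kernel poisson_kernel.
Proof.
rewrite (_ : poisson_kernel = fun x y => (1 - enorm x ^+ 2) * inv_dist x y ^+ m).
  exact: kernel_mul kernel_one_sub_sqr (kernel_exp _ kernel_inv_dist).
by apply/funext => x; apply/funext => y; exact: poisson_kernelE.
Qed.

Let kd i k : sphere_kernel (fun x y : V => m%:R * (y 0 i - x 0 i) * inv_dist x y ^+ k).
Proof.
apply: kernel_mul (kernel_exp _ kernel_inv_dist).
exact: kernel_mul (kernel_cst _) (kernel_coord_sub i).
Qed.

Lemma kernel_poisson1 i : sphere_kernel (poisson_kernel1 i).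
Proof.
apply: kernel_add; last exact: kernel_mul kernel_one_sub_sqr (kd _ _).
apply: kernel_mul (kernel_exp _ kernel_inv_dist); apply: kernel_opp.
exact: kernel_mul (kernel_cst _) (kernel_fst _).
Qed.

Lemma kernel_poisson2 i j : sphere_kernel (poisson_kernel2 i j).
Proof.
have k2 l : sphere_kernel (fun x _ : V => 2 * x 0 l).
  exact: kernel_mul (kernel_cst _) (kernel_fst _).
apply: kernel_add.
  apply: kernel_sub; last exact: kernel_mul (k2 j) (kd i _).
  apply: kernel_sub; last exact: kernel_mul (k2 i) (kd j _).
  exact: kernel_mul (kernel_cst _) (kernel_exp _ kernel_inv_dist).
apply: kernel_mul; first exact: kernel_mul kernel_one_sub_sqr (kernel_cst _).
apply: kernel_add; first exact: kernel_mul (kernel_cst _) (kernel_exp _ kernel_inv_dist).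
apply: kernel_mul (kernel_coord_sub i) _.
apply: kernel_mul (kernel_exp _ kernel_inv_dist).
exact: kernel_mul (kernel_cst _) (kernel_coord_sub j).
Qed.

Lemma is_derive_inv_dist_exp i x y k : 0 < enorm (y - x) ->
  is_derive x (e_ i) (fun z => inv_dist z y ^+ k)
    (k%:R * (y 0 i - x 0 i) * inv_dist x y ^+ k.+2).
Proof.
move=> xy; elim: k => [|k IH].
  by rewrite !mul0r; exact: is_derive_cst.
under eq_fun do rewrite exprS.
apply: is_derive_eq (is_derive_prod (is_derive_inv_dist i xy) IH) _.
by rewrite -natr1 !exprS; ring.
Qed.

Let dq i x : is_derive x (e_ i) (fun z : V => 1 - enorm z ^+ 2) (- (2 * x 0 i)).
Proof.
have D := is_derive_sub (is_derive_cst (1 : R) x (e_ i)) (is_derive_sqr_enorm i x).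
apply: (is_derive_eq D).
by rewrite sub0r.
Qed.

Let dd i j x y : is_derive x (e_ j) (fun z : V => y 0 i - z 0 i) (- (i == j)%:R).
Proof.
have D := is_derive_sub (is_derive_cst (y 0 i) x (e_ j)) (is_derive_coord j i x).
apply: (is_derive_eq D).
by rewrite sub0r eq_sym.
Qed.

Lemma is_derive_poisson_kernel i x y : 0 < enorm (y - x) ->
  is_derive x (e_ i) (poisson_kernel ^~ y) (poisson_kernel1 i x y).
Proof.
move=> xy; under eq_fun do rewrite poisson_kernelE.
exact: is_derive_prod (dq i x) (is_derive_inv_dist_exp i _ xy).
Qed.

Lemma is_derive_poisson_kernel1 i j x y : 0 < enorm (y - x) ->
  is_derive x (e_ j) (poisson_kernel1 i ^~ y) (poisson_kernel2 i j x y).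
Proof.
move=> xy; have d2 : is_derive x (e_ j) (fun z : V => - (2 * z 0 i)) (- (2 * (i == j)%:R)).
  under eq_fun do rewrite -mulNr; rewrite -mulNr eq_sym.
  exact: is_deriveMl (is_derive_coord j i x).
have dN k := is_derive_inv_dist_exp j k xy.
have d3 := is_deriveMl m%:R (dd i j x y).
have D := is_derive_add (is_derive_prod d2 (dN m))
  (is_derive_prod (dq j x) (is_derive_prod d3 (dN m.+2))).
apply: (is_derive_eq D).
by rewrite /poisson_kernel2; ring.
Qed.

Section Integral.
Variable u : V -> R.
Hypothesis cu : {within S, continuous u}.

Let ku : sphere_kernel (fun _ y => u y) := kernel_snd cu.

Lemma Ck_poisson_int k : Ck k unit_ball (poisson_int u).
Proof. exact: Ck_savg (kernel_mul kernel_poisson ku). Qed.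

Let d1 i x : unit_ball x -> is_derive x (e_ i) (poisson_int u)
  (savg (fun y => poisson_kernel1 i x y * u y)).
Proof.
apply: (is_derive_savg (F := fun x y => poisson_kernel x y * u y)
  (G := fun i x y => poisson_kernel1 i x y * u y)).
- exact: kernel_mul kernel_poisson ku.
- exact: kernel_mul (kernel_poisson1 i) ku.
move=> z y z1 Sy; under eq_fun do rewrite mulrC; rewrite mulrC.
exact/is_deriveMl/is_derive_poisson_kernel/dist_sphere_gt0.
Qed.

Lemma poisson_int_partial2 i j x : unit_ball x ->
  partial j (partial i (poisson_int u)) x = savg (fun y => poisson_kernel2 i j x y * u y).
Proof.
move=> x1; have E : {in unit_ball, partial i (poisson_int u) =1
    fun x => savg (fun y => poisson_kernel1 i x y * u y)}.
  by move=> z; rewrite inE => z1; exact: partialE (d1 i z1).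
rewrite (partial_ext j (@open_eball R m 1) x1 E); apply: partialE.
apply: (is_derive_savg (F := fun x y => poisson_kernel1 i x y * u y)
  (G := fun j x y => poisson_kernel2 i j x y * u y)) x1.
- exact: kernel_mul (kernel_poisson1 i) ku.
- exact: kernel_mul (kernel_poisson2 i j) ku.
move=> z y z1 Sy; under eq_fun do rewrite mulrC; rewrite mulrC.
exact/is_deriveMl/is_derive_poisson_kernel1/dist_sphere_gt0.
Qed.

End Integral.

Lemma savg_sum (I : Type) (r : seq I) (F : I -> V -> R) :
  (forall i, {within S, continuous (F i)}) ->
  savg (fun y => \sum_(i <- r) F i y) = \sum_(i <- r) savg (F i).
Proof.
move=> cF; elim: r => [|i r IH].
  by under eq_fun do rewrite big_nil; rewrite savg_cst big_nil.
under eq_fun do rewrite big_cons; rewrite big_cons -IH savgD//.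
elim: r {IH} => [|j r IH].
  by under eq_fun do rewrite big_nil; exact: within_continuous_cst.
by under eq_fun do rewrite big_cons; exact: within_continuousD.
Qed.

Lemma poisson_kernel_harmonic x y : unit_ball x -> S y ->
  \sum_i poisson_kernel2 i i x y = 0.
Proof.
move=> x1 y1; have xy := dist_sphere_gt0 x1 y1.
set N := inv_dist x y.
have N2 k : enorm (y - x) ^+ 2 * N ^+ k.+2 = N ^+ k.
  by rewrite /N /inv_dist !exprS; field; rewrite gt_eqF.
pose q := 1 - enorm x ^+ 2.
(* By |y - x|^2 N^(k+2) = N^k the sum becomes m N^(m+2) times - 2 |y - x|^2 + 2 (1 - |x|^2) - 4 x.(y
   - x), which is 0 when |y| = 1. *)
have -> : \sum_i poisson_kernel2 i i x y =
   \sum_i (- 2 * N ^+ m - q * m%:R * N ^+ m.+2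
     - 4 * m%:R * N ^+ m.+2 * (x 0 i * (y - x) 0 i)
     + q * m%:R * m.+2%:R * N ^+ m.+4 * ((y - x) 0 i * (y - x) 0 i)).
  apply: eq_bigr => i _; rewrite /poisson_kernel2 eqxx (_ : true%:R = 1 :> R)// !mxE -/N -/q.
  by move: m%:R m.+2%:R (N ^+ m) (N ^+ m.+2) (N ^+ m.+4) => *; ring.
rewrite big_split/= big_split/= sumrN -!mulr_sumr sumr_const card_ord.
rewrite -/(dot x (y - x)) -/(dot (y - x) (y - x)) -sqr_enorm.
rewrite -[_ *+ m]mulr_natr -(mulrA _ (N ^+ m.+4)) (mulrC (N ^+ m.+4)) (N2 m.+2) -(N2 m).
have y2 : dot y y = 1 by rewrite -sqr_enorm y1 expr1n.
have -> : m.+2%:R = m%:R + 2 :> R by rewrite -addn2 natrD.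
rewrite /q !sqr_enorm !(dotDl, dotDr, dotNl, dotNr) y2 (dotC y x).
by ring.
Qed.

Lemma laplacian_poisson_int u x : {within S, continuous u} -> unit_ball x ->
  laplacian (poisson_int u) x = 0.
Proof.
move=> cu x1; rewrite /laplacian.
under eq_bigr => i _ do rewrite (poisson_int_partial2 cu i i x1).
rewrite -savg_sum => [|i]; last first.
  exact: (kernel_continuous (kernel_mul (kernel_poisson2 i i) (kernel_snd cu))).
rewrite (@eq_savg _ _ _ (fun=> 0)) ?savg_cst// => y Sy.
by rewrite -mulr_suml poisson_kernel_harmonic ?mul0r.
Qed.

Lemma poisson_kernel_ge0 x y : unit_ball x -> 0 <= poisson_kernel x y.
Proof.
move=> x1; rewrite divr_ge0 ?exprn_ge0// subr_ge0 expr_le1//; exact: ltW.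
Qed.

Lemma continuous_poisson_kernel x : unit_ball x -> {within S, continuous (poisson_kernel x)}.
Proof. exact: kernel_continuous kernel_poisson. Qed.

Lemma continuous_poisson_kernel2 i j x : unit_ball x ->
  {within S, continuous (poisson_kernel2 i j x)}.
Proof. exact: kernel_continuous (kernel_poisson2 i j). Qed.

Lemma savg_poisson_kernel_reflection x x' : unit_ball x -> enorm x = enorm x' ->
  savg (poisson_kernel x') = savg (poisson_kernel x).
Proof.
move=> x1 xx'; have [->//|nxx'] := eqVneq x x'.
have x'1 : unit_ball x' by rewrite /unit_ball/= -xx'.
have w0 : 0 < dot (x - x') (x - x').
  rewrite -sqr_enorm exprn_gt0// lt_def enorm_ge0 andbT.
  by apply: contra nxx' => /eqP/enorm0_eq0/eqP; rewrite subr_eq0.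
pose T := reflection (x - x').
have TK z : T (T z) = z by exact: reflectionK.
have nT z : enorm (T z) = enorm z by exact: enorm_reflection.
have isoT z z' : enorm (T z - T z') = enorm (z - z') by rewrite -reflectionB nT.
have TS y : S y -> S (T y) by rewrite /unit_sphere/= nT.
have Tx : T x = x' by exact: reflection_swap.
rewrite -(savg_isometry TK isoT TS (continuous_poisson_kernel x'1)).
by apply: eq_savg => y Sy /=; rewrite /poisson_kernel -Tx isoT nT.
Qed.

(* The average is harmonic in x and, by the reflections, constant on spheres around
   0, hence constant. *)
Lemma savg_poisson_kernel x : unit_ball x -> savg (poisson_kernel x) = 1.
Proof.
move=> x1; have c1 : {within S, continuous (fun=> 1 : R)} by exact: within_continuous_cst.
have E z : savg (poisson_kernel z) = poisson_int (fun=> 1) z.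
  by apply: eq_savg => y _; rewrite mulr1.
have P0 : poisson_int (fun=> 1) (0 : V) = 1.
  rewrite /poisson_int (@eq_savg _ _ _ (fun=> 1)) ?savg_cst// => y y1.
  by rewrite /poisson_kernel enorm0 subr0 y1 expr1n expr0n subr0 divr1 mulr1.
have [->|xn0] := eqVneq x 0; first by rewrite E.
have r0 : 0 < enorm x.
  by rewrite lt_def enorm_ge0 andbT; apply: contra xn0 => /eqP/enorm0_eq0 ->.
have sub : eball (enorm x) `<=` (unit_ball : set V).
  by move=> z; rewrite /eball /unit_ball/= => /lt_trans; apply.
have C2 : Ck 2 (eball (enorm x)) (poisson_int (fun=> 1)).
  exact: Ck_sub sub (Ck_poisson_int c1 2).
have K2 : Ck 2 (eball (enorm x) : set V) (fun=> savg (poisson_kernel x)).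
  exact: (@Ck_cst R m 2 _ (savg (poisson_kernel x)) (@open_eball R m (enorm x))).
have cP : {within [set z | enorm z <= enorm x], continuous (poisson_int (fun=> 1))}.
  apply/subspace_continuousP => z /= zx; apply: cvg_within_filter.
  by apply: (Ck_continuous (Ck_poisson_int c1 0)); rewrite /unit_ball/=; exact: le_lt_trans x1.
have lK (z : V) : enorm z < enorm x -> laplacian (fun=> savg (poisson_kernel x)) z = 0.
  move=> _; apply: big1 => i _.
  have -> : partial i (fun=> savg (poisson_kernel x)) = (fun=> 0 : R).
    by apply/funext => t; apply: partialE; exact: is_derive_cst.
  by apply: partialE; exact: is_derive_cst.
have lP (z : V) : enorm z < enorm x -> laplacian (poisson_int (fun=> 1)) z = 0.
  by move=> zx; apply: laplacian_poisson_int => //; exact: sub.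
have b (z : V) : enorm z = enorm x -> poisson_int (fun=> 1) z = savg (poisson_kernel x).
  by move=> zx; rewrite -E; apply: savg_poisson_kernel_reflection.
have := harmonic_unique (ltn0Sn n) r0 C2 K2 cP (@within_continuous_cst R m _ _) lP lK b.
by move=> /(_ 0); rewrite enorm0 P0 => <-//; exact: ltW.
Qed.

End PoissonKernel.

(** * Boundary behaviour of the Poisson integral *)

Section PoissonBoundary.
Context {R : realType} {n : nat}.
Local Notation S := (@unit_sphere R n.+1).
Local Notation V := 'rV[R]_n.+1.
Local Notation m := (n.+1).
Implicit Types (x y p : V) (u h f : V -> R).

Definition glue (F u : V -> R) x := if enorm x < 1 then F x else u x.

Lemma glue_ball F u x : unit_ball x -> glue F u x = F x.
Proof. by rewrite /unit_ball/= /glue => ->. Qed.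

Lemma glue_sphere F u y : S y -> glue F u y = u y.
Proof. by rewrite /unit_sphere/= /glue => ->; rewrite ltxx. Qed.

Lemma continuous_glue F u :
  (forall x, unit_ball x -> {for x, continuous F}) -> {within S, continuous u} ->
  (forall p e, S p -> 0 < e -> exists2 d, 0 < d & forall x, unit_ball x ->
     enorm (x - p) < d -> `|F x - u p| <= e) ->
  {within [set x | enorm x <= 1], continuous (glue F u)}.
Proof.
move=> cF /continuous_within_enormP cu bF; apply/continuous_within_enormP.
move=> x e /=; rewrite le_eqVlt => /orP[/eqP x1|x1] e0.
  have e2 : 0 < e / 2 by rewrite divr_gt0.
  have [d d0 dP] := bF x _ x1 e2; have [d' d'0 d'P] := cu x e x1 e0.
  exists (Num.min d d'); first by rewrite lt_min d0.
  move=> y; rewrite le_eqVlt lt_min => /orP[/eqP y1|y1] /andP[yd yd'].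
    by rewrite !glue_sphere// d'P.
  rewrite glue_ball// glue_sphere// (le_lt_trans (dP _ y1 yd))//; lra.
have /continuous_enormP/(_ e e0)[d d0 dP] := cF x x1.
have /nbhs_enormP[d' d'0 d'P] := eball_nbhs x1.
exists (Num.min d d'); first by rewrite lt_min d0.
move=> y _; rewrite lt_min => /andP[yd /d'P y1].
by rewrite !glue_ball// dP.
Qed.

Let far_kernel (k : nat) p x y (d : R) : 0 < d -> enorm (x - p) < d / 2 ->
  d <= enorm (y - p) -> inv_dist x y ^+ k <= (2 / d) ^+ k.
Proof.
move=> d0 xp yp; have xy : d / 2 <= enorm (y - x).
  by have := enorm_triangle x y p; lra.
have d2 : 0 < d / 2 by rewrite divr_gt0.
have xy0 : 0 < enorm (y - x) by exact: lt_le_trans xy.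
by rewrite lerXn2r// ?nnegrE ?invr_ge0 ?divr_ge0 ?(ltW d0)// -invf_div lef_pV2 ?posrE.
Qed.

Let one_sub_sqr_le p x : S p -> unit_ball x -> 1 - enorm x ^+ 2 <= 2 * enorm (x - p).
Proof.
rewrite /unit_sphere /unit_ball/= => p1 x1.
have xp : 1 - enorm x <= enorm (x - p).
  by have := enorm_triangle x p 0; rewrite !subr0 p1 (enorm_distC p); lra.
have -> : 1 - enorm x ^+ 2 = (1 - enorm x) * (1 + enorm x) by ring.
by rewrite mulrC ler_pM//; have := enorm_ge0 x; lra.
Qed.

(** The kernel is nonnegative with average 1, so near p only the oscillation of u counts, while away
    from p the kernel is O(1 - |x|^2). *)
Lemma poisson_int_boundary u p e : {within S, continuous u} -> S p -> 0 < e ->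
  exists2 d, 0 < d & forall x, unit_ball x -> enorm (x - p) < d ->
    `|poisson_int u x - u p| <= e.
Proof.
move=> cu Sp e0; have e2 : 0 < e / 2 by rewrite divr_gt0.
have [d d0 dP] := iffLR (continuous_within_enormP _ _) cu p _ Sp e2.
have [M M0 uM] := within_continuous_bounded (@compact_unit_sphere R n) cu.
pose C := (2 / d) ^+ m * (2 * M).
have C0 : 0 <= C by rewrite mulr_ge0 ?exprn_ge0 ?mulr_ge0 ?invr_ge0 ?(ltW d0).
have C1 : 0 < 2 * C + 1 by lra.
(* Since 1 - |x|^2 <= 2 |x - p|, the second radius makes the far part (1 - |x|^2) C at most e /
   2. *)
exists (Num.min (d / 2) (e / 2 / (2 * C + 1))); first by rewrite lt_min !divr_gt0.
move=> x x1; rewrite lt_min => /andP[xd xe].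
have cK := continuous_poisson_kernel x1.
have cc (c : R) : {within S, continuous (fun=> c)} by exact: within_continuous_cst.
have -> : poisson_int u x - u p = savg (fun y => poisson_kernel x y * (u y - u p)).
  rewrite -[in LHS](mulr1 (u p)) -(savg_poisson_kernel x1) -savgZ// -savgB.
  - by apply: eq_savg => y _; ring.
  - exact: within_continuousM.
  - exact: within_continuousZ.
pose k y := (e / 2) * poisson_kernel x y + (1 - enorm x ^+ 2) * C.
have q0 : 0 <= 1 - enorm x ^+ 2 by rewrite subr_ge0 expr_le1//; exact: ltW.
apply: le_trans (norm_savg_le (k := k) _ _ _) _.
- by apply: within_continuousM => //; exact: within_continuousB.
- by apply: within_continuousD => //; exact: within_continuousZ.
- move=> y Sy; have K0 := poisson_kernel_ge0 y x1.
  rewrite normrM (ger0_norm K0) /k.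
  have [yd|yd] := ltP (enorm (y - p)) d.
    apply: (@le_trans _ _ (e / 2 * poisson_kernel x y)).
      by rewrite mulrC ler_wpM2r// ltW// dP.
    by rewrite lerDl mulr_ge0.
  apply: (@le_trans _ _ ((1 - enorm x ^+ 2) * C)); last by rewrite lerDr mulr_ge0// ltW.
  rewrite poisson_kernelE -mulrA ler_wpM2l// ler_pM//.
  - by rewrite exprn_ge0// invr_ge0.
  - exact: (far_kernel m d0 xd yd).
  - rewrite (le_trans (ler_normB _ _))// mulr_natl mulr2n lerD ?uM//.
- rewrite /k savgD//; last exact: within_continuousZ.
  rewrite savgZ// savg_poisson_kernel// savg_cst mulr1.
  have q := one_sub_sqr_le Sp x1.
  rewrite ltr_pdivlMr// in xe.
  have : (1 - enorm x ^+ 2) * C <= 2 * enorm (x - p) * C by rewrite ler_wpM2r.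
  have : 0 <= enorm (x - p) by [].
  by move: (enorm (x - p)) (enorm x) C xe {q C1 C0 q0 k} => a b c; nra.
Qed.

Lemma poisson_int_harmonic f : Ck 2 unit_ball f ->
  {within [set x | enorm x <= 1], continuous f} ->
  (forall x, unit_ball x -> laplacian f x = 0) ->
  forall x, unit_ball x -> poisson_int f x = f x.
Proof.
move=> Cf cf lf.
have cu : {within S, continuous f}.
  by apply: continuous_subspaceW cf => y /= ->.
have oB : open (unit_ball : set V) by exact: (@open_eball R m 1).
have E : {in unit_ball, poisson_int f =1 glue (poisson_int f) f}.
  by move=> x; rewrite inE => x1; rewrite glue_ball.
have Cg : Ck 2 unit_ball (glue (poisson_int f) f) := Ck_ext oB E (Ck_poisson_int cu 2).
have cg : {within [set x | enorm x <= 1], continuous (glue (poisson_int f) f)}.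
  apply: continuous_glue => //.
    by move=> x x1; exact: Ck_continuous (Ck_poisson_int cu 0) x1.
  by move=> p e Sp e0; exact: poisson_int_boundary.
have lg x : enorm x < 1 -> laplacian (glue (poisson_int f) f) x = 0.
  move=> x1; rewrite -(laplacian_poisson_int cu x1); apply: eq_bigr => i _.
  have E1 : {in unit_ball, partial i (glue (poisson_int f) f) =1 partial i (poisson_int f)}.
    move=> z; rewrite inE => z1; apply: (partial_ext i oB z1) => t tB.
    by rewrite -E.
  exact: (partial_ext i oB x1 E1).
have b x : enorm x = 1 -> glue (poisson_int f) f x = f x by move=> x1; rewrite glue_sphere.
move=> x x1; rewrite (E x) ?inE//.
exact: (harmonic_unique (ltn0Sn n) ltr01 Cg Cf cg cf lg lf b (ltW x1)).
Qed.

Definition kernel2_bound : R := 4 + 6 * m%:R + 2 * (m%:R * m.+2%:R).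

(** Each term is compared with N^(m+1): |y - x| <= 2 gives N^m <= 2 N^(m+1), coordinates of y - x
    satisfy |y_i - x_i| N <= 1, and 1 - |x| <= |y - x| gives (1 - |x|^2) N <= 2. The five terms
    contribute 4, three times 2m, and 2m (m + 2). *)
Lemma poisson_kernel2_le i j x y : unit_ball x -> S y ->
  `|poisson_kernel2 i j x y| <= kernel2_bound * inv_dist x y ^+ m.+1.
Proof.
move=> x1 Sy; have xy := dist_sphere_gt0 x1 Sy.
set N := inv_dist x y.
have N0 : 0 < N by rewrite invr_gt0.
have N1 : 1 <= 2 * N.
  rewrite -ler_pdivrMr// div1r invrK (le_trans (enormB _ _))//.
  by move: x1 Sy; rewrite /unit_ball /unit_sphere/= => x1 ->; lra.
have xi l : `|x 0 l| <= 1.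
  by rewrite (le_trans (le_coord_enorm _ _))// ltW.
have dN l : `|y 0 l - x 0 l| * N <= 1.
  rewrite ler_pdivrMr// mul1r.
  by have := le_coord_enorm (y - x) l; rewrite !mxE.
have q0 : 0 <= 1 - enorm x ^+ 2 by rewrite subr_ge0 expr_le1//; exact: ltW.
have qN : (1 - enorm x ^+ 2) * N <= 2.
  rewrite ler_pdivrMr//.
  have xyn : 1 - enorm x <= enorm (y - x).
    have := enorm_triangle x y 0; rewrite !subr0.
    by move: Sy; rewrite /unit_sphere/= => ->; lra.
  have -> : 1 - enorm x ^+ 2 = (1 + enorm x) * (1 - enorm x) by ring.
  rewrite ler_pM ?subr_ge0 ?(ltW x1)//.
    by have := enorm_ge0 x; lra.
  by move: x1; rewrite /unit_ball/=; lra.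
have dl : `|(i == j)%:R : R| <= 1 by case: (i == j); rewrite ?normr0 ?normr1.
have [A EA] : {A : R | A = N ^+ m.+1} by exists (N ^+ m.+1).
have A0 : 0 <= A by rewrite EA exprn_ge0// ltW.
have Nm : N ^+ m <= 2 * A.
  have -> : 2 * A = (2 * N) * N ^+ m by rewrite EA exprS mulrA.
  by rewrite ler_peMl// exprn_ge0// ltW.
pose dj := (y 0 j - x 0 j) * N; pose di := (y 0 i - x 0 i) * N.
have djN : `|dj| <= 1 by rewrite normrM (gtr0_norm N0).
have diN : `|di| <= 1 by rewrite normrM (gtr0_norm N0).
pose q := (1 - enorm x ^+ 2) * N.
have qn : `|q| <= 2 by rewrite ger0_norm// mulr_ge0// ltW.
have -> : poisson_kernel2 i j x y = - 2 * (i == j)%:R * N ^+ m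
   - 2 * x 0 i * m%:R * dj * A - 2 * x 0 j * m%:R * di * A
   - q * m%:R * (i == j)%:R * A + q * m%:R * m.+2%:R * di * dj * A.
  rewrite /poisson_kernel2 /q /dj /di EA !exprS -/N.
  by move: m%:R m.+2%:R (N ^+ n) => *; ring.
rewrite -EA; apply: (@le_trans _ _ (4 * A + 2 * m%:R * A + 2 * m%:R * A +
  2 * m%:R * A + 2 * (m%:R * m.+2%:R) * A)); last first.
  by rewrite le_eqVlt; apply/orP; left; apply/eqP; rewrite /kernel2_bound; ring.
have nM (a b al be : R) : `|a| <= al -> `|b| <= be -> `|a * b| <= al * be.
  by move=> ha hb; rewrite normrM ler_pM.
have nn k : `|k%:R : R| <= k%:R by rewrite normr_nat.
have nA : `|A| <= A by rewrite ger0_norm.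
have nN : `|N ^+ m| <= 2 * A by rewrite ger0_norm// exprn_ge0// ltW.
have t1 := nM _ _ _ _ (nM _ _ _ _ (nM _ _ _ _ (nM _ _ _ _ (nM _ _ _ _ qn (nn m)) (nn m.+2)) diN) djN) nA.
have t2 := nM _ _ _ _ (nM _ _ _ _ (nM _ _ _ _ qn (nn m)) dl) nA.
have t3 a b (a1 : `|a| <= 1) (b1 : `|b| <= 1) :=
  nM _ _ _ _ (nM _ _ _ _ (nM _ _ _ _ (nM _ _ _ _ (nn 2) a1) (nn m)) b1) nA.
have n2 : `|- 2 : R| <= 2 by rewrite normrN.
have t4 := nM _ _ _ _ (nM _ _ _ _ n2 dl) nN.
apply: le_trans (ler_normD _ _) _; apply: lerD; last by move: t1; rewrite !mulr1 !mulrA.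
apply: le_trans (ler_normB _ _) _; apply: lerD; last by move: t2; rewrite !mulr1.
apply: le_trans (ler_normB _ _) _; apply: lerD; last first.
  by move: (t3 _ _ (xi j) diN); rewrite !mulr1.
apply: le_trans (ler_normB _ _) _; apply: lerD; last first.
  by move: (t3 _ _ (xi i) djN); rewrite !mulr1.
by move: t4; rewrite mulr1 mulrA (_ : 2 * 2 = 4 :> R)//; ring.
Qed.

Lemma poisson_int_partial2_le i j x u M : {within S, continuous u} -> unit_ball x ->
    (forall y, S y -> `|u y| <= M) ->
  `|partial j (partial i (poisson_int u)) x| <=
    kernel2_bound * (1 - enorm x)^-1 ^+ m.+1 * M.
Proof.
move=> cu x1 uM; rewrite poisson_int_partial2//.
have B0 : 0 <= kernel2_bound by rewrite !addr_ge0// mulr_ge0// mulr_ge0.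
set C := _ * M; rewrite -(@savg_cst R n C); apply: norm_savg_le.
- by apply: within_continuousM => //; exact: continuous_poisson_kernel2.
- exact: within_continuous_cst.
move=> y Sy; rewrite normrM ler_pM ?uM//.
rewrite (le_trans (poisson_kernel2_le i j x1 Sy))// ler_wpM2l//.
have x0 : 0 < 1 - enorm x by rewrite subr_gt0.
have xy := dist_sphere_gt0 x1 Sy.
rewrite lerXn2r ?nnegrE ?invr_ge0 ?(ltW x0)// lef_pV2 ?posrE//.
have := enorm_triangle x y 0; rewrite !subr0.
by move: Sy; rewrite /unit_sphere/= => ->; lra.
Qed.

(** An affine function is harmonic, hence equal to its Poisson integral on the ball, and its second
    derivatives vanish. *)
Lemma poisson_int_affine (a : R) (c : 'I_m -> R) (x0 : V) i j x : unit_ball x ->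
  savg (fun y => poisson_kernel2 i j x y * (a + \sum_k c k * (y - x0) 0 k)) = 0.
Proof.
move=> x1; pose f y := a + \sum_k c k * (y - x0) 0 k.
have oB : open (unit_ball : set V) by exact: (@open_eball R m 1).
have df l z : is_derive z (unit_vec l) f (c l).
  pose G k (t : V) := c k * (t - x0) 0 k.
  have dG k : is_derive z (unit_vec l) (G k) (c k * (l == k)%:R).
    apply: is_deriveMl.
    have D := is_derive_sub (is_derive_coord l k z) (is_derive_cst (x0 0 k) z (unit_vec l)).
    rewrite subr0 in D; rewrite (_ : (fun t : V => (t - x0) 0 k) = fun t => t 0 k - x0 0 k)//.
    by apply/funext => t; rewrite !mxE.
  have D := is_derive_add (is_derive_cst a z (unit_vec l)) (is_derive_sum dG).
  have E : (fun t => cst a t + (\sum_k G k) t) = f.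
    by apply/funext => t; rewrite fct_sumE.
  rewrite E in D; apply: (is_derive_eq D).
  rewrite add0r (bigD1 l)//= eqxx mulr1 big1 ?addr0// => k kl.
  by rewrite eq_sym (negbTE kl) mulr0.
have CfU (U : set V) : open U -> Ck 2 U f.
  move=> oU; apply: (CkD oU (Ck_cst 2 a oU)).
  apply: (@Ck_sum R m 2 U 'I_m (index_enum _) xpredT (fun k y => c k * (y - x0) 0 k)) => // k _.
  apply: (CkZ (c k) oU); rewrite (_ : (fun y : V => _) = fun y => y 0 k + (- x0 0 k)).
    exact: (CkD oU (Ck_coord 2 k oU) (Ck_cst 2 _ oU)).
  by apply/funext => y; rewrite !mxE.
have cf z : {for z, continuous f} by exact: (Ck_continuous (CfU _ openT)).
have Cf := CfU _ oB.
have pf l : partial l f = fun=> c l by apply/funext => z; exact: partialE.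
have p2 k l z : partial l (partial k f) z = 0.
  by rewrite pf; apply: partialE; exact: is_derive_cst.
have cS : {within S, continuous f} by apply: continuous_subspaceT => z; exact: cf.
rewrite -(poisson_int_partial2 cS i j x1) -[RHS](p2 i j x).
have lf z : unit_ball z -> laplacian f z = 0 by move=> _; apply: big1 => l _; exact: p2.
have E1 : {in unit_ball, poisson_int f =1 f}.
  move=> z; rewrite inE; apply: poisson_int_harmonic => //.
  by apply: continuous_subspaceT => t; exact: cf.
apply: (partial_ext j oB x1) => z; rewrite inE => z1.
exact: (partial_ext i oB z1).
Qed.

(* Subtracting from h its first order Taylor polynomial at p, whose Poisson integral
   has no second derivatives, makes the data o(|y - p|). *)
Lemma poisson_int_partial2_decay (W : set V) h p i j e : open W -> Ck 1 W h -> W p ->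
    S p -> {within S, continuous h} -> 0 < e ->
  exists2 d, 0 < d & forall x, unit_ball x -> enorm (x - p) < d ->
    `|(1 - enorm x ^+ 2) * partial j (partial i (poisson_int h)) x| <= e.
Proof.
move=> oW Ch Wp Sp ch e0; set B := kernel2_bound.
have B0 : 0 < B by rewrite ltr_pwDl// ?mulr_ge0// ltr_pwDl// mulr_ge0.
(* With a B = e / 2, the bound B N^(m+1) times a |y - x| is (e / 2) N^m, so the part near p is at
   most e / 2 times the Poisson kernel. *)
pose a := e / 2 / B; have a0 : 0 < a by rewrite !divr_gt0.
have [d d0 dP] := strict_differentiability oW Ch Wp a0.
have [M M0 hM] := within_continuous_bounded (@compact_unit_sphere R n) ch.
have /continuous_enormP/(_ 1 ltr01)[d1 d10 d1P] := Ck_continuous Ch Wp.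
pose c k := partial k h p.
(* Bounds |h y - l y| on the whole sphere: |h x| <= |h p| + 1 for x close to p, and |y - x| <= 2. *)
pose Q := M + (`|h p| + 1) + \sum_k `|c k| * 2.
have Q0 : 0 <= Q by rewrite !addr_ge0// sumr_ge0// => k _; rewrite mulr_ge0.
pose C := B * (2 / d) ^+ m.+1 * Q.
have C0 : 0 <= C.
  by rewrite mulr_ge0// mulr_ge0 ?(ltW B0)// exprn_ge0// divr_ge0// ltW.
have C1 : 0 < 2 * C + 1 by lra.
exists (Num.min (Num.min d1 (d / 2)) (e / 2 / (2 * C + 1))).
  by rewrite !lt_min d10 !divr_gt0.
move=> x x1; rewrite !lt_min => /andP[/andP[xd1 xd] xe].
have cc (r : R) : {within S, continuous (fun=> r)} by exact: within_continuous_cst.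
(* The slope is that of h at p, but the graph passes through (x, h x). Strict differentiability at p
   then bounds h - l by a |y - x|, with the same distance that occurs in the kernel. *)
pose l y := h x + \sum_k c k * (y - x) 0 k.
have cl : {within S, continuous l}.
  apply: within_continuousD => //.
  rewrite /l; elim: (index_enum _) => [|k r IH].
    by under eq_fun do rewrite big_nil; exact: cc.
  under eq_fun do rewrite big_cons; apply: within_continuousD => //.
  apply: within_continuousZ; under eq_fun do rewrite !mxE.
  by apply: within_continuousB => //; exact: within_continuous_coord.
have c2 : {within S, continuous (poisson_kernel2 i j x)} by exact: continuous_poisson_kernel2.
have -> : partial j (partial i (poisson_int h)) x =
    savg (fun y => poisson_kernel2 i j x y * (h y - l y)).
  rewrite poisson_int_partial2// -[LHS]subr0 -(poisson_int_affine (h x) c x i j x1).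
  rewrite -savgB; [|exact: within_continuousM|exact: within_continuousM].
  by apply: eq_savg => y _; rewrite -mulrBr.
set q := 1 - enorm x ^+ 2.
have q0 : 0 <= q by rewrite subr_ge0 expr_le1//; exact: ltW.
have chl : {within S, continuous (fun y => poisson_kernel2 i j x y * (h y - l y))}.
  by apply: within_continuousM => //; exact: within_continuousB.
rewrite -savgZ//.
pose k y := e / 2 * poisson_kernel x y + q * C.
have cK := continuous_poisson_kernel x1.
apply: le_trans (norm_savg_le (k := k) _ _ _) _.
- exact: within_continuousZ.
- by apply: within_continuousD => //; exact: within_continuousZ.
- move=> y Sy; have K0 := poisson_kernel_ge0 y x1.
  have xy := dist_sphere_gt0 x1 Sy.
  have N0 : 0 <= inv_dist x y by rewrite invr_ge0.
  have k2 := poisson_kernel2_le i j x1 Sy.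
  rewrite normrM (ger0_norm q0) normrM /k poisson_kernelE -/q.
  have [yd|yd] := ltP (enorm (y - p)) d.
    have xd' : enorm (x - p) < d by lra.
    have hl : `|h y - l y| <= a * enorm (y - x).
      by rewrite /l opprD addrA; exact: dP.
    apply: (@le_trans _ _ (e / 2 * (q * inv_dist x y ^+ m))); last by rewrite lerDl mulr_ge0.
    apply: (@le_trans _ _ (q * ((B * inv_dist x y ^+ m.+1) * (a * enorm (y - x))))).
      by rewrite ler_wpM2l// ler_pM.
    rewrite le_eqVlt; apply/orP; left; apply/eqP.
    by rewrite /a exprS /inv_dist; field; rewrite !gt_eqF.
  apply: (@le_trans _ _ (q * C)); last first.
    by rewrite lerDr mulr_ge0 ?(ltW (divr_gt0 _ _))// mulr_ge0// exprn_ge0.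
  rewrite ler_wpM2l// /C ler_pM//.
    rewrite (le_trans k2)// ler_wpM2l ?(ltW B0)//; exact: (far_kernel m.+1 d0 xd yd).
  rewrite /l (le_trans (ler_normB _ _))// /Q -addrA lerD ?hM//.
  rewrite (le_trans (ler_normD _ _))// lerD//.
    have := d1P x xd1; have := ler_normD (h x - h p) (h p); rewrite subrK; lra.
  rewrite (le_trans (ler_norm_sum _ _ _))//; apply: ler_sum => t _.
  rewrite normrM ler_wpM2l// (le_trans (le_coord_enorm _ _))// (le_trans (enormB _ _))//.
  by move: Sy x1; rewrite /unit_sphere /unit_ball/= => ->; lra.
- rewrite /k savgD//; last exact: within_continuousZ.
  rewrite savgZ// savg_poisson_kernel// savg_cst mulr1.
  have qx := one_sub_sqr_le Sp x1.
  rewrite ltr_pdivlMr// in xe.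
  have : q * C <= 2 * enorm (x - p) * C by rewrite ler_wpM2r.
  have : 0 <= enorm (x - p) by [].
  by move: (enorm (x - p)) q C xe {qx C1 C0 q0 k chl} => b t c'; nra.
Qed.

End PoissonBoundary.

(** * Dirac calculus *)

#[local] Opaque psi_inv.

Section CliffordAlgebra.
Context {R : numFieldType} {m : nat}.
Local Notation Cl := (clifford R m).
Implicit Types (a b c : Cl) (i j : 'I_m).

Lemma clifford_scaleE (r : R) a A : (r *: a) A = r * a A.
Proof. by rewrite ffunE. Qed.

Lemma clifford0E A : (0 : Cl) A = 0.
Proof. by rewrite ffunE. Qed.

Lemma clifford_addE a b A : (a + b) A = a A + b A.
Proof. by rewrite ffunE. Qed.

Lemma clifford_sumE (I : Type) (s : seq I) (P : pred I) (F : I -> Cl) A :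
  (\sum_(i <- s | P i) F i) A = \sum_(i <- s | P i) F i A.
Proof. by rewrite sum_ffunE. Qed.

Lemma clifford_double_inj a b : a + a = b + b -> a = b.
Proof.
have half c : 2^-1 *: (c + c) = c.
  by rewrite scalerDr -scalerDl -[X in X + _]mul1r -[X in _ + X]mul1r -splitr scale1r.
by move=> ab; rewrite -(half a) ab half.
Qed.

Lemma gen_anticommutator i j :
  gen i * gen j + gen j * gen i = - ((i == j)%:R *: (1 + 1)) :> Cl.
Proof.
have [->|ij] := eqVneq i j; first by rewrite gen_sqr scale1r opprD.
by rewrite (gen_anticomm ij) addNr scale0r oppr0.
Qed.

(** The algebra behind D^2 = - Delta: in the doubled sum the terms (i, j) and (j, i) combine to
    anticommutators, which vanish off the diagonal. *)
Lemma sum_sym_gen_r (G : 'I_m -> 'I_m -> Cl) : (forall i j, G i j = G j i) ->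
  \sum_i \sum_j G i j * gen i * gen j = - \sum_i G i i.
Proof.
move=> symG; apply: clifford_double_inj; rewrite {1}exchange_big -big_split -opprD -big_split.
rewrite -sumrN; apply: eq_bigr => i _; rewrite -big_split/= (bigD1 i)//= big1 => [|j ji].
  by rewrite -!mulrA -mulrDr gen_anticommutator eqxx scale1r mulrN mulrDr mulr1 addr0.
rewrite (symG j i) -!mulrA -mulrDr gen_anticommutator (negbTE ji).
by rewrite scale0r oppr0 mulr0.
Qed.

Lemma sum_sym_gen_l (G : 'I_m -> 'I_m -> Cl) : (forall i j, G i j = G j i) ->
  \sum_i \sum_j gen i * (gen j * G i j) = - \sum_i G i i.
Proof.
move=> symG; apply: clifford_double_inj; rewrite {1}exchange_big -big_split -opprD -big_split.
rewrite -sumrN; apply: eq_bigr => i _; rewrite -big_split/= (bigD1 i)//= big1 => [|j ji].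
  by rewrite !mulrA -mulrDl gen_anticommutator eqxx scale1r mulNr mulrDl mul1r addr0.
rewrite (symG j i) !mulrA -mulrDl gen_anticommutator (negbTE ji).
by rewrite scale0r oppr0 mul0r.
Qed.

Lemma genC i j : gen i * gen j = - (gen j * gen i) - (i == j)%:R *: (1 + 1) :> Cl.
Proof. by rewrite -gen_anticommutator addrC addrK. Qed.

Lemma gen_psi i a : gen i * psi a = - psi (gen i * a) - (a * gen i + a * gen i).
Proof.
rewrite /psi mulr_sumr -sumrN.
have -> : a * gen i + a * gen i = \sum_j ((i == j)%:R *: (a * gen j + a * gen j)).
  rewrite (bigD1 i)//= eqxx scale1r big1 ?addr0// => j ji.
  by rewrite eq_sym (negbTE ji) scale0r.
rewrite -sumrB; apply: eq_bigr => j _.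
by rewrite !mulrA genC mulrBl mulNr mulrBl mulNr -!scalerAl !mulrDl !mul1r.
Qed.

Lemma psi_gen i a : psi a * gen i = - psi (a * gen i) - (gen i * a + gen i * a).
Proof.
rewrite /psi mulr_suml -sumrN.
have -> : gen i * a + gen i * a = \sum_j ((j == i)%:R *: (gen j * a + gen j * a)).
  rewrite (bigD1 i)//= eqxx scale1r big1 ?addr0// => j ji.
  by rewrite (negbTE ji) scale0r.
rewrite -sumrB; apply: eq_bigr => j _.
by rewrite -!mulrA genC mulrBr mulrN mulrBr mulrN -!scalerAr !mulrDr !mulr1.
Qed.

Lemma sandwich_lincomb a b (k1 k2 k3 k4 : R) (x y z w : Cl) :
  a * (k1 *: x + k2 *: y + (k3 *: z + k4 *: w)) * b =
  k1 *: (a * x * b) + k2 *: (a * y * b) + (k3 *: (a * z * b) + k4 *: (a * w * b)).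
Proof. by rewrite !mulrDr !mulrDl -!scalerAr -!scalerAl. Qed.

(** Linearity written in coordinates, the form in which derivatives and integrals, both defined
    componentwise, pass through T. *)
Definition cliff_linear (T : Cl -> Cl) := forall a A, T a A = \sum_B a B * T (blade B) A.

Lemma cliff_linearP (T : Cl -> Cl) : (forall a b, T (a + b) = T a + T b) ->
  (forall (r : R) a, T (r *: a) = r *: T a) -> cliff_linear T.
Proof.
move=> TD TZ a A; rewrite {1}(cliffordE a).
have T0 : T 0 = 0 by have := TZ 0 0; rewrite !scale0r.
have -> : T (\sum_B a B *: blade B) = \sum_B a B *: T (blade B).
  by elim/big_rec2: _ => [//|B x y _ <-]; rewrite TD TZ.
by rewrite clifford_sumE; apply: eq_bigr => B _; rewrite clifford_scaleE.
Qed.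

Lemma psiD a b : psi (a + b) = psi a + psi b.
Proof. by rewrite /psi -big_split; apply: eq_bigr => j _; rewrite mulrDr mulrDl. Qed.

Lemma psi_sum (I : Type) (s : seq I) (F : I -> Cl) :
  psi (\sum_(i <- s) F i) = \sum_(i <- s) psi (F i).
Proof.
elim: s => [|i s IH]; last by rewrite !big_cons psiD IH.
by rewrite !big_nil /psi big1// => j _; rewrite mulr0 mul0r.
Qed.

Lemma psi_inv_linear : cliff_linear (@psi_inv R m).
Proof.
apply: cliff_linearP => [a b|r a]; apply/ffunP => A.
  rewrite (clifford_addE (psi_inv a) (psi_inv b) A) (psi_invE (a + b) A).
  by rewrite (psi_invE a A) (psi_invE b A) (clifford_addE a b A) mulrDr.
rewrite (clifford_scaleE r (psi_inv a) A) (psi_invE (r *: a) A).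
by rewrite (psi_invE a A) (clifford_scaleE r a A) mulrCA.
Qed.

Lemma sandwich_linear b c : cliff_linear (fun a => b * a * c).
Proof.
apply: cliff_linearP => [x y|r x]; first by rewrite mulrDr mulrDl.
by rewrite -scalerAr -scalerAl.
Qed.

Lemma mull_linear b : cliff_linear (fun a => b * a).
Proof. by apply: cliff_linearP => [x y|r x]; rewrite ?mulrDr -?scalerAr. Qed.

Lemma mulr_linear c : cliff_linear (fun a => a * c).
Proof. by apply: cliff_linearP => [x y|r x]; rewrite ?mulrDl -?scalerAl. Qed.

Lemma psi2_eq4 a : odd m -> psi (psi a) = a + a + (a + a) -> a = 0.
Proof.
move=> om /ffunP e; apply/ffunP => A; have := e A; rewrite !psiE !ffunE.
set k : R := m%:R - (2 * #|A|)%:R => {}e.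
have {}e : (k ^+ 2 - 4) * a A = 0.
  have s2 : (-1) ^+ #|A|.+1 * (-1) ^+ #|A|.+1 = 1 :> R by rewrite -expr2 sqrr_sign.
  have : k * k * a A = a A + a A + (a A + a A).
    by rewrite -[LHS]mul1r -s2 -[RHS]e; ring.
  by move=> h; rewrite mulrBl expr2 h; ring.
move/eqP: e; rewrite mulf_eq0 => /orP[|/eqP//].
have -> : k ^+ 2 - 4 = (k - 2) * (k + 2) by ring.
rewrite mulf_eq0 /k => /orP[].
  rewrite -addrA -opprD -natrD subr_eq0 eqr_nat => /eqP mE.
  by move: (congr1 odd mE); rewrite addn2 /= negbK om mul2n odd_double.
rewrite addrAC -natrD subr_eq0 eqr_nat => /eqP mE.
by move: (congr1 odd mE); rewrite addn2 /= negbK om mul2n odd_double.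
Qed.

(* Let a = \sum_i e_i v_i and b = \sum_i v_i e_i. Moving e_i past psi turns the
   hypotheses into psi a = - 2 b and psi b = - 2 a, so psi^2 = 4 on a and b, whereas
   the eigenvalues of psi are odd. *)
Lemma sum_gen_psi_eq0 (v : 'I_m -> Cl) : odd m ->
    \sum_i gen i * psi (v i) = 0 -> \sum_i psi (v i) * gen i = 0 ->
  \sum_i gen i * v i = 0 /\ \sum_i v i * gen i = 0.
Proof.
move=> om; set a := \sum_i gen i * v i; set b := \sum_i v i * gen i.
under eq_bigr => i _ do rewrite gen_psi.
rewrite sumrB sumrN -psi_sum big_split/= -/a -/b => ha.
under eq_bigr => i _ do rewrite psi_gen.
rewrite sumrB sumrN -psi_sum big_split/= -/a -/b => hb.
have pa : psi a = - (b + b) by apply/eqP; rewrite -subr_eq0 opprK -oppr_eq0 opprD; apply/eqP.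
have pb : psi b = - (a + a) by apply/eqP; rewrite -subr_eq0 opprK -oppr_eq0 opprD; apply/eqP.
have psiN x : psi (- x) = - psi x.
  by rewrite /psi -sumrN; apply: eq_bigr => j _; rewrite mulrN mulNr.
split; apply: psi2_eq4 => //.
  by rewrite pa psiN psiD pb -opprD opprK.
by rewrite pb psiN psiD pa -opprD opprK.
Qed.

End CliffordAlgebra.

(** * Left and right Dirac operators *)

Section DiracCalculus.
Context {R : realType} {m : nat}.
Local Notation Cl := (clifford R m).
Local Notation V := 'rV[R]_m.
Local Notation e_ := (@unit_vec R m).
Implicit Types (U : set V) (x v : V) (f g : V -> Cl) (s : V -> R) (A B : {set 'I_m}).

Definition is_cderive x v f (d : Cl) := forall A, is_derive x v (fun y => f y A) (d A).

Lemma cpartialA i f x A : clifford_partial i f x A = partial i (fun y => f y A) x.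
Proof. by rewrite ffunE. Qed.

#[local] Opaque clifford_partial.

Lemma cpartialE i f x d : is_cderive x (e_ i) f d -> clifford_partial i f x = d.
Proof. by move=> df; apply/ffunP => A; rewrite cpartialA; exact: partialE. Qed.

Lemma cpartial_coord i f A :
  (fun y => clifford_partial i f y A) = partial i (fun y => f y A).
Proof. by apply/funext => y; rewrite cpartialA. Qed.

Lemma clifford_Ck_cderive k U f i x : clifford_Ck k.+1 U f -> U x ->
  is_cderive x (e_ i) f (clifford_partial i f x).
Proof. by move=> Cf Ux A; rewrite cpartialA; exact: Ck_is_derive (Cf A) Ux. Qed.

Lemma clifford_Ck_partial k U f i : clifford_Ck k.+1 U f ->
  clifford_Ck k U (clifford_partial i f).
Proof. by move=> Cf A; rewrite cpartial_coord; exact: Ck_partial. Qed.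

Lemma clifford_CkW k U f : clifford_Ck k.+1 U f -> clifford_Ck k U f.
Proof. by move=> Cf A; exact: CkW. Qed.

Lemma cpartial_ext U i f g x : open U -> U x -> {in U, f =1 g} ->
  clifford_partial i f x = clifford_partial i g x.
Proof.
move=> oU Ux fg; apply/ffunP => A; rewrite [LHS]cpartialA [RHS]cpartialA.
by apply: (partial_ext i oU Ux) => y yU; rewrite fg.
Qed.

Lemma cpartial_comm U f i j x : open U -> clifford_Ck 2 U f -> U x ->
  clifford_partial i (clifford_partial j f) x =
  clifford_partial j (clifford_partial i f) x.
Proof.
move=> oU Cf Ux; apply/ffunP => A; rewrite [LHS]cpartialA [RHS]cpartialA.
rewrite (cpartial_coord j f A) (cpartial_coord i f A).
exact: partial_comm oU (Cf A) Ux.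
Qed.

Lemma is_cderive_add f g x v d e : is_cderive x v f d -> is_cderive x v g e ->
  is_cderive x v (fun y => f y + g y) (d + e).
Proof.
move=> df dg A; rewrite clifford_addE; under eq_fun do rewrite clifford_addE.
exact: is_derive_add.
Qed.

Lemma is_cderive_cst (c : Cl) x v : is_cderive x v (fun=> c) 0.
Proof. by move=> A; rewrite ffunE; exact: is_derive_cst. Qed.

Lemma is_derive_fin_sum (I : finType) (F : I -> V -> R) x v (d : I -> R) :
  (forall i, is_derive x v (F i) (d i)) ->
  is_derive x v (fun y => \sum_i F i y) (\sum_i d i).
Proof.
move=> dF; elim: (index_enum I) => [|i r IH].
  by under eq_fun do rewrite big_nil; rewrite big_nil; exact: is_derive_cst.
by under eq_fun do rewrite big_cons; rewrite big_cons; exact: is_derive_add.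
Qed.

Lemma is_cderive_sum (I : finType) (F : I -> V -> Cl) x v (d : I -> Cl) :
  (forall i, is_cderive x v (F i) (d i)) ->
  is_cderive x v (fun y => \sum_i F i y) (\sum_i d i).
Proof.
move=> dF A; rewrite clifford_sumE; under eq_fun do rewrite clifford_sumE.
by apply: is_derive_fin_sum => i; exact: dF.
Qed.

Lemma is_cderive_linear T f x v d : cliff_linear T -> is_cderive x v f d ->
  is_cderive x v (fun y => T (f y)) (T d).
Proof.
move=> lT df A; rewrite lT; under eq_fun do rewrite lT.
apply: is_derive_fin_sum => B; rewrite mulrC; under eq_fun do rewrite mulrC.
exact: is_deriveMl.
Qed.

Lemma is_cderive_scale s f x v ds d : is_derive x v s ds -> is_cderive x v f d ->
  is_cderive x v (fun y => s y *: f y) (ds *: f x + s x *: d).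
Proof.
move=> hs hf A; rewrite clifford_addE !clifford_scaleE; under eq_fun do rewrite clifford_scaleE.
exact: is_derive_prod.
Qed.

Lemma clifford_Ck_linear k U T f : open U -> cliff_linear T -> clifford_Ck k U f ->
  clifford_Ck k U (fun y => T (f y)).
Proof.
move=> oU lT Cf A; under eq_fun do rewrite lT; apply: Ck_sum => // B _.
by under eq_fun do rewrite mulrC; exact: CkZ.
Qed.

Lemma clifford_Ck_sum k U (I : finType) (F : I -> V -> Cl) : open U ->
  (forall i, clifford_Ck k U (F i)) -> clifford_Ck k U (fun y => \sum_i F i y).
Proof.
move=> oU CF A; under eq_fun do rewrite clifford_sumE.
by apply: Ck_sum => // i _; exact: CF.
Qed.

Lemma clifford_Ck_scale k U s f : open U -> Ck k U s -> clifford_Ck k U f ->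
  clifford_Ck k U (fun y => s y *: f y).
Proof. by move=> oU Cs Cf A; under eq_fun do rewrite clifford_scaleE; exact: CkM. Qed.

Lemma clifford_CkD k U f g : open U -> clifford_Ck k U f -> clifford_Ck k U g ->
  clifford_Ck k U (fun y => f y + g y).
Proof. by move=> oU Cf Cg A; under eq_fun do rewrite clifford_addE; exact: CkD. Qed.

Lemma clifford_Ck_sandwich k U f : open U -> clifford_Ck k.+2 U f ->
  clifford_Ck k U (dirac_sandwich f).
Proof.
move=> oU Cf; apply: clifford_Ck_sum => // i; apply: clifford_Ck_sum => // j.
apply: (clifford_Ck_linear oU (sandwich_linear (gen i) (gen j))).
exact/clifford_Ck_partial/clifford_Ck_partial.
Qed.

Definition dirac_left f x : Cl := \sum_i gen i * clifford_partial i f x.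
Definition dirac_right f x : Cl := \sum_i clifford_partial i f x * gen i.
Definition claplacian f x : Cl := \sum_i clifford_partial i (clifford_partial i f) x.

Lemma cpartial_sandwich U f k x : open U -> clifford_Ck 3 U f -> U x ->
  clifford_partial k (dirac_sandwich f) x =
  \sum_i \sum_j gen i * clifford_partial k (clifford_partial i (clifford_partial j f)) x * gen j.
Proof.
move=> oU Cf Ux; apply: cpartialE; apply: is_cderive_sum => i; apply: is_cderive_sum => j.
apply: (is_cderive_linear (sandwich_linear (gen i) (gen j))).
exact: clifford_Ck_cderive (clifford_Ck_partial i (clifford_Ck_partial j Cf)) Ux.
Qed.

Lemma cpartial_laplacian U f k x : open U -> clifford_Ck 3 U f -> U x ->
  clifford_partial k (claplacian f) x =
  \sum_i clifford_partial k (clifford_partial i (clifford_partial i f)) x.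
Proof.
move=> oU Cf Ux; apply: cpartialE; apply: is_cderive_sum => i.
exact: clifford_Ck_cderive (clifford_Ck_partial i (clifford_Ck_partial i Cf)) Ux.
Qed.

(** The two Dirac operators on the right combine to - Delta and the left one remains; the third
    partial derivatives are permuted on the way. *)
Lemma dirac_right_sandwich U f x : open U -> clifford_Ck 3 U f -> U x ->
  dirac_right (dirac_sandwich f) x = - dirac_left (claplacian f) x.
Proof.
move=> oU Cf Ux; rewrite /dirac_right /dirac_left.
pose D i j k := clifford_partial i (clifford_partial j (clifford_partial k f)) x.
have D23 i j k : D i j k = D i k j.
  apply: (cpartial_ext i oU Ux) => y; rewrite inE => Uy.
  exact: cpartial_comm oU (clifford_CkW Cf) Uy.
have D12 i j k : D i j k = D j i k.
  exact: cpartial_comm oU (clifford_Ck_partial k Cf) Ux.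
under eq_bigr => k _.
  rewrite (cpartial_sandwich k oU Cf Ux) mulr_suml.
  under eq_bigr => i _ do rewrite mulr_suml.
  over.
rewrite exchange_big/= -sumrN; apply: eq_bigr => i _.
rewrite (cpartial_laplacian i oU Cf Ux) -mulrN -(@sum_sym_gen_r _ _ (D i)) => [|j k]; last exact: D23.
rewrite mulr_sumr exchange_big/=; apply: eq_bigr => j _.
rewrite mulr_sumr; apply: eq_bigr => k _.
by rewrite -/(D k i j) D12 D23 !mulrA.
Qed.

Lemma dirac_left_sandwich U f x : open U -> clifford_Ck 3 U f -> U x ->
  dirac_left (dirac_sandwich f) x = - dirac_right (claplacian f) x.
Proof.
move=> oU Cf Ux; rewrite /dirac_right /dirac_left.
pose D i j k := clifford_partial i (clifford_partial j (clifford_partial k f)) x.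
have D23 i j k : D i j k = D i k j.
  apply: (cpartial_ext i oU Ux) => y; rewrite inE => Uy.
  exact: cpartial_comm oU (clifford_CkW Cf) Uy.
have D12 i j k : D i j k = D j i k.
  exact: cpartial_comm oU (clifford_Ck_partial k Cf) Ux.
under eq_bigr => k _.
  rewrite (cpartial_sandwich k oU Cf Ux) mulr_sumr.
  under eq_bigr => i _ do rewrite mulr_sumr.
  over.
rewrite /= -sumrN.
under eq_bigr => k _ do rewrite exchange_big/=.
rewrite exchange_big/=; apply: eq_bigr => j _.
rewrite (cpartial_laplacian j oU Cf Ux) -mulNr -(@sum_sym_gen_l _ _ (D j)) => [|i k]; last exact: D23.
rewrite mulr_suml; apply: eq_bigr => k _.
rewrite mulr_suml; apply: eq_bigr => i _.
by rewrite -/(D k i j) D23 D12 D23 !mulrA.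
Qed.

Section Monogenic.
Variables (U : set V) (u : V -> Cl).
Hypotheses (oU : open U) (Cu : clifford_Ck 2 U u).
Hypotheses (ul : forall x, U x -> dirac_left u x = 0).
Hypotheses (ur : forall x, U x -> dirac_right u x = 0).

(** Delta u = - D (D u), and D u vanishes on an open set. *)
Lemma claplacian_monogenic x : U x -> claplacian u x = 0.
Proof.
move=> Ux; apply/eqP; rewrite -oppr_eq0; apply/eqP.
pose G i j := clifford_partial i (clifford_partial j u) x.
rewrite -(@sum_sym_gen_l _ _ G) => [|i j]; last exact: cpartial_comm oU Cu Ux.
apply: big1 => i _; rewrite -mulr_sumr.
rewrite (_ : \sum_j gen j * G i j = clifford_partial i (dirac_left u) x).
  rewrite (cpartial_ext i (g := fun=> 0) oU Ux) => [|y]; last by rewrite inE => /ul.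
  rewrite (_ : clifford_partial _ _ _ = 0) ?mulr0//.
  by apply: cpartialE; exact: is_cderive_cst.
apply/esym/cpartialE; apply: is_cderive_sum => j.
exact: is_cderive_linear (mull_linear _) (clifford_Ck_cderive i (clifford_Ck_partial j Cu) Ux).
Qed.

Lemma sandwich_monogenic x : U x -> dirac_sandwich u x = 0.
Proof.
move=> Ux; apply: big1 => i _.
under eq_bigr => j _ do rewrite -mulrA.
rewrite -mulr_sumr.
rewrite (_ : \sum_j _ = clifford_partial i (dirac_right u) x).
  rewrite (cpartial_ext i (g := fun=> 0) oU Ux) => [|y]; last by rewrite inE => /ur.
  rewrite (_ : clifford_partial _ _ _ = 0) ?mulr0//.
  by apply: cpartialE; exact: is_cderive_cst.
apply/esym/cpartialE; apply: is_cderive_sum => j.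
exact: is_cderive_linear (mulr_linear _) (clifford_Ck_cderive i (clifford_Ck_partial j Cu) Ux).
Qed.

Lemma sandwich_sub_sqr_monogenic (c : R) x : U x ->
  dirac_sandwich (fun y => (c * (1 - enorm y ^+ 2)) *: u y) x =
  - (c *: (psi (u x) + psi (u x))).
Proof.
move=> Ux.
have dq i y : is_derive y (e_ i) (fun z : V => c * (1 - enorm z ^+ 2)) (- (2 * c * y 0 i)).
  have D := is_deriveMl c (is_derive_sub (is_derive_cst (1 : R) y (e_ i)) (is_derive_sqr_enorm i y)).
  have E : c * (0 - 2 * y 0 i) = - (2 * c * y 0 i) by ring.
  by rewrite -E.
have d1 j y : U y -> clifford_partial j (fun y => (c * (1 - enorm y ^+ 2)) *: u y) y =
    (- (2 * c * y 0 j)) *: u y + (c * (1 - enorm y ^+ 2)) *: clifford_partial j u y.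
  move=> Uy; apply: cpartialE.
  exact: (is_cderive_scale (dq j y) (clifford_Ck_cderive j (clifford_CkW Cu) Uy)).
have d2 i j : clifford_partial i
    (clifford_partial j (fun y => (c * (1 - enorm y ^+ 2)) *: u y)) x =
    (- (2 * c * (i == j)%:R)) *: u x + (- (2 * c * x 0 j)) *: clifford_partial i u x +
    ((- (2 * c * x 0 i)) *: clifford_partial j u x +
      (c * (1 - enorm x ^+ 2)) *: clifford_partial i (clifford_partial j u) x).
  rewrite (cpartial_ext i oU Ux (g := fun y => (- (2 * c * y 0 j)) *: u y +
      (c * (1 - enorm y ^+ 2)) *: clifford_partial j u y)) => [|y]; last by rewrite inE => /d1.
  have dl : is_derive x (e_ i) (fun z : V => - (2 * c * z 0 j)) (- (2 * c * (i == j)%:R)).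
    have D := is_deriveMl (- (2 * c)) (is_derive_coord i j x).
    rewrite mulNr in D; rewrite (_ : (fun z : V => _) = fun z => - (2 * c) * z 0 j)//.
    by apply/funext => z; rewrite mulNr.
  apply: cpartialE; apply: is_cderive_add.
    exact: (is_cderive_scale dl (clifford_Ck_cderive i (clifford_CkW Cu) Ux)).
  exact: (is_cderive_scale (dq i x) (clifford_Ck_cderive i (clifford_Ck_partial j Cu) Ux)).
(* The Leibniz rule gives four double sums. T1 is diagonal and gives - 2 c psi(u); T2 contains D u,
   T3 contains u D, and T4 is a multiple of D u D. *)
pose s := c * (1 - enorm x ^+ 2).
pose T1 i j := (- (2 * c * (i == j)%:R)) *: (gen i * u x * gen j).
pose T2 i j := (- (2 * c * x 0 j)) *: (gen i * clifford_partial i u x * gen j).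
pose T3 i j := (- (2 * c * x 0 i)) *: (gen i * clifford_partial j u x * gen j).
pose T4 i j := s *: (gen i * clifford_partial i (clifford_partial j u) x * gen j).
transitivity (\sum_i \sum_j (T1 i j + T2 i j + (T3 i j + T4 i j))).
  apply: eq_bigr => i _; apply: eq_bigr => j _; rewrite (d2 i j).
  exact: sandwich_lincomb.
have e4 : \sum_i \sum_j T4 i j = 0.
  transitivity (s *: dirac_sandwich u x); last by rewrite (sandwich_monogenic Ux) scaler0.
  rewrite /dirac_sandwich scaler_sumr; apply: eq_bigr => i _.
  by rewrite scaler_sumr.
have e3 : \sum_i \sum_j T3 i j = 0.
  apply: big1 => i _; rewrite /T3 -scaler_sumr.
  rewrite (_ : \sum_j _ = gen i * dirac_right u x); first by rewrite ur// mulr0 scaler0.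
  by rewrite mulr_sumr; apply: eq_bigr => j _; rewrite mulrA.
have e2 : \sum_i \sum_j T2 i j = 0.
  rewrite exchange_big; apply: big1 => j _; rewrite /T2 -scaler_sumr.
  rewrite (_ : \sum_i _ = dirac_left u x * gen j); first by rewrite ul// mul0r scaler0.
  by rewrite mulr_suml.
transitivity (\sum_i \sum_j T1 i j + \sum_i \sum_j T2 i j +
  (\sum_i \sum_j T3 i j + \sum_i \sum_j T4 i j)).
  move: T1 T2 T3 T4 {e2 e3 e4} => T1 T2 T3 T4.
  by rewrite -!big_split; apply: eq_bigr => i _ /=; rewrite -!big_split.
have add000 (A B C D : Cl) : B = 0 -> C = 0 -> D = 0 -> A + B + (C + D) = A.
  by move=> -> -> ->; rewrite !addr0.
transitivity (\sum_i \sum_j T1 i j); first exact: add000 e2 e3 e4.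
move=> {e2 e3 e4 T2 T3 T4}.
rewrite /psi -big_split/= scaler_sumr -sumrN; apply: eq_bigr => i _.
rewrite (bigD1 i)//= big1 ?addr0 => [|j ji]; rewrite /T1.
  rewrite eqxx mulr1 scaleNr; congr (- _).
  by rewrite scalerDr -scalerDl; congr (_ *: _); ring.
by rewrite eq_sym (negbTE ji) mulr0 oppr0 scale0r.
Qed.

End Monogenic.

Lemma psi_inv_monogenic U w : odd m -> open U -> clifford_Ck 1 U w ->
  (forall x, U x -> dirac_left w x = 0) -> (forall x, U x -> dirac_right w x = 0) ->
  forall x, U x -> dirac_left (fun y => psi_inv (w y)) x = 0 /\
                   dirac_right (fun y => psi_inv (w y)) x = 0.
Proof.
move=> om oU Cw wl wr x Ux.
pose v i := psi_inv (clifford_partial i w x).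
have dv i : clifford_partial i (fun y => psi_inv (w y)) x = v i.
  apply: cpartialE; apply: is_cderive_linear; first exact: psi_inv_linear.
  exact: clifford_Ck_cderive Cw Ux.
have [] := @sum_gen_psi_eq0 R m v om.
- by rewrite -[RHS](wl x Ux); apply: eq_bigr => i _; rewrite psi_invK.
- by rewrite -[RHS](wr x Ux); apply: eq_bigr => i _; rewrite psi_invK.
by move=> l r; rewrite /dirac_left /dirac_right;
  split; [rewrite -[RHS]l|rewrite -[RHS]r]; apply: eq_bigr => i _; rewrite dv.
Qed.

End DiracCalculus.

(** * Averages along affine paths *)

Section AffineAverage.
Context {R : realType} {m : nat}.
Local Notation V := 'rV[R]_m.
Local Notation e_ := (@unit_vec R m).
Local Notation leb := (@lebesgue_measure R).
Local Notation I01 := (`[0%R, 1%R]%classic : set R).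
Implicit Types (x y z : V) (f g : V -> R).

Lemma measurable_I01 : measurable I01.
Proof. exact: measurable_itv. Qed.

Lemma lebesgue_I01 : leb I01 = 1%E.
Proof. by rewrite lebesgue_measure_itv/= lte_fin ltr01 oppr0 adde0. Qed.

Lemma lebesgue_I01_lty : (leb I01 < +oo)%E.
Proof. by rewrite lebesgue_I01 ltry. Qed.

Definition continuous_curve (v : R -> V) := forall t e, 0 < e ->
  exists2 d, 0 < d & forall t', `|t' - t| < d -> enorm (v t' - v t) < e.

(** The data of an average int_0^1 w(t) f(s(t) x + v(t)) dt that turns functions on the ball of
    radius rho' into functions on the ball of radius rho. By [path_ball], for |x| < r the points
    stay in a compact ball inside the domain of f, where a continuous f is bounded and uniformly
    continuous. *)
Record affine_path (rho rho' : R) (w s : R -> R) (v : R -> V) : Prop := AffinePath {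
  path_weight : continuous w;
  path_scale : continuous s;
  path_shift : continuous_curve v;
  path_ball : forall r, r < rho -> exists2 r', r' < rho' &
    forall x t, enorm x < r -> I01 t -> enorm (s t *: x + v t) <= r' }.

Definition affine_avg (w s : R -> R) (v : R -> V) f x : R :=
  \int[leb]_(t in I01) (w t * f (s t *: x + v t)).

Lemma bounded_I01 (w : R -> R) : continuous w ->
  exists2 C, 0 <= C & forall t, I01 t -> `|w t| <= C.
Proof.
move=> cw; have cw' : {within I01, continuous (fun t => `|w t|)}.
  by apply: continuous_subspaceT => t; apply: continuous_comp; [exact: cw|exact: norm_continuous].
have [c _ cmax] := EVT_max ler01 cw'.
by exists `|w c| => // t; exact: cmax.
Qed.

Lemma continuous_path rho rho' w s v x : affine_path rho rho' w s v ->
  continuous_curve (fun t => s t *: x + v t).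
Proof.
move=> [cw cs cv _] t e e0; have e2 : 0 < e / 2 by rewrite divr_gt0.
have ex : 0 < e / 2 / (enorm x + 1) by rewrite divr_gt0// ltr_wpDl.
have [d d0 dP] := cv t _ e2.
have /cvgrPdist_lt/(_ _ ex)/nbhs_ballP[d' /= d'0 d'P] := cs t.
exists (Num.min d d'); first by rewrite lt_min d0.
move=> t'; rewrite lt_min => /andP[/dP h1 h2].
have {}h2 : `|s t' - s t| < e / 2 / (enorm x + 1).
  by rewrite distrC; apply: d'P; rewrite -ball_normE /ball_/= distrC.
rewrite opprD addrACA -scalerBl (le_lt_trans (enormD _ _))// enormZ.
rewrite ltr_pdivlMr ?ltr_wpDl// in h2.
have : `|s t' - s t| * enorm x <= `|s t' - s t| * (enorm x + 1) by rewrite ler_wpM2l// lerDl.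
lra.
Qed.

Lemma path_in_ball rho rho' w s v x t : affine_path rho rho' w s v -> enorm x < rho ->
  I01 t -> enorm (s t *: x + v t) < rho'.
Proof.
move=> [_ _ _ pb] xr It; have [r' r'1 r'P] := pb ((enorm x + rho) / 2) ltac:(lra).
by apply: le_lt_trans r'1; apply: r'P => //; lra.
Qed.

Lemma continuous_along_path rho rho' w s v f x : affine_path rho rho' w s v ->
  Ck 0 (eball rho') f -> enorm x < rho ->
  {within I01, continuous (fun t => w t * f (s t *: x + v t))}.
Proof.
move=> pth Cf xr; rewrite subspace_continuousP => t It.
apply: cvg_within_filter; apply: cvgM; first exact: (path_weight pth).
have /continuous_enormP cf := Ck_continuous Cf (path_in_ball pth xr It).
apply/cvgrPdist_lt => e e0; have [d d0 dP] := cf e e0.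
have [d' d'0 d'P] := continuous_path x pth t d0.
apply/nbhs_ballP; exists d' => //= t'; rewrite -ball_normE /ball_/= distrC => tt'.
by rewrite distrC dP// d'P.
Qed.

Lemma integrable_along_path rho rho' w s v f x : affine_path rho rho' w s v ->
  Ck 0 (eball rho') f -> enorm x < rho ->
  leb.-integrable I01 (EFin \o (fun t => w t * f (s t *: x + v t))).
Proof.
move=> pth Cf xr; apply: continuous_compact_integrable; first exact: segment_compact.
exact: continuous_along_path pth Cf xr.
Qed.

(** A derivative in x brings out the factor s(t), which is absorbed into the weight; derivatives of
    averages are thus again averages. *)
Lemma path_weightM rho rho' w s v : affine_path rho rho' w s v ->
  affine_path rho rho' (fun t => w t * s t) s v.
Proof.
move=> [cw cs cv pb]; split=> // t.
by apply: continuousM; [exact: cw|exact: cs].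
Qed.

Lemma Ckfam_affine_avg k rho rho' w s v f r : affine_path rho rho' w s v ->
  Ck k (eball rho') f -> r < rho ->
  Ckfam I01 k (eball r) (fun x t => w t * f (s t *: x + v t)).
Proof.
move=> + + rr; elim: k w f => [|k IH] w f pth Cf; last first.
  have C0 := Ckfam0 (IH w f pth (CkW Cf)).
  split; first by case: C0.
  exists (fun i x t => w t * s t * partial i f (s t *: x + v t)); split=> [i x t xr It|i].
    rewrite -mulrA; apply: is_deriveMl; apply: is_derive_affine.
    apply: Ck_is_derive Cf _; exact: (path_in_ball pth (lt_trans xr rr)).
  exact: IH (path_weightM pth) (Ck_partial i Cf).
have [r' r'1 r'P] := path_ball pth rr.
pose K := [set z : V | enorm z <= r'].
have cK : {within K, continuous f}.
  apply/subspace_continuousP => z zr; apply: cvg_within_filter.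
  by apply: (Ck_continuous Cf); exact: le_lt_trans r'1.
have [Cw Cw0 wC] := bounded_I01 (path_weight pth).
have [Cs Cs0 sC] := bounded_I01 (path_scale pth).
have [Cf' Cf0 fC] := within_continuous_bounded (@compact_enorm_le R m r') cK.
have unif := heine_cantor (@compact_enorm_le R m r') cK.
split=> //; split.
- move=> x xr; apply: subspace_continuous_measurable_fun; first exact: measurable_itv.
  exact: continuous_along_path pth Cf (lt_trans xr rr).
- exists (Cw * Cf') => x t xr It; rewrite normrM ler_pM ?wC// fC//.
  exact: r'P.
- move=> x e xr e0.
  have ew : 0 < e / (Cw + 1) by rewrite divr_gt0// ltr_wpDl.
  have [d d0 dP] := unif _ ew.
  exists (d / (Cs + 1)); first by rewrite divr_gt0// ltr_wpDl.
  move=> x' x'r xx' t It.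
  rewrite -mulrBr normrM.
  have : `|f (s t *: x' + v t) - f (s t *: x + v t)| < e / (Cw + 1).
    apply: dP; [exact: r'P|exact: r'P|].
    rewrite opprD addrACA subrr addr0 -scalerBr enormZ.
    apply: (@le_lt_trans _ _ ((Cs + 1) * enorm (x' - x))).
      by rewrite ler_wpM2r// (le_trans (sC _ It))// lerDl.
    by rewrite mulrC -ltr_pdivlMr// ltr_wpDl.
  move/ltW => h; apply: (@le_trans _ _ (Cw * (e / (Cw + 1)))).
    by rewrite ler_pM ?wC.
  by rewrite mulrCA ler_piMr ?(ltW e0)// ler_pdivrMr ?ltr_wpDl// mul1r lerDl.
Qed.

Let ball_mid (rho : R) x : eball rho x -> exists2 r, r < rho & eball r x.
Proof. by move=> xr; exists ((enorm x + rho) / 2); rewrite /eball/= in xr *; lra. Qed.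

Lemma Ck_affine_avg k rho rho' w s v f : affine_path rho rho' w s v ->
  Ck k (eball rho') f -> Ck k (eball rho) (affine_avg w s v f).
Proof.
move=> pth Cf; apply: Ck_local => x /ball_mid[r rr xr]; exists (eball r); split=> //.
have H := (@Ck_Rintegral R m _ _ leb I01 measurable_I01 lebesgue_I01_lty k (eball r) _
  (@open_eball R m r) (Ckfam_affine_avg pth Cf rr)).
exact H.
Qed.

Lemma is_derive_affine_avg rho rho' w s v f i x : affine_path rho rho' w s v ->
  Ck 1 (eball rho') f -> eball rho x ->
  is_derive x (e_ i) (affine_avg w s v f)
    (affine_avg (fun t => w t * s t) s v (partial i f) x).
Proof.
move=> pth Cf /ball_mid[r rr xr].
have Ff := Ckfam_affine_avg pth (CkW Cf) rr.
have Fd := Ckfam_affine_avg (path_weightM pth) (Ck_partial i Cf) rr.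
have dF z t : eball r z -> I01 t -> is_derive z (e_ i)
    ((fun x t => w t * f (s t *: x + v t)) ^~ t) (w t * s t * partial i f (s t *: z + v t)).
  move=> zr It; rewrite -mulrA; apply: is_deriveMl; apply: is_derive_affine.
  apply: Ck_is_derive Cf _; exact: (path_in_ball pth (lt_trans zr rr)).
exact (@is_derive_Rintegral R m _ _ leb I01 measurable_I01 lebesgue_I01_lty (eball r)
  (fun x t => w t * f (s t *: x + v t))
  (fun i x t => w t * s t * partial i f (s t *: x + v t)) i x (@open_eball R m r) Ff Fd dF xr).
Qed.

Lemma affine_avgD rho rho' w s v f g x : affine_path rho rho' w s v ->
    Ck 0 (eball rho') f -> Ck 0 (eball rho') g -> eball rho x ->
  affine_avg w s v (fun y => f y + g y) x = affine_avg w s v f x + affine_avg w s v g x.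
Proof.
move=> pth Cf Cg xr; rewrite /affine_avg -RintegralD.
- by apply: eq_Rintegral => t _; rewrite mulrDr.
- exact: measurable_I01.
- exact: integrable_along_path pth Cf xr.
- exact: integrable_along_path pth Cg xr.
Qed.

Lemma affine_avgZ rho rho' w s v f c x : affine_path rho rho' w s v ->
    Ck 0 (eball rho') f -> eball rho x ->
  affine_avg w s v (fun y => c * f y) x = c * affine_avg w s v f x.
Proof.
move=> pth Cf xr; rewrite /affine_avg -RintegralZl.
- by apply: eq_Rintegral => t _; rewrite mulrCA.
- exact: measurable_I01.
- exact: integrable_along_path pth Cf xr.
Qed.

Lemma affine_avg0 rho rho' w s v f x : affine_path rho rho' w s v ->
    (forall y, eball rho' y -> f y = 0) -> eball rho x -> affine_avg w s v f x = 0.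
Proof.
move=> pth f0 xr; transitivity (\int[leb]_(t in I01) (0 : R)).
  apply: eq_Rintegral => t; rewrite inE => It.
  by rewrite f0 ?mulr0//; exact: path_in_ball pth xr It.
by rewrite Rintegral_cst ?mul0r//; exact: measurable_I01.
Qed.

Lemma affine_avg_sum rho rho' w s v (J : finType) (F : J -> V -> R) x :
    affine_path rho rho' w s v ->
    (forall j, Ck 0 (eball rho') (F j)) -> eball rho x ->
  affine_avg w s v (fun y => \sum_j F j y) x = \sum_j affine_avg w s v (F j) x.
Proof.
move=> pth CF xr; have oB := @open_eball R m rho'.
elim: (index_enum J) => [|j r IH].
  under eq_fun do rewrite big_nil; rewrite big_nil.
  exact: (affine_avg0 pth).
under eq_fun do rewrite big_cons; rewrite big_cons -IH.
by apply: (affine_avgD pth) => //; apply: Ck_sum.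
Qed.

Lemma affine_avg_near rho rho' s v f x (c e : R) : affine_path rho rho' (fun=> 1) s v ->
    Ck 0 (eball rho') f -> eball rho x ->
    (forall t, I01 t -> `|f (s t *: x + v t) - c| <= e) ->
  `|affine_avg (fun=> 1) s v f x - c| <= e.
Proof.
move=> pth Cf xr fc.
have If := integrable_along_path pth Cf xr.
have cc : {within I01, continuous (fun=> c : R)}.
  by apply: continuous_subspaceT; exact: cst_continuous.
have Ic : leb.-integrable I01 (EFin \o (fun=> c)).
  by apply: continuous_compact_integrable; [exact: segment_compact|exact: cc].
have -> : affine_avg (fun=> 1) s v f x - c =
    \int[leb]_(t in I01) (1 * f (s t *: x + v t) - c).
  rewrite RintegralB; [|exact: measurable_I01|exact: If|exact: Ic].
  rewrite Rintegral_cst; last exact: measurable_I01.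
  have E : fine (leb I01) = 1 by rewrite lebesgue_I01.
  rewrite -[X in _ - X]mulr1; congr (_ - _ * _); exact (esym E).
have mF : measurable_fun I01 (fun t => 1 * f (s t *: x + v t) - c).
  apply: measurable_funB; last exact: measurable_cst.
  apply: subspace_continuous_measurable_fun; first exact: measurable_itv.
  exact: continuous_along_path pth Cf xr.
have bF t : I01 t -> `|1 * f (s t *: x + v t) - c| <= e by move=> It; rewrite mul1r fc.
have := @norm_Rintegral_le R _ _ leb I01 measurable_I01 lebesgue_I01_lty _ _ mF bF.
have E : e * fine (leb I01) = e by rewrite lebesgue_I01 mulr1.
by move=> B; rewrite -[leRHS]E; exact B.
Qed.

Lemma Rintegral_FTC (F F' : R -> R) : (forall t, I01 t -> is_derive t 1 F (F' t)) ->
  {within I01, continuous F'} -> \int[leb]_(t in I01) F' t = F 1 - F 0.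
Proof.
move=> dF cF'; rewrite /Rintegral (@continuous_FTC2 R F' F 0 1)//.
  split.
  - move=> t t01; have It : I01 t by exact: subset_itv_oo_cc.
    by have [] := dF t It.
  - have I0 : I01 0 by rewrite /= in_itv/= lexx ler01.
    have [d0 _] := dF 0 I0.
    apply: cvg_at_right_filter; apply: differentiable_continuous.
    exact/derivable1_diffP.
  - have I1 : I01 1 by rewrite /= in_itv/= lexx ler01.
    have [d1 _] := dF 1 I1.
    apply: cvg_at_left_filter; apply: differentiable_continuous.
    exact/derivable1_diffP.
move=> t t01; have It : I01 t by exact: subset_itv_oo_cc.
by rewrite derive1E; have [_ ->] := dF t It.
Qed.

End AffineAverage.

(** * Segment averages and the gain of regularity *)

Section Paths.
Context {R : realType} {m : nat}.
Local Notation V := 'rV[R]_m.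
Local Notation e_ := (@unit_vec R m).
Local Notation leb := (@lebesgue_measure R).
Local Notation I01 := (`[0%R, 1%R]%classic : set R).
Implicit Types (x y z : V) (f g : V -> R).

Lemma enorm_unit_vec i : enorm (e_ i) = 1.
Proof.
rewrite enormE /dot (bigD1 i)//= big1 => [|l li]; rewrite !mxE ?eqxx/=.
  by rewrite mulr1 addr0 sqrtr1.
by rewrite (negbTE li) mulr0.
Qed.

Lemma continuous_curve_cst z : continuous_curve (fun=> z).
Proof. by move=> t e e0; exists 1 => // t' _; rewrite subrr enorm0. Qed.

Lemma continuous_curve_line z : continuous_curve (fun t => t *: z).
Proof.
move=> t e e0; exists (e / (enorm z + 1)); first by rewrite divr_gt0// ltr_wpDl.
move=> t'; rewrite ltr_pdivlMr ?ltr_wpDl// -scalerBl enormZ; apply: le_lt_trans.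
by rewrite ler_wpM2l// lerDl.
Qed.

Lemma affine_path_const_scale rho rho' w a b (v : R -> V) : continuous w -> continuous_curve v ->
    0 < a -> (forall t, I01 t -> enorm (v t) <= b) -> a * rho + b <= rho' ->
  affine_path rho rho' w (fun=> a) v.
Proof.
move=> cw cv a0 vb ab; split=> //; first by move=> t; exact: cst_continuous.
move=> r rr; exists (a * r + b).
  by rewrite (lt_le_trans _ ab)// ltrD2r ltr_pM2l.
move=> x t xr It; rewrite (le_trans (enormD _ _))// enormZ gtr0_norm//.
by rewrite lerD ?vb// ler_wpM2l// ltW.
Qed.

Lemma affine_path_radial rho w : continuous w ->
  affine_path rho rho w (fun t => t ^+ 2) (fun=> 0 : V).
Proof.
move=> cw; split=> //; [exact: exprn_continuous|exact: continuous_curve_cst|].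
move=> r rr; exists r => // x t xr; rewrite /= in_itv/= => /andP[t0 t1].
rewrite addr0 enormZ ger0_norm ?sqr_ge0// (le_trans _ (ltW xr))//.
by rewrite ler_piMl// expr_le1.
Qed.

Lemma affine_avg_const a z f x : affine_avg (fun=> 1) (fun=> a) (fun=> z) f x = f (a *: x + z).
Proof.
rewrite /affine_avg Rintegral_cst; last exact: measurable_I01.
have E : fine (leb I01) = 1 by rewrite lebesgue_I01.
by rewrite mul1r -[RHS]mulr1; congr (_ * _); exact E.
Qed.

Section Smoothing.
Variable e : R.
Hypothesis e_gt0 : 0 < e.
Hypothesis e_lt1 : e < 1.
Local Notation B := (eball 1 : set V).

Let c1 : continuous (fun _ : R => 1 : R).
Proof. by move=> t; exact: cst_continuous. Qed.

Lemma shrink_path i : affine_path 1 1 (fun=> 1) (fun=> 1 - e) (fun t => t *: (e *: e_ i)).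
Proof.
apply: (affine_path_const_scale (b := e)) => //; last 1 first.
- by rewrite mulr1 subrK.
- exact: continuous_curve_line.
- by rewrite subr_gt0.
move=> t; rewrite /= in_itv/= => /andP[t0 t1].
by rewrite !enormZ enorm_unit_vec mulr1 !ger0_norm// ?(ltW e_gt0)// ler_piMl// ltW.
Qed.

Let end_path z : enorm z <= e -> affine_path 1 1 (fun=> 1) (fun=> 1 - e) (fun=> z).
Proof.
move=> ze; apply: (affine_path_const_scale (b := e)) => //.
- exact: continuous_curve_cst.
- by rewrite subr_gt0.
- by rewrite mulr1 subrK.
Qed.

(* Average over a segment in direction e_i inside the ball; by the fundamental
   theorem of calculus it gains one derivative in that direction. *)
Definition shrink_avg i f := affine_avg (fun=> 1) (fun=> 1 - e) (fun t => t *: (e *: e_ i)) f.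

Lemma partial_shrink_avg_ne i j f x : Ck 1 B f -> B x ->
  partial j (shrink_avg i f) x = (1 - e) * shrink_avg i (partial j f) x.
Proof.
move=> Cf Bx; have C0 := Ck_partial j Cf.
rewrite (partialE (is_derive_affine_avg j (shrink_path i) Cf Bx)).
rewrite /shrink_avg -(affine_avgZ (1 - e) (shrink_path i) C0 Bx).
by apply: eq_Rintegral => t _; rewrite mulrA.
Qed.

Lemma partial_shrink_avg i f x : Ck 1 B f -> B x ->
  partial i (shrink_avg i f) x =
  (1 - e) / e * (f ((1 - e) *: x + e *: e_ i) - f ((1 - e) *: x + 0)).
Proof.
move=> Cf Bx; rewrite (partial_shrink_avg_ne i i Cf Bx) -mulrA; congr (_ * _).
have C0 := Ck_partial i Cf; have pth := shrink_path i.
have dF t : I01 t -> is_derive t 1 (fun t => f (t *: (e *: e_ i) + (1 - e) *: x))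
    (e * partial i f (t *: (e *: e_ i) + (1 - e) *: x)).
  move=> It; apply/is_derive_line; apply: is_derive_scale_vec.
  apply: (Ck_is_derive i Cf); rewrite addrC; exact: path_in_ball pth Bx It.
have cF : {within I01, continuous (fun t => e * partial i f (t *: (e *: e_ i) + (1 - e) *: x))}.
  have := continuous_along_path (w := fun=> e) (v := fun t => t *: (e *: e_ i))
    (s := fun=> 1 - e) (rho := 1) (rho' := 1) (f := partial i f) (x := x).
  move=> /(_ _ C0 Bx) h.
  have E : (fun t : R => e * partial i f ((1 - e) *: x + t *: (e *: e_ i))) =
      (fun t => e * partial i f (t *: (e *: e_ i) + (1 - e) *: x)).
    by apply/funext => t; rewrite addrC.
  rewrite -E; apply: h; case: pth => _ cs cv pb; split=> // t; exact: cst_continuous.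
have := Rintegral_FTC dF cF; rewrite scale1r scale0r add0r addr0 (addrC (e *: _)) => <-.
rewrite mulrC; apply: (canRL (mulfK _)); first by rewrite gt_eqF.
rewrite mulrC -(affine_avgZ e pth C0 Bx).
by apply: eq_Rintegral => t _; rewrite mul1r (addrC (_ *: x)).
Qed.

Lemma Ck_shrink_avg k i f : Ck k B f -> Ck k B (shrink_avg i f).
Proof. exact: Ck_affine_avg (shrink_path i). Qed.

Fixpoint shrink_avgs (L : seq 'I_m) f :=
  if L is i :: L' then shrink_avg i (shrink_avgs L' f) else f.

Lemma Ck_shrink_avgs k L f : Ck k B f -> Ck k B (shrink_avgs L f).
Proof. by move=> Cf; elim: L => [//|i L IH] /=; exact: Ck_shrink_avg. Qed.

Let oB : open B := @open_eball R m 1.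

(** At an average in direction j the derivative becomes a difference of two values and costs no
    regularity; averages in other directions commute with it up to the factor 1 - e. *)
Lemma Ck_partial_shrink_avgs k L f j : j \in L -> Ck k.+1 B f ->
  Ck k.+1 B (partial j (shrink_avgs L f)).
Proof.
have Ck1 l u : Ck l.+1 B u -> Ck 1 B u by elim: l => [//|l IH /CkW/IH].
move=> + Cf; elim: L => [//|i L IH]; rewrite inE => /orP[/eqP <-|jL] /=.
  set u := shrink_avgs L f; have Cu : Ck k.+1 B u by exact: Ck_shrink_avgs.
  (* The two end values are averages along constant curves, so their regularity is again a case of
     [Ck_affine_avg]. *)
  have E : {in B, (fun x => (1 - e) / e *
      (affine_avg (fun=> 1) (fun=> 1 - e) (fun=> e *: e_ j) u x +
       -1 * affine_avg (fun=> 1) (fun=> 1 - e) (fun=> 0) u x)) =1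
       partial j (shrink_avg j u)}.
    move=> x; rewrite inE => Bx; rewrite (partial_shrink_avg j (Ck1 _ _ Cu) Bx).
    by rewrite !affine_avg_const mulN1r.
  have pe : enorm (e *: e_ j) <= e by rewrite enormZ enorm_unit_vec mulr1 gtr0_norm.
  have p0 : enorm (0 : V) <= e by rewrite enorm0 ltW.
  apply: (Ck_ext oB E); apply: CkZ => //; apply: CkD => //.
    exact: Ck_affine_avg (end_path pe) Cu.
  apply: CkZ => //; exact: Ck_affine_avg (end_path p0) Cu.
set u := shrink_avgs L f; have Cu : Ck k.+1 B u by exact: Ck_shrink_avgs.
have E : {in B, (fun x => (1 - e) * shrink_avg i (partial j u) x) =1
    partial j (shrink_avg i u)}.
  by move=> x; rewrite inE => Bx; rewrite (partial_shrink_avg_ne i j (Ck1 _ _ Cu) Bx).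
apply: (Ck_ext oB E); apply: CkZ => //; apply: Ck_shrink_avg; exact: IH.
Qed.

(** Averaging once in every coordinate direction leaves all first derivatives in the class of f. *)
Lemma Ck_gain k f : Ck k.+1 B f -> Ck k.+2 B (shrink_avgs (enum 'I_m) f).
Proof.
move=> Cf; have Cu := Ck_shrink_avgs (enum 'I_m) Cf.
apply: (@Ck_intro _ _ k.+1 B _ (fun j => partial j (shrink_avgs (enum 'I_m) f)) oB).
- by move=> x; exact: Ck_continuous Cu.
- by move=> j x; exact: Ck_is_derive Cu.
- by move=> j; apply: Ck_partial_shrink_avgs => //; rewrite mem_enum.
Qed.

Lemma shrink_avgs_near L f x (c h : R) : Ck 0 B f -> B x ->
  (forall z, B z -> enorm (z - x) <= 2 * e * (size L)%:R -> `|f z - c| <= h) ->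
  `|shrink_avgs L f x - c| <= h.
Proof.
move=> Cf; elim: L x => [|i L IH] x Bx fc /=.
  by apply: fc => //; rewrite subrr enorm0 mulr0.
apply: (affine_avg_near (shrink_path i) (Ck_shrink_avgs L Cf) Bx) => t It.
have Bt := path_in_ball (shrink_path i) Bx It.
apply: IH => // z Bz zt; apply: fc => //=.
apply: le_trans (enorm_triangle _ _ _) _.
rewrite -[(size _).+1%:R]natr1 mulrDr mulr1; apply: lerD zt _.
(* One average displaces x by at most 2 e: at most e along the segment and e |x| by the
   contraction. *)
have -> : (1 - e) *: x + t *: (e *: e_ i) - x = t *: (e *: e_ i) - e *: x.
  by rewrite scalerBl scale1r addrAC (addrAC x) subrr add0r addrC.
move: It; rewrite /= in_itv/= => /andP[t0 t1].
apply: le_trans (enormB _ _) _; rewrite !enormZ enorm_unit_vec.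
rewrite !ger0_norm ?(ltW e_gt0)// mulr1 (_ : 2 * e = e + e); last by ring.
apply: lerD; first by rewrite ler_piMl// ltW.
by rewrite ler_piMr ?(ltW e_gt0)//; exact: ltW.
Qed.

End Smoothing.
End Paths.

Section CliffordAverage.
Context {R : realType} {m : nat}.
Local Notation Cl := (clifford R m).
Local Notation V := 'rV[R]_m.
Implicit Types (x : V) (f : V -> Cl).
Variables (rho rho' : R).

Definition cavg w s v f x : Cl := [ffun A => affine_avg w s v (fun y => f y A) x].

Lemma cavgA w s v f x A : cavg w s v f x A = affine_avg w s v (fun y => f y A) x.
Proof. by rewrite ffunE. Qed.

#[local] Opaque cavg.

Lemma clifford_Ck_cavg k w s v f : affine_path rho rho' w s v ->
  clifford_Ck k (eball rho') f -> clifford_Ck k (eball rho) (cavg w s v f).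
Proof.
move=> pth Cf A; have -> : (fun x => cavg w s v f x A) = affine_avg w s v (fun y => f y A).
  by apply/funext => x; exact: cavgA.
exact: Ck_affine_avg pth (Cf A).
Qed.

Lemma cpartial_cavg w s v f i x : affine_path rho rho' w s v ->
    clifford_Ck 1 (eball rho') f -> eball rho x ->
  clifford_partial i (cavg w s v f) x =
  cavg (fun t => w t * s t) s v (clifford_partial i f) x.
Proof.
move=> pth Cf xr; apply: cpartialE => A; rewrite cavgA.
have -> : (fun y => cavg w s v f y A) = affine_avg w s v (fun y => f y A).
  by apply/funext => y; exact: cavgA.
rewrite (cpartial_coord i f A); exact: is_derive_affine_avg pth (Cf A) xr.
Qed.

Lemma cavg_linear w s v T f x : affine_path rho rho' w s v -> cliff_linear T ->
    clifford_Ck 0 (eball rho') f -> eball rho x ->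
  T (cavg w s v f x) = cavg w s v (fun y => T (f y)) x.
Proof.
move=> pth lT Cf xr; apply/ffunP => A; rewrite cavgA lT.
under [in RHS]eq_fun do rewrite lT.
rewrite (affine_avg_sum (F := fun B y => f y B * T (blade B) A) pth) => [|B|]//; last first.
  by under eq_fun do rewrite mulrC; apply: CkZ; [exact: open_eball|exact: Cf].
apply: eq_bigr => B _; rewrite cavgA mulrC -(affine_avgZ _ pth (Cf B) xr).
by congr (affine_avg _ _ _ _ x); apply/funext => y; rewrite mulrC.
Qed.

Lemma cavg_sum w s v (I : finType) (F : I -> V -> Cl) x : affine_path rho rho' w s v ->
    (forall i, clifford_Ck 0 (eball rho') (F i)) -> eball rho x ->
  \sum_i cavg w s v (F i) x = cavg w s v (fun y => \sum_i F i y) x.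
Proof.
move=> pth CF xr; apply/ffunP => A; rewrite clifford_sumE cavgA.
under [in RHS]eq_fun do rewrite clifford_sumE.
rewrite (affine_avg_sum (F := fun i y => F i y A) pth) => [|i|]//; last exact: CF.
by apply: eq_bigr => i _; rewrite cavgA.
Qed.

Lemma cavg0 w s v f x : affine_path rho rho' w s v ->
  (forall y, eball rho' y -> f y = 0) -> eball rho x -> cavg w s v f x = 0.
Proof.
move=> pth f0 xr; apply/ffunP => A; rewrite cavgA (affine_avg0 pth) ?ffunE// => y yr.
by rewrite f0// ffunE.
Qed.

Let oB : open (eball rho' : set V) := @open_eball R m rho'.

Lemma dirac_left_cavg w s v f x : affine_path rho rho' w s v ->
    clifford_Ck 1 (eball rho') f -> eball rho x ->
  dirac_left (cavg w s v f) x = cavg (fun t => w t * s t) s v (dirac_left f) x.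
Proof.
move=> pth Cf xr; have pth' := path_weightM pth; have Cp i := clifford_Ck_partial i Cf.
rewrite /dirac_left -(cavg_sum (F := fun i y => gen i * clifford_partial i f y) pth') => [|i|]//.
  apply: eq_bigr => i _; rewrite (cpartial_cavg i pth Cf xr).
  exact: cavg_linear pth' (mull_linear _) (Cp i) xr.
exact: clifford_Ck_linear oB (mull_linear _) (Cp i).
Qed.

Lemma dirac_right_cavg w s v f x : affine_path rho rho' w s v ->
    clifford_Ck 1 (eball rho') f -> eball rho x ->
  dirac_right (cavg w s v f) x = cavg (fun t => w t * s t) s v (dirac_right f) x.
Proof.
move=> pth Cf xr; have pth' := path_weightM pth; have Cp i := clifford_Ck_partial i Cf.
rewrite /dirac_right -(cavg_sum (F := fun i y => clifford_partial i f y * gen i) pth') => [|i|]//.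
  apply: eq_bigr => i _; rewrite (cpartial_cavg i pth Cf xr).
  exact: (cavg_linear (T := fun a => a * gen i) pth' (mulr_linear _) (Cp i) xr).
exact: clifford_Ck_linear oB (mulr_linear _) (Cp i).
Qed.

Lemma dirac_sandwich_cavg w s v f x : affine_path rho rho' w s v ->
    clifford_Ck 2 (eball rho') f -> eball rho x ->
  dirac_sandwich (cavg w s v f) x =
  cavg (fun t => w t * s t * s t) s v (dirac_sandwich f) x.
Proof.
move=> pth Cf xr; have pth' := path_weightM pth; have pth2 := path_weightM pth'.
have Cp i j := clifford_Ck_partial i (clifford_Ck_partial j Cf).
have lin i j := sandwich_linear (R := R) (m := m) (gen i) (gen j).
have Cs i j := clifford_Ck_linear oB (lin i j) (Cp i j).
rewrite /dirac_sandwich.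
rewrite -(cavg_sum (F := fun i y => \sum_j gen i * clifford_partial i (clifford_partial j f) y * gen j) pth2)
  => [|i|]//; last by apply: clifford_Ck_sum => // j; exact: Cs.
apply: eq_bigr => i _.
rewrite -(cavg_sum (F := fun j y => gen i * clifford_partial i (clifford_partial j f) y * gen j) pth2)
  => [|j|]//.
apply: eq_bigr => j _.
rewrite (cpartial_ext i (g := cavg (fun t => w t * s t) s v (clifford_partial j f)) (@open_eball R m rho) xr).
  rewrite (cpartial_cavg i pth' (clifford_Ck_partial j Cf) xr).
  exact: (cavg_linear (T := fun a => gen i * a * gen j) pth2 (lin i j) (Cp i j) xr).
by move=> y; rewrite inE => yr; exact: cpartial_cavg pth (clifford_CkW Cf) yr.
Qed.

End CliffordAverage.

(** * Representation and uniqueness *)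

Section RadialPotential.
Context {R : realType} {n : nat}.
Local Notation V := 'rV[R]_n.+1.
Local Notation e_ := (@unit_vec R n.+1).
Local Notation leb := (@lebesgue_measure R).
Local Notation I01 := (`[0%R, 1%R]%classic : set R).
Implicit Types (x y : V) (f q : V -> R).

(** For harmonic h, Delta ((1 - |x|^2) h) = - 2 m h - 4 x.grad h. With h the integral of w(t) q(t^2
    x) and w(t) = - t^(m-1) / 2, the right-hand side has as integrand the t-derivative of t^m q(t^2
    x), so it integrates to q(x). Here m = n + 1. *)
Definition radial_weight (t : R) : R := - 2^-1 * t ^+ n.

Definition radial_potential q x : R :=
  affine_avg radial_weight (fun t => t ^+ 2) (fun=> 0 : V) q x.

Lemma path_radial_weight rho :
  affine_path rho rho radial_weight (fun t => t ^+ 2) (fun=> 0 : V).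
Proof.
apply: affine_path_radial => t; apply: cvgM; first exact: cvg_cst.
exact: exprn_continuous.
Qed.

Lemma is_derive_one_sub_sqr i y :
  is_derive y (e_ i) (fun z : V => 1 - enorm z ^+ 2) (- (2 * y 0 i)).
Proof.
have D := is_derive_sub (is_derive_cst (1 : R) y (e_ i)) (is_derive_sqr_enorm i y).
by rewrite -[X in is_derive _ _ _ X]sub0r.
Qed.

Lemma laplacian_one_sub_sqrM (U : set V) f x : open U -> Ck 2 U f -> U x ->
  laplacian (fun y => (1 - enorm y ^+ 2) * f y) x =
  - (2 * n.+1%:R) * f x - 4 * (\sum_i x 0 i * partial i f x) + (1 - enorm x ^+ 2) * laplacian f x.
Proof.
move=> oU Cf Ux.
have d1 i y : U y -> partial i (fun y => (1 - enorm y ^+ 2) * f y) y =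
    - 2 * y 0 i * f y + (1 - enorm y ^+ 2) * partial i f y.
  move=> Uy; apply: partialE; rewrite mulNr.
  exact: is_derive_prod (is_derive_one_sub_sqr i y) (Ck_is_derive i (CkW Cf) Uy).
have d2 i : partial i (partial i (fun y => (1 - enorm y ^+ 2) * f y)) x =
    (- 2 * (i == i)%:R * f x + - 2 * x 0 i * partial i f x) +
    (- (2 * x 0 i) * partial i f x + (1 - enorm x ^+ 2) * partial i (partial i f) x).
  rewrite (@partial_ext _ _ U i _ (fun y => - 2 * y 0 i * f y +
    (1 - enorm y ^+ 2) * partial i f y) x oU Ux) => [|y]; last by rewrite inE; exact: d1.
  apply: partialE; apply: is_derive_add.
    exact: is_derive_prod (is_deriveMl (- 2) (is_derive_coord i i x)) (Ck_is_derive i (CkW Cf) Ux).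
  exact: is_derive_prod (is_derive_one_sub_sqr i x) (Ck_is_derive i (Ck_partial i Cf) Ux).
have E : laplacian (fun y => (1 - enorm y ^+ 2) * f y) x =
    \sum_i (- 2 * f x - 4 * (x 0 i * partial i f x) +
      (1 - enorm x ^+ 2) * partial i (partial i f) x).
  by apply: eq_bigr => i _; rewrite d2 eqxx /=; ring.
rewrite E big_split big_split/= -mulr_sumr sumrN -mulr_sumr sumr_const card_ord.
rewrite -[_ *+ n.+1]mulr_natr; congr (_ - _ + _); first by ring.
by rewrite mulr_sumr.
Qed.

Lemma is_derive_radial rho q x (t : R) : Ck 1 (eball rho) q -> eball rho x -> I01 t ->
  is_derive t 1 (fun t => t ^+ n.+1 * q (t ^+ 2 *: x + 0))
    (n.+1%:R * t ^+ n * q (t ^+ 2 *: x + 0) +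
     t ^+ n.+1 * (2 * t * \sum_i x 0 i * partial i q (t ^+ 2 *: x + 0))).
Proof.
move=> Cq xr It.
have Bt : eball rho (t ^+ 2 *: x + 0) := path_in_ball (path_radial_weight rho) xr It.
have dq : is_derive (t ^+ 2) 1 (fun s : R => q (s *: x + 0))
    (\sum_i x 0 i * partial i q (t ^+ 2 *: x + 0)).
  exact/is_derive_line/(is_derive_direction x (@open_eball R n.+1 rho) Cq Bt).
have dX k : is_derive t 1 (fun t : R => t ^+ k) (k%:R * t ^+ k.-1).
  have D := is_deriveX k (is_derive_id t (1 : R)).
  rewrite exprfctE in D; rewrite -[X in is_derive _ _ _ X]mulr1; exact: D.
have d2 := dX 2%N; rewrite expr1 in d2.
have dc := @is_derive1_comp R (fun s : R => q (s *: x + 0)) (fun t => t ^+ 2) t _ _ dq d2.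
have dn := dX n.+1.
have D := is_deriveM dn dc; rewrite addrC (mulrC (2 * t)) [X in _ + X]mulrC; exact: D.
Qed.

Lemma laplacian_radial_potential rho q x : Ck 2 (eball rho) q -> eball rho x ->
    laplacian (radial_potential q) x = 0 ->
  laplacian (fun y => (1 - enorm y ^+ 2) * radial_potential q y) x = q x.
Proof.
move=> Cq xr lap0; have oB := @open_eball R n.+1 rho.
have pth := path_radial_weight rho; have pth' := path_weightM pth.
have Ch : Ck 2 (eball rho) (radial_potential q) := Ck_affine_avg pth Cq.
rewrite (laplacian_one_sub_sqrM oB Ch xr) lap0 mulr0 addr0.
pose dq y := \sum_i x 0 i * partial i q y.
have C0 : Ck 0 (eball rho) q := CkW (CkW Cq).
have Ci i : Ck 0 (eball rho) (partial i q) := CkW (Ck_partial i Cq).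
have Cdi i : Ck 0 (eball rho) (fun y => x 0 i * partial i q y) := CkZ (x 0 i) oB (Ci i).
have Cd : Ck 0 (eball rho) dq by apply: Ck_sum => // i _; exact: Cdi.
have E1 : \sum_i x 0 i * partial i (radial_potential q) x =
    affine_avg (fun t => radial_weight t * t ^+ 2) (fun t => t ^+ 2) (fun=> 0 : V) dq x.
  rewrite (affine_avg_sum (F := fun i y => x 0 i * partial i q y) pth' Cdi xr).
  apply: eq_bigr => i _; rewrite (affine_avgZ _ pth' (Ci i) xr); congr (_ * _).
  exact: partialE (is_derive_affine_avg i pth (CkW Cq) xr).
rewrite E1 -[- (4 * _)]mulNr -(affine_avgZ (- 4) pth' Cd xr) -(affine_avgZ _ pth C0 xr).
have C1 := CkZ (- (2 * n.+1%:R)) oB C0; have C2 := CkZ (- 4) oB Cd.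
have I1 := integrable_along_path pth C1 xr; have I2 := integrable_along_path pth' C2 xr.
have c1 := continuous_along_path pth C1 xr; have c2 := continuous_along_path pth' C2 xr.
rewrite -(RintegralD _ I1 I2); last exact: measurable_I01.
(* The integrand of the two surviving Leibniz terms; its primitive t^(n+1) q(t^2 x) vanishes at t =
   0. *)
pose F' (t : R) := radial_weight t * (- (2 * n.+1%:R) * q (t ^+ 2 *: x + 0)) +
  radial_weight t * t ^+ 2 * (- 4 * dq (t ^+ 2 *: x + 0)).
have cF : {within I01, continuous F'} by move=> t; exact: cvgD (c1 t) (c2 t).
have dF t : I01 t -> is_derive t 1 (fun t => t ^+ n.+1 * q (t ^+ 2 *: x + 0)) (F' t).
  move=> It; have := is_derive_radial (CkW Cq) xr It; rewrite -/(dq _).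
  congr is_derive; rewrite /F' /radial_weight (exprS t n).
  set a := q _; set b := dq _; set k : R := n.+1%:R; move: a b k => a b k; by field.
have := Rintegral_FTC dF cF.
by rewrite !expr1n scale1r addr0 mul1r expr0n mul0r subr0.
Qed.

End RadialPotential.

Section DiracSandwich.
Context {R : realType} {m : nat}.
Local Notation Cl := (clifford R m).
Local Notation V := 'rV[R]_m.
Implicit Types (x y : V) (f g : V -> Cl) (A : {set 'I_m}).

Lemma claplacianA f x A : claplacian f x A = laplacian (fun y => f y A) x.
Proof.
rewrite clifford_sumE; apply: eq_bigr => i _.
by rewrite cpartialA (cpartial_coord i f A).
Qed.

Lemma dirac_sandwichA f x A : dirac_sandwich f x A =
  \sum_i \sum_j \sum_B
    partial i (partial j (fun y => f y B)) x * (gen i * blade B * gen j : Cl) A.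
Proof.
rewrite clifford_sumE; apply: eq_bigr => i _; rewrite clifford_sumE; apply: eq_bigr => j _.
rewrite (sandwich_linear (gen i) (gen j)); apply: eq_bigr => B _.
by rewrite cpartialA (cpartial_coord j f B).
Qed.

Definition sandwich_norm A : R := \sum_i \sum_j \sum_B `|(gen i * blade B * gen j : Cl) A|.

Lemma sandwich_norm_ge0 A : 0 <= sandwich_norm A.
Proof. by do 3 (apply: sumr_ge0 => ? _). Qed.

Lemma norm_dirac_sandwich_le (s M : R) f x A :
    (forall i j B, `|s * partial i (partial j (fun y => f y B)) x| <= M) ->
  `|s * dirac_sandwich f x A| <= sandwich_norm A * M.
Proof.
move=> sM; rewrite dirac_sandwichA /sandwich_norm.
do 3 (rewrite mulr_sumr mulr_suml; apply: le_trans (ler_norm_sum _ _ _) _; apply: ler_sum => ? _).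
by rewrite mulrA normrM mulrC ler_wpM2l.
Qed.

Lemma dirac_sandwich_ext (U : set V) f g x : open U -> U x -> {in U, f =1 g} ->
  dirac_sandwich f x = dirac_sandwich g x.
Proof.
move=> oU Ux fg.
have E i j : clifford_partial i (clifford_partial j f) x =
    clifford_partial i (clifford_partial j g) x.
  apply: (cpartial_ext i oU Ux) => y; rewrite inE => Uy.
  exact (cpartial_ext j oU Uy fg).
by rewrite /dirac_sandwich; apply: eq_bigr => i _; apply: eq_bigr => j _; rewrite E.
Qed.

Lemma dirac_sandwich_addZ (U : set V) f g (c : R) x : open U -> clifford_Ck 2 U f ->
    clifford_Ck 2 U g -> U x ->
  dirac_sandwich (fun y => f y + c *: g y) x = dirac_sandwich f x + c *: dirac_sandwich g x.
Proof.
move=> oU Cf Cg Ux.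
have dZ i h y : clifford_Ck 1 U h -> U y ->
    is_cderive y (unit_vec i) (fun y => c *: h y) (c *: clifford_partial i h y).
  move=> Ch Uy A; rewrite clifford_scaleE; under eq_fun do rewrite clifford_scaleE.
  exact: is_deriveMl (clifford_Ck_cderive i Ch Uy A).
have d1 j y : U y -> clifford_partial j (fun y => f y + c *: g y) y =
    clifford_partial j f y + c *: clifford_partial j g y.
  move=> Uy; apply: cpartialE; apply: is_cderive_add.
    exact: clifford_Ck_cderive (clifford_CkW Cf) Uy.
  exact: dZ (clifford_CkW Cg) Uy.
rewrite /dirac_sandwich scaler_sumr -big_split; apply: eq_bigr => i _ /=.
rewrite scaler_sumr -big_split; apply: eq_bigr => j _ /=.
rewrite (cpartial_ext i oU Ux (g := fun y => clifford_partial j f y + c *: clifford_partial j g y))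
  => [|y]; last by rewrite inE; exact: d1.
rewrite scalerAl scalerAr -mulrDl -mulrDr; congr (_ * _ * _); apply: cpartialE.
apply: is_cderive_add; first exact: clifford_Ck_cderive (clifford_Ck_partial j Cf) Ux.
exact: dZ (clifford_Ck_partial j Cg) Ux.
Qed.

End DiracSandwich.

#[local] Opaque clifford_partial dirac_sandwich.

Section Representation.
Context {R : realType} {n : nat}.
Local Notation m := (n.+1).
Local Notation Cl := (clifford R m).
Local Notation V := 'rV[R]_m.
Local Notation S := (@unit_sphere R m).
Local Notation B1 := (@unit_ball R m).
Implicit Types (x y : V) (f g : V -> Cl) (A : {set 'I_m}).

Lemma poissonA g x A : poisson g x A = poisson_int (fun y => g y A) x.
Proof. by rewrite ffunE. Qed.

#[local] Opaque poisson.

Lemma clifford_Ck_poisson k g : (forall A, {within S, continuous (fun y => g y A)}) ->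
  clifford_Ck k unit_ball (poisson g).
Proof.
move=> cg A; have -> : (fun x => poisson g x A) = poisson_int (fun y => g y A).
  by apply/funext => x; exact: poissonA.
exact: Ck_poisson_int.
Qed.

Lemma claplacian_poisson g x : (forall A, {within S, continuous (fun y => g y A)}) ->
  unit_ball x -> claplacian (poisson g) x = 0.
Proof.
move=> cg Bx; apply/ffunP => A; rewrite claplacianA ffunE.
have -> : (fun x => poisson g x A) = poisson_int (fun y => g y A).
  by apply/funext => y; exact: poissonA.
exact: laplacian_poisson_int (cg A) Bx.
Qed.

Lemma Ck_within_continuous (rho : R) k (h : V -> R) (K : set V) : Ck k (eball rho) h ->
  K `<=` eball rho -> {within K, continuous h}.
Proof.
move=> Ch Kr; apply/subspace_continuousP => x Kx; apply: cvg_within_filter.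
exact: Ck_continuous Ch (Kr _ Kx).
Qed.

Section Potential.
Variables (rho : R) (f : V -> Cl).
Hypotheses (m_odd : odd m) (rho_gt1 : 1 < rho) (Cf : clifford_Ck 4 (eball rho) f).
Hypothesis Lf : forall x, eball rho x -> dirac_sandwich f x = 0.

Let oB : open (eball rho : set V) := @open_eball R m rho.
Let h : V -> Cl := cavg (@radial_weight R n) (fun t => t ^+ 2) (fun=> 0) (claplacian f).
Let pth : affine_path rho rho (@radial_weight R n) (fun t => t ^+ 2) (fun=> 0 : V) :=
  path_radial_weight rho.

Let Cq : clifford_Ck 2 (eball rho) (claplacian f).
Proof.
apply: (clifford_Ck_sum oB) => i; exact: clifford_Ck_partial (clifford_Ck_partial i Cf).
Qed.

Let Ch : clifford_Ck 2 (eball rho) h := clifford_Ck_cavg pth Cq.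

Let D0 i x : eball rho x -> clifford_partial i (dirac_sandwich f) x = 0.
Proof.
move=> xr; rewrite (cpartial_ext i oB xr (g := fun=> 0)) => [|y]; last by rewrite inE; exact: Lf.
by apply: cpartialE; exact: is_cderive_cst.
Qed.

Let hl x : eball rho x -> dirac_left h x = 0.
Proof.
move=> xr; rewrite (dirac_left_cavg pth (clifford_CkW Cq) xr).
apply: (cavg0 (path_weightM pth)) xr => y yr; apply/eqP; rewrite -oppr_eq0.
rewrite -(dirac_right_sandwich oB (clifford_CkW Cf) yr); apply/eqP.
by apply: big1 => i _; rewrite D0// mul0r.
Qed.

Let hr x : eball rho x -> dirac_right h x = 0.
Proof.
move=> xr; rewrite (dirac_right_cavg pth (clifford_CkW Cq) xr).
apply: (cavg0 (path_weightM pth)) xr => y yr; apply/eqP; rewrite -oppr_eq0.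
rewrite -(dirac_left_sandwich oB (clifford_CkW Cf) yr); apply/eqP.
by apply: big1 => i _; rewrite D0// mulr0.
Qed.

Let unit_ball_sub : B1 `<=` eball rho.
Proof. by move=> x Bx; exact: lt_trans rho_gt1. Qed.

Let closed_ball_sub : [set x | enorm x <= 1] `<=` (eball rho : set V).
Proof. by move=> x /= x1; exact: le_lt_trans rho_gt1. Qed.

Let poisson_f x : unit_ball x -> poisson f x = f x + (- 1 * (1 - enorm x ^+ 2)) *: h x.
Proof.
move=> Bx; apply/ffunP => A; rewrite poissonA clifford_addE clifford_scaleE.
pose k y := f y A + -1 * ((1 - enorm y ^+ 2) * h y A).
have Cs : Ck 2 (eball rho) (fun y => (1 - enorm y ^+ 2) * h y A).
  apply: (CkM oB) (Ch A); under eq_fun do rewrite -mulN1r.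
  by apply: (CkD oB); [exact: Ck_cst|apply: CkZ => //; exact: Ck_sqr_enorm].
have Cf2 : Ck 2 (eball rho) (fun y => f y A) := CkW (CkW (Cf A)).
have Ckk : Ck 2 (eball rho) k := CkD oB Cf2 (CkZ (-1) oB Cs).
have -> : poisson_int (fun y => f y A) x = poisson_int k x.
  apply: eq_savg => y; rewrite /unit_sphere/= /k => ->.
  by rewrite expr1n subrr mul0r mulr0 addr0.
rewrite (poisson_int_harmonic (Ck_sub unit_ball_sub Ckk)) /k; first by rewrite mulrA.
- exact: Ck_within_continuous Ckk closed_ball_sub.
- move=> y /unit_ball_sub yr; rewrite (laplacianD oB Cf2 (CkZ (-1) oB Cs) yr).
  rewrite (laplacianZ _ oB Cs yr) mulN1r.
  have -> : (fun y => (1 - enorm y ^+ 2) * h y A) =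
      (fun y => (1 - enorm y ^+ 2) * radial_potential (fun y => claplacian f y A) y).
    by apply/funext => z; rewrite /h cavgA.
  rewrite (laplacian_radial_potential (Cq A) yr) ?claplacianA ?subrr//.
  have E : (fun z => h z A) = radial_potential (fun y => claplacian f y A).
    by apply/funext => z; exact: cavgA.
  rewrite -E -(claplacianA h y A) (claplacian_monogenic oB Ch hl yr); exact: clifford0E.
- exact: Bx.
Qed.

Lemma sandwich_representation x : unit_ball x ->
  f x = (2^-1 * (1 - enorm x ^+ 2)) *: psi_inv (dirac_sandwich (poisson f) x) + poisson f x.
Proof.
move=> Bx; have xr := unit_ball_sub Bx.
have oB1 : open (unit_ball : set V) := @open_eball R m 1.
suff -> : dirac_sandwich (poisson f) x = psi (h x) + psi (h x).
  rewrite -psiD psiK// (poisson_f Bx) addrCA; set s := 1 - _; move: (h x) s => a s.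
  have E : (2^-1 * s) *: (a + a) + (-1 * s) *: a = 0.
    by rewrite scalerDr -!scalerDl (_ : _ + _ = 0) ?scale0r//; field.
  by rewrite E addr0.
have -> : dirac_sandwich (poisson f) x =
    dirac_sandwich (fun y => f y + 1 *: ((- 1 * (1 - enorm y ^+ 2)) *: h y)) x.
  apply: (dirac_sandwich_ext oB1 Bx) => y; rewrite inE => By.
  by rewrite scale1r; exact: poisson_f.
have Cs : clifford_Ck 2 (eball rho) (fun y => (- 1 * (1 - enorm y ^+ 2)) *: h y).
  apply: (clifford_Ck_scale oB) Ch; apply: (CkZ _ oB); under eq_fun do rewrite -mulN1r.
  by apply: (CkD oB); [exact: Ck_cst|apply: (CkZ _ oB); exact: Ck_sqr_enorm].
rewrite (dirac_sandwich_addZ 1 oB (fun A => CkW (CkW (Cf A))) Cs xr) (Lf xr) add0r scale1r.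
by rewrite (sandwich_sub_sqr_monogenic oB Ch hl hr _ xr) scaleN1r opprK.
Qed.

End Potential.
End Representation.

#[local] Opaque poisson cavg.

Section AprioriBound.
Context {R : realType} {n : nat}.
Local Notation m := (n.+1).
Local Notation Cl := (clifford R m).
Local Notation V := 'rV[R]_m.
Local Notation S := (@unit_sphere R m).
Implicit Types (x y : V) (f g : V -> Cl) (A : {set 'I_m}).

Lemma norm_poisson_int_le (u : V -> R) x (M : R) : {within S, continuous u} -> unit_ball x ->
  (forall y, S y -> `|u y| <= M) -> `|poisson_int u x| <= M.
Proof.
move=> cu Bx uM; have ck := continuous_poisson_kernel Bx.
have -> : M = savg (fun y => M * poisson_kernel x y).
  by rewrite (savgZ _ ck) (savg_poisson_kernel Bx) mulr1.
apply: norm_savg_le; [exact: within_continuousM|exact: within_continuousZ|].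
move=> y Sy; rewrite normrM ger0_norm ?poisson_kernel_ge0// mulrC.
by rewrite ler_wpM2r ?poisson_kernel_ge0// uM.
Qed.

Lemma norm_partial2_poisson_le f x M i j B : (forall A, {within S, continuous (fun y => f y A)}) ->
    unit_ball x -> (forall y A, S y -> `|f y A| <= M) ->
  `|partial i (partial j (fun y => poisson f y B)) x| <=
    @kernel2_bound R n * (1 - enorm x)^-1 ^+ m.+1 * M.
Proof.
move=> cf Bx fM; have -> : (fun y => poisson f y B) = poisson_int (fun y => f y B).
  by apply/funext => y; exact: poissonA.
by apply: (poisson_int_partial2_le j i (cf B) Bx) => y; exact: fM.
Qed.

(** Read off from the representation formula: the factor (1 - |x|^2) / 2, the coefficient of Psi^-1
    on e_A, and the interior bound on second derivatives of a Poisson integral; the final 1 accounts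
    for the Poisson integral itself. It depends on x and A but neither on f nor on the radius rho,
    so it survives the approximation. *)
Definition solution_bound x A : R :=
  `|2^-1 * (1 - enorm x ^+ 2)| * `|(-1) ^+ #|A|.+1 / (m%:R - (2 * #|A|)%:R)| *
  (sandwich_norm A * (@kernel2_bound R n * (1 - enorm x)^-1 ^+ m.+1)) + 1.

Lemma norm_solution_le (rho : R) f x A (M : R) : odd m -> 1 < rho -> clifford_Ck 4 (eball rho) f ->
    (forall y, eball rho y -> dirac_sandwich f y = 0) -> unit_ball x ->
    (forall y B, S y -> `|f y B| <= M) ->
  `|f x A| <= solution_bound x A * M.
Proof.
move=> om r1 Cf Lf Bx fM.
have cf B : {within S, continuous (fun y => f y B)}.
  by apply: (Ck_within_continuous (Cf B)) => y; rewrite /unit_sphere /eball/= => ->.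
pose K := @kernel2_bound R n * (1 - enorm x)^-1 ^+ m.+1.
have LM : `|dirac_sandwich (poisson f) x A| <= sandwich_norm A * (K * M).
  rewrite -[X in `|X|]mul1r; apply: norm_dirac_sandwich_le => i j B; rewrite mul1r.
  exact: norm_partial2_poisson_le.
rewrite (sandwich_representation om r1 Cf Lf Bx) clifford_addE clifford_scaleE psi_invE.
apply: le_trans (ler_normD _ _) _; rewrite mulrDl mul1r; apply: lerD; last first.
  by rewrite poissonA; apply: (norm_poisson_int_le (cf A) Bx) => y; exact: fM.
rewrite -/K; move: LM; set c1 := 2^-1 * _; set c2 := _ / _; clearbody c1 c2 K.
move: (dirac_sandwich _ _ _) => L LM.
rewrite (normrM c1) (normrM c2) -!(mulrA _ _ M) -(mulrA `|c1|).
by do 2 (apply: ler_wpM2l; first exact: normr_ge0).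
Qed.

End AprioriBound.

(** * Approximation by solutions that are smooth across the sphere *)

Section SmoothApproximation.
Context {R : realType} {m : nat}.
Local Notation Cl := (clifford R m).
Local Notation V := 'rV[R]_m.
Local Notation B1 := (eball 1 : set V).
Implicit Types (x y : V) (f g : V -> Cl) (A : {set 'I_m}).

Lemma exists_common_delta (I : finType) (P : I -> R -> Prop) :
    (forall i d d', d' <= d -> P i d -> P i d') ->
    (forall i, exists2 d, 0 < d & P i d) -> exists2 d, 0 < d & forall i, P i d.
Proof.
move=> Pm dP; have /choice[dl dlP] : forall i, exists d, 0 < d /\ P i d.
  by move=> i; have [d d0 Pd] := dP i; exists d.
exists (\big[Order.min/1]_i dl i).
  by apply: lt_bigmin => // i _; have [] := dlP i.
by move=> i; apply: Pm (proj2 (dlP i)); exact: bigmin_le.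
Qed.

Section ShrinkAverages.
Variable e : R.
Hypothesis e_gt0 : 0 < e.
Hypothesis e_lt1 : e < 1.

Fixpoint cshrink_avgs (L : seq 'I_m) f :=
  if L is i :: L' then
    cavg (fun=> 1) (fun=> 1 - e) (fun t => t *: (e *: unit_vec i)) (cshrink_avgs L' f)
  else f.

Lemma cshrink_avgsA L f A :
  (fun y => cshrink_avgs L f y A) = shrink_avgs e L (fun y => f y A).
Proof.
by elim: L => [//|i L IH] /=; apply/funext => x; rewrite cavgA IH.
Qed.

Lemma clifford_Ck_cshrink_avgs k L f : clifford_Ck k B1 f -> clifford_Ck k B1 (cshrink_avgs L f).
Proof. by move=> Cf A; rewrite cshrink_avgsA; exact: Ck_shrink_avgs. Qed.

Lemma dirac_sandwich_cshrink_avgs L f : clifford_Ck 2 B1 f ->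
    (forall x, B1 x -> dirac_sandwich f x = 0) ->
  forall x, B1 x -> dirac_sandwich (cshrink_avgs L f) x = 0.
Proof.
move=> Cf Lf; elim: L => [//|i L IH] x Bx /=.
have pth := shrink_path e_gt0 e_lt1 i.
rewrite (dirac_sandwich_cavg pth (clifford_Ck_cshrink_avgs L Cf) Bx).
exact: (cavg0 (path_weightM (path_weightM pth))).
Qed.

End ShrinkAverages.

Lemma smooth_approximation f (eta : R) : 0 < eta -> clifford_Ck 2 B1 f ->
    (forall A, {within [set x | enorm x <= 1], continuous (fun x => f x A)}) ->
    (forall x, B1 x -> dirac_sandwich f x = 0) ->
  exists rho g, [/\ 1 < rho, clifford_Ck 4 (eball rho) g,
    forall x, eball rho x -> dirac_sandwich g x = 0 &
    forall y A, enorm y <= 1 -> `|g y A - f y A| <= eta].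
Proof.
move=> eta0 Cf cf Lf.
have [d d0 dP] : exists2 d, 0 < d & forall A x y, enorm x <= 1 -> enorm y <= 1 ->
    enorm (x - y) < d -> `|f x A - f y A| <= eta.
  apply: (exists_common_delta (P := fun A d => forall x y, enorm x <= 1 -> enorm y <= 1 ->
    enorm (x - y) < d -> `|f x A - f y A| <= eta)).
    by move=> A d d' dd h x y x1 y1 xy; apply: h => //; exact: lt_le_trans dd.
  move=> A; have [d d0 dP] := heine_cantor (@compact_enorm_le R m 1) (cf A) eta0.
  by exists d => // x y x1 y1 xy; exact/ltW/dP.
pose L := enum 'I_m; pose N : R := (size L)%:R.
have N0 : 0 <= N by exact: ler0n.
pose d1 := Num.min d 1; have d10 : 0 < d1 by rewrite lt_min d0 ltr01.
have d1d : d1 <= d by rewrite ge_min lexx.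
have d11 : d1 <= 1 by rewrite ge_min lexx orbT.
(* Two rounds of N averages displace a point by at most 4 e N < d1 / 2 and the dilation by at most
   d1 / 4, together less than d, the modulus of continuity for eta. *)
pose e := d1 / (8 * (N + 1)); have e0 : 0 < e by rewrite divr_gt0// mulr_gt0// ltr_wpDl.
have eN : 8 * (e * (N + 1)) = d1 by rewrite /e; field; apply/eqP; lra.
have e1 : e < 1 by have : 0 <= e * N by [rewrite mulr_ge0// ltW]; lra.
have eN4 : 2 * e * N + 2 * e * N < d1 / 2 + d1 / 4 by lra.
(* Composition with the contraction by s < 1 moves the domain from the unit ball to the ball of
   radius 1 / s > 1. *)
pose s := 1 - d1 / 4; have s0 : 0 < s by rewrite /s; lra.
(* The inner round raises C^2 to C^3, the outer one C^3 to C^4. *)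
pose g := cshrink_avgs e L (cshrink_avgs e L f).
have C3 : clifford_Ck 3 B1 (cshrink_avgs e L f).
  by move=> A; rewrite cshrink_avgsA; exact: Ck_gain.
have C4 : clifford_Ck 4 B1 g by move=> A; rewrite cshrink_avgsA; exact: Ck_gain.
have Lg := dirac_sandwich_cshrink_avgs e0 e1 L (clifford_Ck_cshrink_avgs e0 e1 L Cf)
  (dirac_sandwich_cshrink_avgs e0 e1 L Cf Lf).
have pth : affine_path s^-1 1 (fun=> 1) (fun=> s) (fun=> 0 : V).
  apply: (affine_path_const_scale (b := 0)) => //.
  - by move=> t; exact: cst_continuous.
  - exact: continuous_curve_cst.
  - by move=> t _; rewrite enorm0.
  - by rewrite addr0 mulfV// gt_eqF.
exists s^-1, (cavg (fun=> 1) (fun=> s) (fun=> 0) g); split.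
- by rewrite invf_gt1// /s; lra.
- exact: clifford_Ck_cavg pth C4.
- move=> x xr; rewrite (dirac_sandwich_cavg pth (fun A => CkW (CkW (C4 A))) xr).
  exact: cavg0 (path_weightM (path_weightM pth)) Lg xr.
move=> y A y1; rewrite cavgA affine_avg_const addr0.
have sy : B1 (s *: y).
  by rewrite /eball/= enormZ gtr0_norm// (le_lt_trans (ler_piMr (ltW s0) y1))// /s; lra.
have -> : g (s *: y) A = shrink_avgs e L (fun y => cshrink_avgs e L f y A) (s *: y).
  by rewrite -(cshrink_avgsA e L (cshrink_avgs e L f) A).
apply: (shrink_avgs_near e0 e1 (CkW (CkW (CkW (C3 A)))) sy) => z Bz zs.
have -> : cshrink_avgs e L f z A = shrink_avgs e L (fun y => f y A) z.
  by rewrite -(cshrink_avgsA e L f A).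
apply: (shrink_avgs_near e0 e1 (CkW (CkW (Cf A))) Bz) => z' Bz' zz'.
apply: dP => //; first exact: ltW.
apply: lt_le_trans d1d; apply: le_lt_trans (enorm_triangle z _ _) _.
apply: le_lt_trans (lerD zz' (enorm_triangle (s *: y) _ _)) _.
have : enorm (s *: y - y) <= d1 / 4.
  have -> : s *: y - y = (- (d1 / 4)) *: y by rewrite -[X in _ - X]scale1r -scalerBl /s; congr (_ *: _); ring.
  by rewrite enormZ normrN gtr0_norm ?ler_piMr//; lra.
by move: zs eN4; rewrite -/N; lra.
Qed.

End SmoothApproximation.

(** * The Dirichlet problem *)

Section Dirichlet.
Context {R : realType} {n : nat}.
Local Notation m := (n.+1).
Local Notation Cl := (clifford R m).
Local Notation V := 'rV[R]_m.
Local Notation S := (@unit_sphere R m).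
Local Notation B1 := (@unit_ball R m).
Implicit Types (x y : V) (f g : V -> Cl) (A : {set 'I_m}).
Hypothesis m_odd : odd m.

Let oB : open B1 := @open_eball R m 1.

Lemma dirichlet_zero f x : clifford_Ck 2 B1 f ->
    (forall A, {within [set x | enorm x <= 1], continuous (fun x => f x A)}) ->
    (forall x, B1 x -> dirac_sandwich f x = 0) -> (forall y, S y -> f y = 0) ->
  B1 x -> f x = 0.
Proof.
move=> Cf cf Lf f0 Bx; apply/ffunP => A; rewrite clifford0E.
have k0 : 0 <= @kernel2_bound R n by rewrite /kernel2_bound !addr_ge0// !mulr_ge0.
have K0 : 0 <= solution_bound x A.
  apply: addr_ge0 => //; apply: mulr_ge0; first exact: mulr_ge0.
  apply: mulr_ge0; first exact: sandwich_norm_ge0.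
  by apply: mulr_ge0 => //; rewrite exprn_ge0// invr_ge0 subr_ge0; exact: ltW.
suff : `|f x A| <= 0 by rewrite normr_le0 => /eqP.
apply/ler_addgt0Pr => e e0; rewrite add0r.
(* The approximation g is at most eta on the sphere, so |g x| is at most eta times the bound; the
   summand 1 pays for the error |f x - g x| <= eta. *)
pose eta := e / (solution_bound x A + 1).
have eta0 : 0 < eta by rewrite divr_gt0// ltr_wpDl.
have etaE : solution_bound x A * eta + eta = e.
  by rewrite -[X in _ + X]mul1r -mulrDl mulrC divfK// gt_eqF// ltr_wpDl.
have [rho [g [r1 Cg Lg gf]]] := smooth_approximation eta0 Cf cf Lf.
have gS y B : S y -> `|g y B| <= eta.
  by move=> Sy; have := gf y B; rewrite (f0 _ Sy) clifford0E subr0; apply; rewrite Sy.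
have gx := norm_solution_le A m_odd r1 Cg Lg Bx gS.
have fx := gf x A (ltW Bx).
rewrite -etaE -[f x A](subrK (g x A)) (le_trans (ler_normD _ _))// addrC lerD//.
by rewrite distrC.
Qed.

Lemma dirichlet_unique g f f' : dirichlet_solution g f -> dirichlet_solution g f' ->
  forall x, closure unit_ball x -> f' x = f x.
Proof.
move=> [Cf cf Lf fg] [Cf' cf' Lf' fg'] x; rewrite closure_unit_ball in cf cf' * => /= x1.
have d0 z : f' z + -1 *: f z = 0 -> f' z = f z.
  by rewrite scaleN1r => /eqP; rewrite subr_eq0 => /eqP.
move: x1; rewrite le_eqVlt => /orP[/eqP Sx|Bx]; first by rewrite (fg _ Sx) (fg' _ Sx).
have dA A : (fun z => (f' z + -1 *: f z) A) = (fun z => f' z A + -1 * f z A).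
  by apply/funext => z; rewrite clifford_addE clifford_scaleE.
apply: d0; apply: (dirichlet_zero (f := fun z => f' z + -1 *: f z)) Bx.
- by move=> A; rewrite dA; apply: (CkD oB) (CkZ (-1) oB (Cf A)); exact: Cf'.
- by move=> A; rewrite dA; apply: within_continuousD; [exact: cf'|exact: within_continuousZ].
- move=> z Bz; rewrite (dirac_sandwich_addZ (-1) oB Cf' Cf Bz) (Lf' _ Bz) (Lf _ Bz).
  by rewrite scaler0 addr0.
- by move=> y Sy; rewrite (fg _ Sy) (fg' _ Sy) scaleN1r subrr.
Qed.

Section Existence.
Variable g : V -> Cl.
Hypothesis g_C1 : sphere_Ck 1 g.

(** The Poisson integral sees its data only on the sphere, so each component of g can be exchanged
    for a C^1 extension, whose derivatives the decay estimate uses. *)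
Let extension A : exists U (h : V -> R),
  [/\ open U, S `<=` U, Ck 1 U h & forall y, S y -> h y = g y A].
Proof.
have [U [h [oU SU Ch hg]]] := g_C1; exists U, (fun y => h y A); split=> // y Sy.
by rewrite hg.
Qed.

Let ext_continuous U (h : V -> R) : open U -> S `<=` U -> Ck 1 U h -> {within S, continuous h}.
Proof.
move=> oU SU Ch; apply/subspace_continuousP => x Sx; apply: cvg_within_filter.
exact: Ck_continuous Ch (SU _ Sx).
Qed.

Let g_continuous A : {within S, continuous (fun y => g y A)}.
Proof.
have [U [h [oU SU Ch hg]]] := extension A.
have /continuous_within_enormP ch := ext_continuous oU SU Ch.
apply/continuous_within_enormP => x e Sx e0; have [d d0 dP] := ch x e Sx e0.
by exists d => // y Sy xy; rewrite -!hg//; exact: dP.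
Qed.

Let G := poisson g.
Let w := dirac_sandwich G.
Let u := fun y => psi_inv (w y).
Let F x : Cl := (2^-1 * (1 - enorm x ^+ 2)) *: u x + G x.

Let CG k : clifford_Ck k B1 G := clifford_Ck_poisson k g_continuous.

Let Cw k : clifford_Ck k B1 w := clifford_Ck_sandwich oB (CG k.+2).

Let Cu k : clifford_Ck k B1 u := clifford_Ck_linear oB psi_inv_linear (Cw k).

Let Cs : clifford_Ck 2 B1 (fun x => (2^-1 * (1 - enorm x ^+ 2)) *: u x).
Proof.
apply: (clifford_Ck_scale oB) (Cu 2); apply: (CkZ _ oB); under eq_fun do rewrite -mulN1r.
by apply: (CkD oB); [exact: Ck_cst|apply: (CkZ _ oB); exact: Ck_sqr_enorm].
Qed.

Let partial_laplacian0 i x : B1 x -> clifford_partial i (claplacian G) x = 0.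
Proof.
move=> Bx; rewrite (cpartial_ext i oB Bx (g := fun=> 0)) => [|y]; last first.
  by rewrite inE; exact: claplacian_poisson.
by apply: cpartialE; exact: is_cderive_cst.
Qed.

Let wl x : B1 x -> dirac_left w x = 0.
Proof.
move=> Bx; rewrite (dirac_left_sandwich oB (CG 3) Bx) /dirac_right big1 ?oppr0// => i _.
by rewrite partial_laplacian0// mul0r.
Qed.

Let wr x : B1 x -> dirac_right w x = 0.
Proof.
move=> Bx; rewrite (dirac_right_sandwich oB (CG 3) Bx) /dirac_left big1 ?oppr0// => i _.
by rewrite partial_laplacian0// mulr0.
Qed.

Let ul x : B1 x -> dirac_left u x = 0.
Proof. by move=> Bx; have [] := psi_inv_monogenic m_odd oB (Cw 1) wl wr Bx. Qed.

Let ur x : B1 x -> dirac_right u x = 0.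
Proof. by move=> Bx; have [] := psi_inv_monogenic m_odd oB (Cw 1) wl wr Bx. Qed.

Let LF x : B1 x -> dirac_sandwich F x = 0.
Proof.
move=> Bx; pose s y : Cl := (2^-1 * (1 - enorm y ^+ 2)) *: u y.
transitivity (dirac_sandwich (fun y => s y + 1 *: G y) x).
  by apply: (dirac_sandwich_ext oB Bx) => y _; rewrite scale1r.
rewrite (dirac_sandwich_addZ 1 oB Cs (CG 2) Bx) scale1r -/w.
rewrite (sandwich_sub_sqr_monogenic oB (Cu 2) ul ur _ Bx) psi_invK// -/(w x).
have half (a : Cl) : 2^-1 *: (a + a) = a.
  by rewrite scalerDr -scalerDl -[X in X + _]mul1r -[X in _ + X]mul1r -splitr scale1r.
by rewrite half addNr.
Qed.

(** On the component A, Psi^-1 multiplies by the number c, and w is a combination of finitely many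
    second derivatives of Poisson integrals, with coefficients of total size [sandwich_norm A]. Each
    of them decays after multiplication by 1 - |x|^2, and one d serves all. *)
Let F_boundary A p (e : R) : S p -> 0 < e -> exists2 d, 0 < d &
  forall x, B1 x -> enorm (x - p) < d -> `|F x A - g p A| <= e.
Proof.
move=> Sp e0; pose c : R := (-1) ^+ #|A|.+1 / (m%:R - (2 * #|A|)%:R).
pose K := `|c| * sandwich_norm A; have K0 : 0 <= K by rewrite mulr_ge0// sandwich_norm_ge0.
pose eta := e / (K + 1).
have eta0 : 0 < eta by rewrite divr_gt0// ltr_wpDl.
have etaE : K * eta <= e.
  by rewrite mulrCA ler_piMr ?(ltW e0)// ler_pdivrMr ?ltr_wpDl// mul1r lerDl.
have e2 : 0 < e / 2 by rewrite divr_gt0.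
have [d1 d10 d1P] := poisson_int_boundary (@g_continuous A) Sp e2.
have [d2 d20 d2P] : exists2 d, 0 < d & forall t : 'I_m * 'I_m * {set 'I_m},
    forall x, B1 x -> enorm (x - p) < d ->
    `|(1 - enorm x ^+ 2) * partial t.1.1 (partial t.1.2 (fun y => G y t.2)) x| <= eta.
  apply: (exists_common_delta (P := fun t d => forall x, B1 x -> enorm (x - p) < d ->
    `|(1 - enorm x ^+ 2) * partial t.1.1 (partial t.1.2 (fun y => G y t.2)) x| <= eta)).
    by move=> t d d' dd h x Bx xd; apply: h => //; exact: lt_le_trans dd.
  move=> [[i j] B] /=; have [U [h [oU SU Ch hg]]] := extension B.
  have -> : (fun y => G y B) = poisson_int h.
    apply/funext => y; rewrite /G poissonA; apply: eq_savg => z Sz.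
    by rewrite hg.
  exact: (poisson_int_partial2_decay j i oU Ch (SU _ Sp) Sp (ext_continuous oU SU Ch) eta0).
exists (Num.min d1 d2); first by rewrite lt_min d10.
move=> x Bx; rewrite lt_min => /andP[x1 x2].
have h1 : `|G x A - g p A| <= e / 2 by rewrite /G poissonA; exact: d1P.
have h2 : `|(1 - enorm x ^+ 2) * w x A| <= sandwich_norm A * eta.
  apply: norm_dirac_sandwich_le => i j B; exact: (d2P (i, j, B)).
rewrite /F clifford_addE clifford_scaleE (psi_invE (w x) A) -/c.
have -> : 2^-1 * (1 - enorm x ^+ 2) * (c * w x A) =
    2^-1 * (c * ((1 - enorm x ^+ 2) * w x A)) by ring.
rewrite -addrA (le_trans (ler_normD _ _))// [leRHS]splitr lerD//.
rewrite normrM gtr0_norm ?invr_gt0// mulrC ler_pM2r ?invr_gt0// normrM.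
by apply: le_trans etaE; rewrite /K -mulrA ler_wpM2l.
Qed.

Lemma dirichlet_exists : exists2 f, dirichlet_solution g f &
  forall x, B1 x -> f x = F x.
Proof.
pose f x := if enorm x < 1 then F x else g x.
have fF x : B1 x -> f x = F x by rewrite /f /unit_ball/= => ->.
exists f; last exact: fF.
split.
- move=> A; apply: (Ck_ext oB (f := fun x => F x A)); first by move=> x; rewrite inE => /fF->.
  exact: (clifford_CkD oB Cs (CG 2) A).
- move=> A; rewrite closure_unit_ball.
  have -> : (fun x => f x A) = glue (fun x => F x A) (fun x => g x A).
    by apply/funext => x; rewrite /f /glue; case: ifP.
  apply: continuous_glue; [|exact (@g_continuous A)|by move=> p e; exact: F_boundary].
  by move=> x; apply: Ck_continuous; exact: (clifford_CkD oB Cs (CG 2) A).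
- move=> x Bx; rewrite -(LF Bx); apply: (dirac_sandwich_ext oB Bx) => y.
  by rewrite inE => /fF.
- by move=> y; rewrite /f /unit_sphere/= => ->; rewrite ltxx.
Qed.

End Existence.
End Dirichlet.

Theorem corollary1 (R : realType) (m : nat) (g : 'rV[R]_m -> clifford R m)
    (m_odd : odd m) (g_C1 : sphere_Ck 1 g) :
  exists f : 'rV[R]_m -> clifford R m,
    [/\ dirichlet_solution g f,
        forall f', dirichlet_solution g f' ->
          forall x, closure unit_ball x -> f' x = f x &
        forall x, unit_ball x ->
          f x = (2^-1 * (1 - enorm x ^+ 2)) *: psi_inv (dirac_sandwich (poisson g) x)
                + poisson g x].
Proof.
(* Oddness excludes m = 0; with m = n + 1 the surface measure is n-dimensional. *)
case: m => [//|n] in g m_odd g_C1 *.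
have [f sf fE] := dirichlet_exists m_odd g_C1; exists f; split=> //.
by move=> f' sf'; exact (dirichlet_unique m_odd sf sf').
Qed.
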